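(* For all $d\in\mathbb{N}$ and all $\mathbf{n}=(n_1,\ldots,n_d)\in\mathbb{N}^d$, with $\mathbf{z}=(z_1,\ldots,z_d)$, the function $$\operatorname{PLi}_{\mathbf{n}}(\mathbf{z})=\operatorname{Li}_{\mathbf{n}}(\mathbf{z})-(-1)^{|\mathbf{n}|-d}\operatorname{Li}_{\mathbf{n}}(1/z_1,\ldots,1/z_d)$$ lies in $\mathscr{L}^{d-1}_{|\mathbf{n}|}(\mathbf{z})$, where $|\mathbf{n}|=n_1+\cdots+n_d$.
   Context: Multiple polylogarithms $\operatorname{Li}_{\mathbf{n}}(\mathbf{y})=\sum_{0<k_1<\cdots<k_r}\frac{y_1^{k_1}\cdots y_r^{k_r}}{k_1^{n_1}\cdots k_r^{n_r}}$ ($\mathbf{n}\in\mathbb{N}^r$), analytically continued along straight paths from near the origin; functions of $\mathbf{z}$ are considered on the simply connected domain $\{\mathbf{z}\in\mathbb{C}^d: z_iz_{i+1}\cdots z_j\notin[0,\infty)\text{ for all }1\le i\le j\le d\}$. For $n\in\mathbb{N}_0$, $\beta_n(z)=\frac{(2\pi i)^n}{n!}B_n\!\left(\frac12+\frac{\log(-z)}{2\pi i}\right)$, with $\log$ the principal branch and $B_n(x)$ the Bernoulli polynomials. Write $z_{i,j}=\prod_{k=i}^j z_k$. $\mathscr{L}^D_w(\mathbf{z})$ is the $\mathbb{Z}$-linear span of all functions $\prod_{i=1}^d\beta_{k_i}(z_{i,d})\prod_{i=1}^s\operatorname{Li}_{\mathbf{n}^{(i)}}(\mathbf{z}^{(i)})$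 with $\mathbf{k}\in\mathbb{N}_0^d$, $s\in\mathbb{N}_0$, $\mathbf{n}^{(i)}\in\mathbb{N}^{d_i}$ with $d_i>0$, $d_1+\cdots+d_s\le D$, $k_1+\cdots+k_d+\sum_i|\mathbf{n}^{(i)}|=w$, and such that listing all arguments left to right gives $(\mathbf{z}^{(1)},\ldots,\mathbf{z}^{(s)})=(z_{i_1,j_1},\ldots,z_{i_r,j_r})$ with $1\le i_1\le j_1<i_2\le j_2<\cdots<i_r\le j_r\le d$. *)

(* Defs.v *)
From Stdlib Require Import Reals ZArith ClassicalEpsilon.
From Coquelicot Require Import Coquelicot.
From Stdlib Require Import List.
Import ListNotations.
Open Scope C_scope.

(* Vectors are lists; the coordinate z_i of the text (1 <= i <= d) is
   [nth (i - 1) z 0]. *)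

Definition Csum (l : list C) : C := fold_right Cplus 0 l.
Definition Cprod (l : list C) : C := fold_right Cmult 1 l.

(* z_{i,j} = z_i z_{i+1} ... z_j, for 1 <= i <= j <= length z *)
Definition zprod (z : list C) (i j : nat) : C :=
  Cprod (firstn (j - i + 1) (skipn (i - 1) z)).

Definition domain (d : nat) (z : list C) : Prop :=
  length z = d /\
  forall i j : nat, (1 <= i <= j)%nat -> (j <= d)%nat ->
    ~ exists x : R, (0 <= x)%R /\ zprod z i j = RtoC x.

(* Sum of prod_i y_i^{k_i} / k_i^{n_i} over lo < k_1 < ... < k_r <= N. *)
Fixpoint Li_trunc (ny : list (nat * C)) (lo N : nat) : C :=
  match ny with
  | [] => 1
  | (n, y) :: ny' =>
      Csum (map (fun k : nat => y ^ k / RtoC (INR k) ^ n * Li_trunc ny' k N)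
                (seq (S lo) (N - lo)))
  end.

Definition is_Li_series (n : list nat) (y : list C) (v : C) : Prop :=
  filterlim (fun N : nat => Li_trunc (combine n y) 0 N) eventually (locally v).

Definition analytic_at (g : C -> C) (t0 : C) : Prop :=
  exists a : nat -> C,
    locally t0
      (fun t => is_pseries (K := C_AbsRing) (V := C_NormedModule) a (t - t0) (g t)).

(* [v] is the value at [y] of the analytic continuation of the series along
   the straight path t |-> t y, t in [0, 1]: [g] continues t |-> Li_n(t y) from
   a neighbourhood of t = 0 to a neighbourhood of [0, 1] in C. *)
Definition is_Li (n : list nat) (y : list C) (v : C) : Prop :=
  exists g : C -> C,
    (forall t : R, (0 <= t <= 1)%R -> analytic_at g (RtoC t)) /\
    locally (RtoC 0) (fun t => is_Li_series n (map (Cmult t) y) (g t)) /\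
    g 1 = v.

(* Unspecified where no continuation along the straight path exists. *)
Definition Li (n : list nat) (y : list C) : C :=
  epsilon (inhabits (RtoC 0)) (is_Li n y).

(* Principal argument, in (-PI, PI], and principal logarithm, for w <> 0. *)
Definition Carg (w : C) : R :=
  if Rle_dec 0 (Im w) then acos (Re w / Cmod w) else (- acos (Re w / Cmod w))%R.
Definition Clog (w : C) : C := (ln (Cmod w), Carg w).

(* [B_0(x); ...; B_(n-1)(x)], from the coefficient recurrence
   sum_(k <= m) binom(m+1, k) B_k(x) = (m+1) x^m
   of t e^(x t) / (e^t - 1) = sum_m B_m(x) t^m / m!. *)
Fixpoint bernoulli_polys (n : nat) (x : C) : list C :=
  match n with
  | O => []
  | S m =>
      let B := bernoulli_polys m x in
      B ++ [x ^ m -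
            Csum (map (fun k : nat => RtoC (Binomial.C (S m) k) * nth k B 0)
                      (seq 0 m))
            / RtoC (INR (S m))]
  end.
Definition bernoulli_poly (n : nat) (x : C) : C :=
  nth n (bernoulli_polys (S n) x) 0.

Definition two_pi_i : C := RtoC (2 * PI) * Ci.

Definition beta (n : nat) (z : C) : C :=
  two_pi_i ^ n / RtoC (INR (fact n)) *
  bernoulli_poly n (/ 2 + Clog (- z) / two_pi_i).

(* One entry of a factor Li_n(z_{i_1,j_1}, z_{i_2,j_2}, ...): its index and the
   endpoints i, j of its argument z_{i,j}. *)
Record entry : Type := Entry { index : nat; left_end : nat; right_end : nat }.

(* lo < i_1 <= j_1 < i_2 <= j_2 < ... <= d *)
Fixpoint increasing_in (lo d : nat) (l : list entry) : Prop :=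
  match l with
  | [] => True
  | e :: l' =>
      (lo < left_end e <= right_end e)%nat /\ (right_end e <= d)%nat /\
      increasing_in (right_end e) d l'
  end.

(* [k] lists the indices of the beta-factors, [b] the Li-factors. *)
Definition generator (d : nat) (k : list nat) (b : list (list entry))
    (z : list C) : C :=
  Cprod (map (fun i : nat => beta (nth (i - 1) k 0%nat) (zprod z i d)) (seq 1 d)) *
  Cprod (map (fun l : list entry =>
                Li (map index l) (map (fun e => zprod z (left_end e) (right_end e)) l)) b).

Definition admissible (D w d : nat) (k : list nat) (b : list (list entry)) : Prop :=
  length k = d /\
  Forall (fun l => l <> []) b /\
  Forall (fun e => (1 <= index e)%nat) (concat b) /\
  increasing_in 0 d (concat b) /\
  (length (concat b) <= D)%nat /\
  (list_sum k + list_sum (map index (concat b)))%nat = w.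

Definition is_generator (D w d : nat) (f : list C -> C) : Prop :=
  exists (k : list nat) (b : list (list entry)),
    admissible D w d k b /\ forall z, f z = generator d k b z.

Definition in_Zspan (dom : list C -> Prop) (G : (list C -> C) -> Prop)
    (f : list C -> C) : Prop :=
  exists l : list (Z * (list C -> C)),
    Forall (fun p => G (snd p)) l /\
    forall z, dom z -> f z = Csum (map (fun p => RtoC (IZR (fst p)) * snd p z) l).

(* The space L^D_w in d variables. *)
Definition Lspace (D w d : nat) : (list C -> C) -> Prop :=
  in_Zspan (domain d) (is_generator D w d).

Definition PLi (n : list nat) (z : list C) : C :=
  Li n z - (- (1)) ^ (list_sum n - length n) * Li n (map Cinv z).

(* Main.v *)
(* Put [f(w) = w / (1 - w)] and [Y_i = z_i ... z_d]. Starting from the constant 1, multiply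
   by [f(Y_i exp(-s))] and integrate [n_i] times over [[s, +oo)], for i = 1, ..., d; the value
   at [s = 0] is [Li_n(z)], continued to all [z] with [Y_1, ..., Y_d] off [[1, +oo)]. Bounded
   linear operators of this kind preserve Taylor expansions in a parameter, which gives the
   analyticity along the path [t z].

   Write [I] for the integration of a function of [log z_1] from [z_1 = 0]. In [Li_n(1/z)],
   Jonquiere's inversion formula replaces the innermost function by a polynomial
   [beta_(n_1)(Y_1 exp s)] and a function that vanishes, like [Li_n(z)], as [z_1 -> 0]. By the
   partial fraction expansion of [f(w) f(z_1 w)], what remains of [Li_n(z)] and [Li_n(1/z)] is
   an [n_1]-fold integral [I^(n_1)] of functions of depth d - 1, and for [n = (n_1, n')] one gets
     PLi_n(z) = - Li_(n_1 + n_2, n_3, ...)(z_1 z_2, z_3, ...)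
                -+ (the contribution of beta_(n_1)(Y_1 exp s))
                + I^(n_1) [f(z_1) (PLi_n'(z_2, z_3, ...) - PLi_n'(z_1 z_2, z_3, ...))].
   No constant of integration occurs, since every term is integrated from [z_1 = 0]. The beta
   contribution is expanded by repeated integration by parts, which only lowers the index of
   beta and raises those of Li; it involves [Li(1/z_2, ..., 1/z_d)], to which the induction
   hypothesis applies. So does it to PLi_n'; in the integral of a generator, beta is again
   integrated by parts, and f(z_1) times a difference of two values of Li integrates to a Li
   with the new first argument [z_1] and one whose first argument has absorbed [z_1]. *)

From Stdlib Require Import Reals ZArith Lra Lia FunctionalExtensionality ClassicalEpsilon.
From Coquelicot Require Import Coquelicot.
From Stdlib Require Import List.
Require Import Defs.
Import ListNotations.
Local Open Scope R_scope.

(** * Integrals over half-lines *)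

Definition tailR (h : R -> R) (s : R) : R :=
  real (Lim_seq (fun N => RInt h s (INR N))).

Section RealTail.
Variables (h : R -> R) (C c : R).
Hypothesis hcont : forall s, continuous h s.
Hypothesis c_pos : 0 < c.
Hypothesis hbound : forall s, 0 <= s -> Rabs (h s) <= C * exp (- c * s).

Lemma ex_RInt_cont (a b : R) : ex_RInt h a b.
Proof. apply (ex_RInt_continuous (V := R_CompleteNormedModule)); intros; apply hcont. Qed.

Lemma RInt_exp_decay (a b : R) :
  RInt (fun s => C * exp (- c * s)) a b = C / c * (exp (- c * a) - exp (- c * b)).
Proof.
  apply is_RInt_unique.
  replace (C / c * (exp (- c * a) - exp (- c * b)))
    with (minus (- (C / c) * exp (- c * b)) (- (C / c) * exp (- c * a)))
    by (unfold minus, plus, opp; simpl; ring).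
  apply (is_RInt_derive (fun s => - (C / c) * exp (- c * s))).
  - intros x _. auto_derive; auto. field. lra.
  - intros x _. apply (ex_derive_continuous (fun s => C * exp (- c * s))). auto_derive; auto.
Qed.

Lemma RInt_tail_bound (a b : R) : 0 <= a <= b -> Rabs (RInt h a b) <= C / c * exp (- c * a).
Proof.
  intros [ha hab].
  apply Rle_trans with (RInt (fun s => C * exp (- c * s)) a b).
  -
    apply Rle_trans with (RInt (fun t => Rabs (h t)) a b).
    + apply abs_RInt_le; [exact hab|apply ex_RInt_cont].
    + apply RInt_le; [exact hab| | |].
      * apply (ex_RInt_continuous (V := R_CompleteNormedModule)); intros; apply continuous_comp; [apply hcont|apply continuous_Rabs].
      * apply (ex_RInt_continuous (V := R_CompleteNormedModule)); intros.
        apply (ex_derive_continuous (fun s => C * exp (- c * s))). auto_derive; auto.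
      * intros x hx. apply hbound; lra.
  - rewrite RInt_exp_decay.
    assert (0 <= C).
    { pose proof (hbound 0 (Rle_refl 0)). rewrite Rmult_0_r, exp_0 in H.
      pose proof (Rabs_pos (h 0)). lra. }
    assert (0 <= C / c) by (apply Rmult_le_pos; [lra|left; apply Rinv_0_lt_compat; lra]).
    pose proof (exp_pos (- c * b)). nra.
Qed.

Lemma exp_decay_lim : is_lim_seq (fun N => C / c * exp (- c * INR N)) 0.
Proof.
  replace (Finite 0) with (Rbar_mult (C / c) 0) by (simpl; f_equal; ring).
  apply (is_lim_seq_scal_l _ (C / c) 0).
  assert (H : is_lim_seq (fun N => (exp (- c)) ^ N) 0).
  { apply is_lim_seq_geom. rewrite Rabs_pos_eq by (left; apply exp_pos).
    rewrite <- exp_0. apply exp_increasing. lra. }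
  eapply is_lim_seq_ext; [|exact H].
  intros n. simpl. induction n; simpl.
  - rewrite Rmult_0_r, exp_0. reflexivity.
  - rewrite IHn, <- exp_plus. f_equal. destruct n; simpl; ring.
Qed.

Lemma tailR_cvg (s : R) : is_lim_seq (fun N => RInt h s (INR N)) (tailR h s).
Proof.
  apply Lim_seq_correct'.
  apply ex_lim_seq_cauchy_corr. intros eps.
  pose proof exp_decay_lim as He.
  apply is_lim_seq_spec in He. destruct (He eps) as [N0 HN0].
  exists N0.
  assert (key : forall n m, (N0 <= n <= m)%nat ->
                Rabs (RInt h s (INR n) - RInt h s (INR m)) < eps).
  { intros n m [hn hm].
    replace (RInt h s (INR n) - RInt h s (INR m)) with (- RInt h (INR n) (INR m)).
    2: { rewrite <- (RInt_Chasles h s (INR n) (INR m)) by apply ex_RInt_cont.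
         unfold plus; simpl. ring. }
    rewrite Rabs_Ropp.
    eapply Rle_lt_trans.
    - apply RInt_tail_bound. split; [apply pos_INR|apply le_INR; lia].
    - specialize (HN0 n hn). rewrite Rminus_0_r in HN0.
      eapply Rle_lt_trans; [apply Rle_abs|exact HN0]. }
  intros n m hn hm. destruct (Nat.le_gt_cases n m).
  - apply key; lia.
  - rewrite Rabs_minus_sym. apply key; lia.
Qed.

Lemma tailR_bound (s : R) : 0 <= s -> Rabs (tailR h s) <= C / c * exp (- c * s).
Proof.
  intros hs.
  pose proof (is_lim_seq_abs _ _ (tailR_cvg s)) as H. simpl in H.
  change (Rbar_le (Finite (Rabs (tailR h s))) (Finite (C / c * exp (- c * s)))).
  eapply is_lim_seq_le_loc; [|exact H|apply is_lim_seq_const].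
  destruct (INR_unbounded s) as [n0 Hn0].
  exists n0. intros n hn. apply RInt_tail_bound.
  apply le_INR in hn. lra.
Qed.

Lemma tailR_chasles (s : R) : tailR h s = tailR h 0 - RInt h 0 s.
Proof.
  assert (H : is_lim_seq (fun N => RInt h s (INR N)) (Finite (tailR h 0 - RInt h 0 s))).
  { eapply is_lim_seq_ext.
    2: apply (is_lim_seq_minus' _ (fun _ => RInt h 0 s) _ _ (tailR_cvg 0) (is_lim_seq_const _)).
    intros n. simpl.
    rewrite <- (RInt_Chasles h 0 s (INR n)) by apply ex_RInt_cont.
    unfold plus; simpl. ring. }
  apply is_lim_seq_unique in H. unfold tailR at 1. rewrite H. reflexivity.
Qed.

Lemma tailR_derive (s : R) : is_derive (tailR h) s (- h s).
Proof.
  apply is_derive_ext with (fun s => tailR h 0 - RInt h 0 s).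
  { intros t. symmetry. apply tailR_chasles. }
  replace (- h s) with (minus 0 (h s)) by (unfold minus, plus, opp; simpl; ring).
  apply (is_derive_minus (fun _ => tailR h 0) (fun s => RInt h 0 s)).
  - apply is_derive_Reals. apply derivable_pt_lim_const.
  - apply (is_derive_RInt h (fun s => RInt h 0 s) 0).
    + exists (mkposreal 1 Rlt_0_1). intros y _. apply (RInt_correct (V := R_CompleteNormedModule) h 0 y). apply ex_RInt_cont.
    + apply hcont.
Qed.
End RealTail.

Local Open Scope C_scope.

Definition contC (h : R -> C) : Prop :=
  forall s, continuous (fun t => Re (h t)) s /\ continuous (fun t => Im (h t)) s.

Definition derC (G : R -> C) (s : R) (l : C) : Prop :=
  is_derive (fun t => Re (G t)) s (Re l) /\ is_derive (fun t => Im (G t)) s (Im l).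

Lemma C_eq (a b : C) : Re a = Re b -> Im a = Im b -> a = b.
Proof. destruct a, b; simpl; congruence. Qed.

Lemma Re_le_Cmod (z : C) : (Rabs (Re z) <= Cmod z)%R.
Proof. eapply Rle_trans; [apply Rmax_l|apply Rmax_Cmod]. Qed.

Lemma Im_le_Cmod (z : C) : (Rabs (Im z) <= Cmod z)%R.
Proof. eapply Rle_trans; [apply Rmax_r|apply Rmax_Cmod]. Qed.

Lemma Cmod_le_Re_Im (z : C) : (Cmod z <= Rabs (Re z) + Rabs (Im z))%R.
Proof.
  replace z with (RtoC (Re z) + (Im z) * Ci) at 1 by (apply C_eq; simpl; ring).
  eapply Rle_trans; [apply Cmod_triangle|].
  rewrite Cmod_mult, !Cmod_R.
  rewrite Cmod_Ci. lra.
Qed.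

Lemma contC_const (a : C) : contC (fun _ => a).
Proof. split; apply continuous_const. Qed.

Lemma contC_plus (f g : R -> C) : contC f -> contC g -> contC (fun s => f s + g s).
Proof. intros hf hg s; destruct (hf s), (hg s); split; simpl; now apply (continuous_plus (V := R_NormedModule)). Qed.

Lemma contC_opp (f : R -> C) : contC f -> contC (fun s => - f s).
Proof. intros hf s; destruct (hf s); split; simpl; now apply (continuous_opp (V := R_NormedModule)). Qed.

Lemma contC_mult (f g : R -> C) : contC f -> contC g -> contC (fun s => f s * g s).
Proof.
  intros hf hg s; destruct (hf s), (hg s); split; simpl.
  - apply (continuous_minus (V := R_NormedModule)); now apply (continuous_mult (K := R_AbsRing)).
  - apply (continuous_plus (V := R_NormedModule)); now apply (continuous_mult (K := R_AbsRing)).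
Qed.

Lemma contC_comp (f : R -> C) (u : R -> R) :
  (forall s, continuous u s) -> contC f -> contC (fun s => f (u s)).
Proof.
  intros hu hf s; destruct (hf (u s)); split.
  - apply (continuous_comp u (fun t => Re (f t))); auto.
  - apply (continuous_comp u (fun t => Im (f t))); auto.
Qed.

Lemma contC_RtoC (u : R -> R) : (forall s, continuous u s) -> contC (fun s => RtoC (u s)).
Proof. intros hu s; split; simpl; [apply hu|apply continuous_const]. Qed.

Lemma contC_inv (f : R -> C) : contC f -> (forall s, f s <> 0) -> contC (fun s => / f s).
Proof.
  intros hf hz s. destruct (hf s) as [h1 h2].
  assert (hn : (Re (f s) ^ 2 + Im (f s) ^ 2 <> 0)%R).
  { intros e. apply (hz s). apply C_eq; simpl; nra. }
  assert (hsq : forall u : R -> R, continuous u s -> continuous (fun t => u t ^ 2)%R s).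
  { intros u hu. apply (continuous_comp u (fun x => x ^ 2)%R); auto.
    apply (ex_derive_continuous (fun x => x ^ 2)%R). auto_derive; auto. }
  assert (hd : continuous (fun t => Re (f t) ^ 2 + Im (f t) ^ 2)%R s).
  { apply (continuous_plus (V := R_NormedModule)
      (fun t => Re (f t) ^ 2)%R (fun t => Im (f t) ^ 2)%R); now apply hsq. }
  assert (hi : continuous (fun t => / (Re (f t) ^ 2 + Im (f t) ^ 2))%R s).
  { apply (continuous_comp (fun t => Re (f t) ^ 2 + Im (f t) ^ 2)%R Rinv); auto.
    apply continuous_Rinv; auto. }
  unfold Cinv; split; simpl Re; simpl Im; unfold Rdiv; apply (continuous_mult (K := R_AbsRing)); auto.
  now apply (continuous_opp (V := R_NormedModule)).
Qed.

Lemma derC_const (a : C) (s : R) : derC (fun _ => a) s 0.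
Proof. split; simpl; apply (is_derive_const (V := R_NormedModule)). Qed.

Lemma derC_plus (f g : R -> C) s a b : derC f s a -> derC g s b -> derC (fun t => f t + g t) s (a + b).
Proof. intros [? ?] [? ?]; split; simpl; now apply (is_derive_plus (V := R_NormedModule)). Qed.

Lemma derC_opp (f : R -> C) s a : derC f s a -> derC (fun t => - f t) s (- a).
Proof. intros [? ?]; split; simpl; now apply (is_derive_opp (V := R_NormedModule)). Qed.

Lemma derC_minus (f g : R -> C) s a b : derC f s a -> derC g s b -> derC (fun t => f t - g t) s (a - b).
Proof. intros; apply derC_plus; auto using derC_opp. Qed.

Lemma derC_eq (f : R -> C) s a b : derC f s a -> a = b -> derC f s b.
Proof. now intros h <-. Qed.

Lemma derC_mult (f g : R -> C) s a b :
  derC f s a -> derC g s b -> derC (fun t => f t * g t) s (a * g s + f s * b).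
Proof.
  intros [h1 h2] [h3 h4]; split; simpl.
  - replace (_ + _)%R with (minus (plus (mult (Re a) (Re (g s))) (mult (Re (f s)) (Re b))) (plus (mult (Im a) (Im (g s))) (mult (Im (f s)) (Im b)))).
    + apply (is_derive_minus (V := R_NormedModule)); apply (is_derive_mult (K := R_AbsRing)); auto; intros; apply Rmult_comm.
    + unfold minus, plus, mult, opp; simpl. unfold Re, Im; ring.
  - replace (_ + _)%R with (plus (plus (mult (Re a) (Im (g s))) (mult (Re (f s)) (Im b))) (plus (mult (Im a) (Re (g s))) (mult (Im (f s)) (Re b)))).
    + apply (is_derive_plus (V := R_NormedModule)); apply (is_derive_mult (K := R_AbsRing)); auto; intros; apply Rmult_comm.
    + unfold minus, plus, mult, opp; simpl. unfold Re, Im; ring.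
Qed.

Lemma derC_scal (c : C) (f : R -> C) s a : derC f s a -> derC (fun t => c * f t) s (c * a).
Proof.
  intros h. eapply derC_eq; [apply derC_mult; [apply derC_const|exact h]|]. cbv beta; ring.
Qed.

Lemma derC_comp (f : R -> C) (u : R -> R) s a du :
  derC f (u s) a -> is_derive u s du -> derC (fun t => f (u t)) s (RtoC du * a).
Proof.
  intros [h1 h2] hu; split; simpl.
  - replace (_ - _)%R with (scal du (Re a)) by (unfold scal; simpl; unfold mult; simpl; unfold Re; ring).
    apply (is_derive_comp (fun t => Re (f t)) u); auto.
  - replace (_ + _)%R with (scal du (Im a)) by (unfold scal; simpl; unfold mult; simpl; unfold Im; ring).
    apply (is_derive_comp (fun t => Im (f t)) u); auto.
Qed.

Lemma derC_RtoC (u : R -> R) s du : is_derive u s du -> derC (fun t => RtoC (u t)) s (RtoC du).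
Proof. intros h; split; simpl; [exact h|apply (is_derive_const (V := R_NormedModule))]. Qed.

Lemma derC_shift (f : R -> C) (b s : R) a : derC f (s + b) a -> derC (fun t => f (t + b)%R) s a.
Proof.
  intros h. eapply derC_eq; [apply (derC_comp f (fun t => t + b)%R s a 1); auto|ring].
  auto_derive; auto.
Qed.

Lemma derC_cont (f df : R -> C) : (forall s, derC f s (df s)) -> contC f.
Proof.
  intros h s. destruct (h s) as [h1 h2].
  split; apply (ex_derive_continuous (K := R_AbsRing) (V := R_NormedModule)); eexists; eauto.
Qed.

Lemma derive_zero_const (f : R -> R) (a b : R) :
  (forall s, (Rmin a b <= s <= Rmax a b)%R -> is_derive f s 0) -> f a = f b.
Proof.
  intros h.
  destruct (MVT_gen f a b (fun _ => 0)) as [c [_ hc]].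
  - intros x hx. apply h. lra.
  - intros x hx. apply continuity_pt_filterlim.
    apply (ex_derive_continuous (K := R_AbsRing) (V := R_NormedModule)). eexists. apply h; auto.
  - lra.
Qed.

Lemma derC_zero_const (f : R -> C) (a b : R) :
  (forall s, (Rmin a b <= s <= Rmax a b)%R -> derC f s 0) -> f a = f b.
Proof.
  intros h. apply C_eq.
  - apply (derive_zero_const (fun t => Re (f t))). intros s hs; apply (h s hs).
  - apply (derive_zero_const (fun t => Im (f t))). intros s hs; apply (h s hs).
Qed.

Definition tail (h : R -> C) (s : R) : C :=
  (tailR (fun t => Re (h t)) s, tailR (fun t => Im (h t)) s).

Definition decaying (h : R -> C) : Prop :=
  contC h /\ exists C c : R, (0 < c)%R /\ forall s, (0 <= s)%R -> (Cmod (h s) <= C * exp (- c * s))%R.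

Lemma tail_bound (h : R -> C) (C c : R) :
  contC h -> (0 < c)%R -> (forall s, (0 <= s)%R -> (Cmod (h s) <= C * exp (- c * s))%R) ->
  forall s, (0 <= s)%R -> (Cmod (tail h s) <= 2 * C / c * exp (- c * s))%R.
Proof.
  intros hc c0 hb s hs.
  eapply Rle_trans; [apply Cmod_le_Re_Im|]. simpl.
  pose proof (tailR_bound (fun t => Re (h t)) C c (fun s => proj1 (hc s)) c0
    (fun s hs => Rle_trans _ _ _ (Re_le_Cmod _) (hb s hs)) s hs).
  pose proof (tailR_bound (fun t => Im (h t)) C c (fun s => proj2 (hc s)) c0
    (fun s hs => Rle_trans _ _ _ (Im_le_Cmod _) (hb s hs)) s hs).
  unfold Rdiv in *. lra.
Qed.

Lemma tail_derC (h : R -> C) (s : R) : decaying h -> derC (tail h) s (- h s).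
Proof.
  intros [hc [C [c [c0 hb]]]]. split; simpl.
  - apply (tailR_derive (fun t => Re (h t)) C c (fun s => proj1 (hc s)) c0
    (fun s hs => Rle_trans _ _ _ (Re_le_Cmod _) (hb s hs)) s).
  - apply (tailR_derive (fun t => Im (h t)) C c (fun s => proj2 (hc s)) c0
    (fun s hs => Rle_trans _ _ _ (Im_le_Cmod _) (hb s hs)) s).
Qed.

Lemma tail_decaying (h : R -> C) : decaying h -> decaying (tail h).
Proof.
  intros hW. split.
  - apply (derC_cont _ (fun s => - h s)). intros; now apply tail_derC.
  - destruct hW as [hc [C [c [c0 hb]]]].
    exists (2 * C / c)%R, c. split; auto. now apply tail_bound.
Qed.

Lemma exp_decay_zero (C c x a : R) : (0 < c)%R ->
  (forall s, (a <= s)%R -> (x <= C * exp (- c * s))%R) -> (x <= 0)%R.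
Proof.
  intros c0 h. destruct (Rle_dec x 0) as [|hx]; auto. exfalso.
  assert (x0 : (0 < x)%R) by lra.
  set (s := Rmax a ((1 + Rabs C / x) / c)).
  assert (hs : (a <= s)%R) by apply Rmax_l.
  assert (hs' : ((1 + Rabs C / x) / c <= s)%R) by apply Rmax_r.
  specialize (h s hs).
  assert (hcs : (1 + Rabs C / x <= c * s)%R).
  { replace (1 + Rabs C / x)%R with (c * ((1 + Rabs C / x) / c))%R by (field; lra).
    apply Rmult_le_compat_l; lra. }
  assert (hp := exp_ineq1_le (c * s)).
  replace (- c * s)%R with (- (c * s))%R in h by ring.
  rewrite exp_Ropp in h.
  assert (he := exp_pos (c * s)).
  apply (Rmult_le_compat_r (exp (c * s))) in h; [|lra].
  rewrite Rmult_assoc, Rinv_l, Rmult_1_r in h by lra.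
  assert (Rabs C + 2 * x <= x * exp (c * s))%R.
  { apply Rle_trans with (x * (1 + (1 + Rabs C / x)))%R.
    - right. field. lra.
    - apply Rmult_le_compat_l; lra. }
  pose proof (Rle_abs C). lra.
Qed.

Definition exp_decay (G : R -> C) : Prop :=
  exists C c : R, (0 < c)%R /\ forall s, (0 <= s)%R -> (Cmod (G s) <= C * exp (- c * s))%R.

Lemma exp_decay_minus (f g : R -> C) : exp_decay f -> exp_decay g -> exp_decay (fun s => f s - g s).
Proof.
  intros [C1 [c1 [h1 b1]]] [C2 [c2 [h2 b2]]].
  exists (Rabs C1 + Rabs C2)%R, (Rmin c1 c2). split; [now apply Rmin_glb_lt|].
  intros s hs. eapply Rle_trans; [apply Cmod_triangle|]. rewrite Cmod_opp.
  assert (aux : forall C c, (Rmin c1 c2 <= c -> C * exp (- c * s) <= Rabs C * exp (- Rmin c1 c2 * s))%R).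
  { intros C c hc. apply Rle_trans with (Rabs C * exp (- c * s))%R.
    - apply Rmult_le_compat_r; [left; apply exp_pos|apply Rle_abs].
    - apply Rmult_le_compat_l; [apply Rabs_pos|].
      assert (- c * s <= - Rmin c1 c2 * s)%R by nra.
      destruct H; [left; now apply exp_increasing|right; now rewrite H]. }
  rewrite Rmult_plus_distr_r. apply Rplus_le_compat.
  - eapply Rle_trans; [apply b1; auto|]. apply aux. apply Rmin_l.
  - eapply Rle_trans; [apply b2; auto|]. apply aux. apply Rmin_r.
Qed.

Lemma tail_unique (h G : R -> C) : decaying h -> (forall s, derC G s (- h s)) -> exp_decay G -> G = tail h.
Proof.
  intros hW hG hd. apply functional_extensionality. intros s.
  pose proof (tail_decaying h hW) as [_ hI].
  destruct (exp_decay_minus _ _ hd hI) as [C [c [c0 hb]]].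
  assert (hz : (Cmod (G s - tail h s) <= 0)%R).
  { apply (exp_decay_zero C c _ 0 c0). intros t ht.
    replace (G s - tail h s) with (G t - tail h t); auto.
    apply (derC_zero_const (fun t => G t - tail h t)). intros u _.
    eapply derC_eq; [apply derC_minus; [apply hG|now apply tail_derC]|]. ring. }
  assert (h0 : Cmod (G s - tail h s) = 0%R) by (pose proof (Cmod_ge_0 (G s - tail h s)); lra).
  apply Cmod_eq_0 in h0.
  replace (G s) with (G s - tail h s + tail h s) by ring. rewrite h0. ring.
Qed.

Lemma decaying_exp_decay (h : R -> C) : decaying h -> exp_decay h.
Proof. now intros [_ H]. Qed.

Lemma exp_decay_opp (f : R -> C) : exp_decay f -> exp_decay (fun s => - f s).
Proof. intros [C [c [c0 b]]]; exists C, c; split; auto. intros; rewrite Cmod_opp; auto. Qed.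

Lemma exp_decay_plus (f g : R -> C) : exp_decay f -> exp_decay g -> exp_decay (fun s => f s + g s).
Proof.
  intros hf hg. destruct (exp_decay_minus _ _ hf (exp_decay_opp _ hg)) as [C [c [c0 b]]].
  exists C, c; split; auto. intros s hs. specialize (b s hs).
  now replace (f s + g s) with (f s - - g s) by ring.
Qed.

Lemma exp_decay_scal (a : C) (f : R -> C) : exp_decay f -> exp_decay (fun s => a * f s).
Proof.
  intros [C [c [c0 b]]]; exists (Cmod a * C)%R, c; split; auto.
  intros s hs. rewrite Cmod_mult, Rmult_assoc. apply Rmult_le_compat_l; auto. apply Cmod_ge_0.
Qed.

Lemma decaying_plus (f g : R -> C) : decaying f -> decaying g -> decaying (fun s => f s + g s).
Proof. intros [] []; split; [now apply contC_plus|now apply exp_decay_plus]. Qed.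

Lemma decaying_scal (a : C) (f : R -> C) : decaying f -> decaying (fun s => a * f s).
Proof. intros []; split; [apply contC_mult; auto using contC_const|now apply exp_decay_scal]. Qed.

Lemma decaying_opp (f : R -> C) : decaying f -> decaying (fun s => - f s).
Proof. intros []; split; [now apply contC_opp|now apply exp_decay_opp]. Qed.

Lemma decaying_minus (f g : R -> C) : decaying f -> decaying g -> decaying (fun s => f s - g s).
Proof. intros; apply decaying_plus; auto using decaying_opp. Qed.

Lemma decaying_zero : decaying (fun _ => 0).
Proof.
  split; [apply contC_const|]. exists 0%R, 1%R. split; [lra|]. intros. rewrite Cmod_0. lra.
Qed.

Lemma tail_plus (f g : R -> C) : decaying f -> decaying g -> tail (fun s => f s + g s) = (fun s => tail f s + tail g s).
Proof.
  intros hf hg. symmetry. apply tail_unique.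
  - now apply decaying_plus.
  - intros s. eapply derC_eq; [apply derC_plus; now apply tail_derC|]. ring.
  - apply exp_decay_plus; apply decaying_exp_decay; now apply tail_decaying.
Qed.

Lemma tail_scal (a : C) (f : R -> C) : decaying f -> tail (fun s => a * f s) = (fun s => a * tail f s).
Proof.
  intros hf. symmetry. apply tail_unique.
  - now apply decaying_scal.
  - intros s. eapply derC_eq; [apply derC_scal; now apply tail_derC|]. ring.
  - apply exp_decay_scal; apply decaying_exp_decay; now apply tail_decaying.
Qed.

Lemma tail_ext_ge (f g : R -> C) (s : R) : (forall u, (s <= u)%R -> f u = g u) ->
  (0 <= s)%R -> contC f -> contC g -> tail f s = tail g s.
Proof.
  intros h hs hf hg.
  assert (aux : forall (a b : R -> R), (forall u, (s <= u)%R -> a u = b u) -> tailR a s = tailR b s).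
  { intros a b hab. unfold tailR. f_equal. apply Lim_seq_ext_loc.
    destruct (INR_unbounded s) as [n0 Hn0]. exists n0. intros n hn.
    apply le_INR in hn. apply RInt_ext. intros x hx. rewrite Rmin_left in hx by lra. apply hab; lra. }
  unfold tail. f_equal; apply aux; intros; now rewrite h.
Qed.

Definition tail_iter (n : nat) (h : R -> C) : R -> C := Nat.iter n tail h.

Lemma tail_iter_S (n : nat) (h : R -> C) : tail_iter (S n) h = tail (tail_iter n h).
Proof. reflexivity. Qed.

Lemma tail_iter_S_r (n : nat) (h : R -> C) : tail_iter (S n) h = tail_iter n (tail h).
Proof. unfold tail_iter. now rewrite Nat.iter_succ_r. Qed.

Lemma tail_iter_add (n m : nat) (h : R -> C) : tail_iter (n + m) h = tail_iter n (tail_iter m h).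
Proof. unfold tail_iter. now rewrite Nat.iter_add. Qed.

Lemma tail_iter_decaying (n : nat) (h : R -> C) : decaying h -> decaying (tail_iter n h).
Proof. intros hW; induction n; simpl; auto. now apply tail_decaying. Qed.

Lemma tail_iter_plus (n : nat) (f g : R -> C) : decaying f -> decaying g ->
  tail_iter n (fun s => f s + g s) = (fun s => tail_iter n f s + tail_iter n g s).
Proof.
  intros hf hg; induction n; simpl; auto. unfold tail_iter in *; simpl. rewrite IHn.
  apply tail_plus; now apply tail_iter_decaying.
Qed.

Lemma tail_iter_scal (n : nat) (a : C) (f : R -> C) : decaying f -> tail_iter n (fun s => a * f s) = (fun s => a * tail_iter n f s).
Proof.
  intros hf; induction n; simpl; auto. unfold tail_iter in *; simpl. rewrite IHn.
  apply tail_scal; now apply tail_iter_decaying.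
Qed.

(** * Iterated integration against decaying kernels *)

Definition kernel_bound (K : R) (phi : R -> C) : Prop :=
  forall s, (0 <= s)%R -> (Cmod (phi s) <= K * exp (- s))%R.
Definition kernel (phi : R -> C) : Prop := contC phi /\ exists K : R, kernel_bound K phi.
Definition moderate_le (A : R) (g : R -> C) : Prop :=
  forall s, (0 <= s)%R -> (Cmod (g s) <= A * exp (s / 2))%R.
Definition moderate (g : R -> C) : Prop := contC g /\ exists A : R, moderate_le A g.

Lemma exp_le (x y : R) : (x <= y)%R -> (exp x <= exp y)%R.
Proof. intros [h|h]; [left; now apply exp_increasing|right; now rewrite h]. Qed.

Lemma moderate_le_nonneg (A : R) (g : R -> C) : moderate_le A g -> (0 <= A)%R.
Proof.
  intros h. specialize (h 0%R (Rle_refl 0)).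
  pose proof (Cmod_ge_0 (g 0%R)). replace (0 / 2)%R with 0%R in h by lra.
  rewrite exp_0 in h. lra.
Qed.

Lemma kernel_bound_nonneg (K : R) (phi : R -> C) : kernel_bound K phi -> (0 <= K)%R.
Proof.
  intros h. specialize (h 0%R (Rle_refl 0)).
  pose proof (Cmod_ge_0 (phi 0%R)). rewrite Ropp_0, exp_0 in h. lra.
Qed.

Lemma moderate_bounded (g : R -> C) (A : R) :
  contC g -> (forall s, (0 <= s)%R -> (Cmod (g s) <= A)%R) -> moderate g.
Proof.
  intros hc hb. split; auto. exists A. intros s hs.
  assert (0 <= A)%R by (eapply Rle_trans; [apply Cmod_ge_0|apply (hb 0%R); lra]).
  assert (1 <= exp (s / 2))%R by (rewrite <- exp_0; apply exp_le; lra).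
  specialize (hb s hs). nra.
Qed.

Lemma decaying_moderate (g : R -> C) : decaying g -> moderate g.
Proof.
  intros [hc [C [c [c0 hb]]]]. apply moderate_bounded with (Rabs C); auto.
  intros s hs. eapply Rle_trans; [now apply hb|].
  assert (exp (- c * s) <= 1)%R by (rewrite <- exp_0; apply exp_le; nra).
  pose proof (exp_pos (- c * s)). pose proof (Rle_abs C). pose proof (Rabs_pos C). nra.
Qed.

Lemma moderate_const (a : C) : moderate (fun _ => a).
Proof. apply moderate_bounded with (Cmod a); [apply contC_const|]. intros; lra. Qed.

Lemma moderate_le_plus (A B : R) (f g : R -> C) : moderate_le A f -> moderate_le B g -> moderate_le (A + B) (fun s => f s + g s).
Proof.
  intros hf hg s hs. eapply Rle_trans; [apply Cmod_triangle|].
  specialize (hf s hs); specialize (hg s hs); lra.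
Qed.

Lemma moderate_le_scal (A : R) (a : C) (f : R -> C) : moderate_le A f -> moderate_le (Cmod a * A) (fun s => a * f s).
Proof.
  intros hf s hs. rewrite Cmod_mult, Rmult_assoc. apply Rmult_le_compat_l; auto. apply Cmod_ge_0.
Qed.

Lemma moderate_plus (f g : R -> C) : moderate f -> moderate g -> moderate (fun s => f s + g s).
Proof. intros [? [A ?]] [? [B ?]]; split; [now apply contC_plus|exists (A + B)%R; now apply moderate_le_plus]. Qed.

Lemma moderate_scal (a : C) (f : R -> C) : moderate f -> moderate (fun s => a * f s).
Proof.
  intros [? [A ?]]; split; [apply contC_mult; auto using contC_const|].
  exists (Cmod a * A)%R; now apply moderate_le_scal.
Qed.

Definition step (n : nat) (phi g : R -> C) : R -> C := tail_iter n (fun s => phi s * g s).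

Lemma kernel_mul_bound (K A : R) (phi g : R -> C) : kernel_bound K phi -> moderate_le A g ->
  forall s, (0 <= s)%R -> (Cmod (phi s * g s) <= K * A * exp (- (1 / 2) * s))%R.
Proof.
  intros hK hA s hs. rewrite Cmod_mult.
  replace (exp (- (1 / 2) * s)) with (exp (- s) * exp (s / 2))%R
    by (rewrite <- exp_plus; f_equal; field).
  replace (K * A * (exp (- s) * exp (s / 2)))%R with ((K * exp (- s)) * (A * exp (s / 2)))%R by ring.
  apply Rmult_le_compat; auto using Cmod_ge_0.
Qed.

Lemma kernel_mul_decaying (phi g : R -> C) : kernel phi -> moderate g -> decaying (fun s => phi s * g s).
Proof.
  intros [hc [K hK]] [hc' [A hA]]. split; [now apply contC_mult|].
  exists (K * A)%R, (1 / 2)%R. split; [lra|]. now apply kernel_mul_bound.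
Qed.

Lemma step_decaying (n : nat) (phi g : R -> C) : kernel phi -> moderate g -> decaying (step n phi g).
Proof. intros; apply tail_iter_decaying; now apply kernel_mul_decaying. Qed.

Lemma tail_iter_bound (n : nat) (h : R -> C) (A c : R) : decaying h -> (0 < c)%R ->
  (forall s, (0 <= s)%R -> (Cmod (h s) <= A * exp (- c * s))%R) ->
  forall s, (0 <= s)%R -> (Cmod (tail_iter n h s) <= (2 / c) ^ n * A * exp (- c * s))%R.
Proof.
  intros hW c0 hA. induction n; intros s hs.
  - simpl. rewrite Rmult_1_l. auto.
  - rewrite tail_iter_S.
    replace ((2 / c) ^ S n * A)%R with (2 * ((2 / c) ^ n * A) / c)%R by (simpl; field; lra).
    apply tail_bound; auto. apply (tail_iter_decaying n h hW).
Qed.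

Lemma step_bound (n : nat) (phi g : R -> C) (K A : R) : kernel phi -> moderate g ->
  kernel_bound K phi -> moderate_le A g ->
  forall s, (0 <= s)%R -> (Cmod (step n phi g s) <= 4 ^ n * (K * A) * exp (- (1 / 2) * s))%R.
Proof.
  intros h1 h2 hK hA. replace 4%R with (2 / (1 / 2))%R by field.
  apply tail_iter_bound; [now apply kernel_mul_decaying|lra|now apply kernel_mul_bound].
Qed.

Lemma step_moderate_le (n : nat) (phi g : R -> C) (K A : R) : kernel phi -> moderate g ->
  kernel_bound K phi -> moderate_le A g -> moderate_le (4 ^ n * K * A) (step n phi g).
Proof.
  intros h1 h2 hK hA s hs. eapply Rle_trans; [now apply (step_bound n phi g K A)|].
  rewrite <- Rmult_assoc. apply Rmult_le_compat_l.
  - repeat apply Rmult_le_pos; [apply pow_le; lra|eapply kernel_bound_nonneg; eauto|eapply moderate_le_nonneg; eauto].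
  - apply exp_le. lra.
Qed.

Lemma step_plus (n : nat) (phi f g : R -> C) : kernel phi -> moderate f -> moderate g ->
  step n phi (fun s => f s + g s) = (fun s => step n phi f s + step n phi g s).
Proof.
  intros h hf hg. unfold step. rewrite <- tail_iter_plus by now apply kernel_mul_decaying.
  f_equal. apply functional_extensionality; intros; ring.
Qed.

Lemma step_scal (n : nat) (phi f : R -> C) (a : C) : kernel phi -> moderate f ->
  step n phi (fun s => a * f s) = (fun s => a * step n phi f s).
Proof.
  intros h hf. unfold step. rewrite <- tail_iter_scal by now apply kernel_mul_decaying.
  f_equal. apply functional_extensionality; intros; ring.
Qed.

Fixpoint steps (l : list (nat * (R -> C))%type) (g : R -> C) : R -> C :=
  match l with
  | [] => g
  | p :: l' => steps l' (step (fst p) (snd p) g)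
  end.

Definition kernels (l : list (nat * (R -> C))%type) : Prop := Forall (fun p => kernel (snd p)) l.

Lemma steps_plus l f g : kernels l -> moderate f -> moderate g ->
  steps l (fun s => f s + g s) = (fun s => steps l f s + steps l g s).
Proof.
  intros hl; revert f g; induction hl; simpl; auto.
  intros f g hf hg. rewrite step_plus by auto. apply IHhl; apply decaying_moderate; now apply step_decaying.
Qed.

Lemma steps_scal l f a : kernels l -> moderate f -> steps l (fun s => a * f s) = (fun s => a * steps l f s).
Proof.
  intros hl; revert f; induction hl; simpl; auto.
  intros f hf. rewrite step_scal by auto. apply IHhl; apply decaying_moderate; now apply step_decaying.
Qed.

Lemma steps_moderate_le l : kernels l -> exists K, (0 <= K)%R /\
  forall A g, moderate g -> moderate_le A g -> moderate_le (K * A) (steps l g).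
Proof.
  induction 1 as [|[n phi] l [hc [k hk]] hl [K [K0 IH]]]; simpl in *.
  - exists 1%R. split; [lra|]. intros. now rewrite Rmult_1_l.
  - exists (K * (4 ^ n * k))%R. split.
    { repeat apply Rmult_le_pos; auto; [apply pow_le; lra|eapply kernel_bound_nonneg; eauto]. }
    intros A g hg hA. rewrite Rmult_assoc.
    assert (kernel phi) by (split; eauto).
    apply IH; [apply decaying_moderate; now apply step_decaying|]. now apply step_moderate_le.
Qed.

Lemma quadratic_derC (G : R -> C) (s : R) (a : C) (B : R) :
  (forall d, (Rabs d <= 1)%R -> (Cmod (G (s + d)%R - G s - RtoC d * a) <= B * d ^ 2)%R) ->
  derC G s a.
Proof.
  intros h.
  assert (aux : forall (p : R -> R) (a : R),
    (forall d, (Rabs d <= 1)%R -> (Rabs (p (s + d) - p s - d * a) <= B * d ^ 2)%R) -> is_derive p s a).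
  { clear. intros p a h. apply is_derive_Reals. intros eps he.
    assert (hB : (0 < 1 + Rabs B)%R) by (pose proof (Rabs_pos B); lra).
    assert (hd : (0 < Rmin 1 (eps / (1 + Rabs B)))%R).
    { apply Rmin_glb_lt; [lra|]. now apply Rdiv_lt_0_compat. }
    exists (mkposreal _ hd). intros d d0 hdl. simpl in hdl.
    assert (h1 : (Rabs d <= 1)%R) by (left; eapply Rlt_le_trans; [apply hdl|apply Rmin_l]).
    assert (h2 : (Rabs d < eps / (1 + Rabs B))%R) by (eapply Rlt_le_trans; [apply hdl|apply Rmin_r]).
    specialize (h d h1).
    replace ((p (s + d) - p s) / d - a)%R with ((p (s + d) - p s - d * a) / d)%R by (field; auto).
    unfold Rdiv. rewrite Rabs_mult, Rabs_inv.
    assert (hp : (0 < Rabs d)%R) by now apply Rabs_pos_lt.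
    apply Rmult_lt_reg_r with (Rabs d); auto.
    rewrite Rmult_assoc, Rinv_l, Rmult_1_r by lra.
    eapply Rle_lt_trans; [apply h|].
    rewrite <- (pow2_abs d).
    assert ((1 + Rabs B) * Rabs d < eps)%R.
    { apply Rmult_lt_compat_l with (r := (1 + Rabs B)%R) in h2; auto.
      replace ((1 + Rabs B) * (eps / (1 + Rabs B)))%R with eps in h2 by (field; lra). exact h2. }
    pose proof (Rle_abs B). nra. }
  split; apply aux; intros d hd; (eapply Rle_trans; [|apply (h d hd)]).
  - eapply Rle_trans; [|apply Re_le_Cmod]. right. f_equal. destruct a; simpl; unfold Re; ring.
  - eapply Rle_trans; [|apply Im_le_Cmod]. right. f_equal. destruct a; simpl; unfold Im; ring.
Qed.

(* [steps l] is bounded for the weight [exp (s / 2)], hence commutes with differentiation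
   in a parameter. *)
Lemma steps_param_derC l (h : R -> R -> C) (k : R -> C) (sigma B : R) : kernels l ->
  (forall u, moderate (h u)) -> moderate k ->
  (forall d, (Rabs d <= 1)%R ->
     moderate_le (B * d ^ 2) (fun s => h (sigma + d)%R s + - (1) * h sigma s + - RtoC d * k s)) ->
  derC (fun u => steps l (h u) 0) sigma (steps l k 0).
Proof.
  intros hl hV hk hB. destruct (steps_moderate_le l hl) as [K [K0 hK]].
  apply quadratic_derC with (K * B)%R. intros d hd.
  specialize (hB d hd). apply hK in hB; [|auto using moderate_plus, moderate_scal].
  specialize (hB 0%R (Rle_refl 0)). replace (0 / 2)%R with 0%R in hB by lra.
  rewrite exp_0, Rmult_1_r, <- Rmult_assoc in hB.
  eapply Rle_trans; [|exact hB]. right. f_equal.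
  rewrite !steps_plus, !steps_scal by auto using moderate_plus, moderate_scal. ring.
Qed.

(** * Analytic families *)

Fixpoint psum (f : nat -> C) (N : nat) : C :=
  match N with O => 0 | S m => psum f m + f m end.

Lemma psum_S f N : psum f (S N) = psum f N + f N.
Proof. reflexivity. Qed.

Lemma psum_ext f g N : (forall n, (n < N)%nat -> f n = g n) -> psum f N = psum g N.
Proof. induction N; simpl; intros h; auto. rewrite IHN, h; auto. Qed.

Lemma psum_plus f g N : psum (fun n => f n + g n) N = psum f N + psum g N.
Proof. induction N; simpl; [ring|]. rewrite IHN. ring. Qed.

Lemma psum_scal a f N : psum (fun n => a * f n) N = a * psum f N.
Proof. induction N; simpl; [ring|]. rewrite IHN. ring. Qed.

Lemma psum_S_l f N : psum f (S N) = f O + psum (fun n => f (S n)) N.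
Proof. induction N; simpl in *; [ring|]. rewrite IHN. ring. Qed.

Lemma psum_contC (a : nat -> R -> C) N : (forall n, contC (a n)) -> contC (fun s => psum (fun n => a n s) N).
Proof. intros h; induction N; simpl; [apply contC_const|now apply contC_plus]. Qed.

Lemma psum_le (f : nat -> C) (B : R) N : (forall n, (n < N)%nat -> (Cmod (f n) <= B)%R) ->
  (Cmod (psum f N) <= INR N * B)%R.
Proof.
  induction N; intros h.
  - simpl. rewrite Cmod_0. lra.
  - rewrite S_INR. simpl psum. eapply Rle_trans; [apply Cmod_triangle|].
    specialize (IHN (fun n hn => h n (Nat.lt_trans _ _ _ hn (Nat.lt_succ_diag_r _)))).
    specialize (h N (Nat.lt_succ_diag_r _)). lra.
Qed.

Lemma Cauchy_psum (a b : nat -> C) (t : C) N :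
  psum (fun n => t ^ n * psum (fun k => a k * b (n - k)%nat) (S n)) N =
  psum (fun k => t ^ k * a k * psum (fun i => t ^ i * b i) (N - k)) N.
Proof.
  induction N; auto.
  rewrite (psum_S (fun n => t ^ n * psum (fun k => a k * b (n - k)%nat) (S n))), IHN.
  rewrite (psum_S (fun k => t ^ k * a k * psum (fun i => t ^ i * b i) (S N - k))).
  rewrite Nat.sub_succ_l, Nat.sub_diag by lia.
  rewrite (psum_ext (fun k => t ^ k * a k * psum (fun i => t ^ i * b i) (S N - k))
    (fun k => t ^ k * a k * psum (fun i => t ^ i * b i) (N - k) + t ^ N * (a k * b (N - k)%nat)) N).
  2: { intros n hn. rewrite Nat.sub_succ_l by lia. simpl psum.
       replace (t ^ N) with (t ^ n * t ^ (N - n)) by (rewrite <- Cpow_add_r; f_equal; lia).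
       ring. }
  rewrite psum_plus, psum_scal. simpl psum. rewrite Nat.sub_diag. simpl. ring.
Qed.

(* [h t] has, uniformly in [s >= 0] and relative to the weight [exp (c s)], the
   Taylor expansion in [t] at [t0] with coefficients [a n]; this is phrased
   through remainders so that bounded operators and products preserve it. *)
Definition has_taylor_with (c : R) (t0 : C) (a : nat -> R -> C) (A M : R) (h : C -> R -> C) : Prop :=
  (0 < M)%R /\ (forall n, contC (a n)) /\
  forall t, (M * Cmod (t - t0) <= 1)%R -> contC (h t) /\
    forall N s, (0 <= s)%R ->
      (Cmod (h t s - psum (fun n => ((t - t0) ^ n * a n s)%C) N) <=
        A * (M * Cmod (t - t0)) ^ N * exp (c * s))%R.
Definition has_taylor (c : R) (t0 : C) (h : C -> R -> C) : Prop :=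
  exists a A M, has_taylor_with c t0 a A M h.

Lemma taylor_with_nonneg c t0 a A M h : has_taylor_with c t0 a A M h -> (0 <= A)%R.
Proof.
  intros [hM [_ H]]. destruct (H t0) as [_ H'].
  { replace (t0 - t0) with (RtoC 0) by ring. rewrite Cmod_0. lra. }
  specialize (H' O 0%R (Rle_refl 0)). simpl in H'. rewrite Rmult_0_r, exp_0 in H'.
  pose proof (Cmod_ge_0 (h t0 0%R - 0)). lra.
Qed.

Lemma taylor_with_mono c t0 a A M M' h : (M <= M')%R -> has_taylor_with c t0 a A M h -> has_taylor_with c t0 a A M' h.
Proof.
  intros hMM H. pose proof (taylor_with_nonneg _ _ _ _ _ _ H) as hA. destruct H as [hM [hc H]].
  split; [lra|split; auto]. intros t ht.
  pose proof (Cmod_ge_0 (t - t0)).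
  destruct (H t) as [h1 h2]; [nra|]. split; auto.
  intros N s hs. eapply Rle_trans; [now apply h2|].
  apply Rmult_le_compat_r; [left; apply exp_pos|]. apply Rmult_le_compat_l; auto.
  apply pow_incr. nra.
Qed.

Lemma taylor_with_term c t0 a A M h : has_taylor_with c t0 a A M h ->
  forall t n s, (M * Cmod (t - t0) <= 1)%R -> (0 <= s)%R ->
  (Cmod ((t - t0) ^ n * a n s) <= 2 * A * (M * Cmod (t - t0)) ^ n * exp (c * s))%R.
Proof.
  intros H t n s ht hs. pose proof (taylor_with_nonneg _ _ _ _ _ _ H) as hA.
  destruct H as [hM [_ H]]. destruct (H t ht) as [_ H'].
  pose proof (H' n s hs) as h1. pose proof (H' (S n) s hs) as h2. simpl psum in h2.
  set (S := psum _ n) in *.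
  replace ((t - t0) ^ n * a n s) with ((h t s - S) - (h t s - (S + (t - t0) ^ n * a n s))) by ring.
  eapply Rle_trans; [apply Cmod_triangle|]. rewrite Cmod_opp.
  assert (h0 : (0 <= M * Cmod (t - t0))%R) by (apply Rmult_le_pos; [lra|apply Cmod_ge_0]).
  assert ((M * Cmod (t - t0)) ^ Datatypes.S n <= (M * Cmod (t - t0)) ^ n)%R.
  { simpl. pose proof (pow_le _ n h0). nra. }
  assert (A * (M * Cmod (t - t0)) ^ Datatypes.S n * exp (c * s) <= A * (M * Cmod (t - t0)) ^ n * exp (c * s))%R.
  { apply Rmult_le_compat_r; [left; apply exp_pos|]. now apply Rmult_le_compat_l. }
  lra.
Qed.

Lemma taylor_with_coef c t0 a A M h : has_taylor_with c t0 a A M h ->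
  forall n s, (0 <= s)%R -> (Cmod (a n s) <= 2 * A * M ^ n * exp (c * s))%R.
Proof.
  intros H n s hs. assert (hM := proj1 H).
  assert (hm : Cmod (t0 + RtoC (/ M) - t0) = (/ M)%R).
  { replace (t0 + RtoC (/ M) - t0) with (RtoC (/ M)) by ring. rewrite Cmod_R.
    apply Rabs_pos_eq. left; now apply Rinv_0_lt_compat. }
  assert (H1 := taylor_with_term _ _ _ _ _ _ H (t0 + RtoC (/ M)) n s).
  rewrite Cmod_mult, Cmod_pow, hm, Rinv_r, pow1 in H1 by lra.
  specialize (H1 (Rle_refl 1) hs).
  apply Rmult_le_reg_l with ((/ M) ^ n)%R; [apply pow_lt; now apply Rinv_0_lt_compat|].
  eapply Rle_trans; [apply H1|]. right.
  rewrite pow_inv. field. apply pow_nonzero; lra.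
Qed.

Lemma taylor_with_coef0 c t0 a A M h : has_taylor_with c t0 a A M h -> forall s, (0 <= s)%R -> a O s = h t0 s.
Proof.
  intros [hM [_ H]] s hs. destruct (H t0) as [_ H'].
  { replace (t0 - t0) with (RtoC 0) by ring. rewrite Cmod_0. lra. }
  specialize (H' 1%nat s hs). simpl in H'. replace (t0 - t0) with (RtoC 0) in H' by ring.
  rewrite Cmod_0 in H'. replace (A * (M * 0 * 1) * exp (c * s))%R with 0%R in H' by ring.
  pose proof (Cmod_ge_0 (h t0 s - (0 + 1 * a O s))).
  assert (e : Cmod (h t0 s - (0 + 1 * a O s)) = 0%R) by lra.
  apply Cmod_eq_0 in e. replace (h t0 s) with (h t0 s - (0 + 1 * a O s) + a O s) by ring.
  rewrite e; ring.
Qed.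

Lemma taylor_const c t0 (phi : R -> C) A : contC phi ->
  (forall s, (0 <= s)%R -> (Cmod (phi s) <= A * exp (c * s))%R) -> has_taylor c t0 (fun _ => phi).
Proof.
  intros hc hb. exists (fun n => match n with O => phi | _ => fun _ => 0 end), A, 1%R.
  split; [lra|split].
  - intros [|n]; auto using contC_const.
  - intros t ht. split; auto. intros N s hs.
    assert (hA : (0 <= A)%R).
    { specialize (hb 0%R (Rle_refl 0)). rewrite Rmult_0_r, exp_0 in hb. pose proof (Cmod_ge_0 (phi 0%R)). lra. }
    destruct N as [|N].
    + simpl. replace (phi s - 0) with (phi s) by ring. rewrite Rmult_1_r. auto.
    + assert (e : psum (fun n => (t - t0) ^ n * match n with O => phi | _ => fun _ => 0 end s) (S N) = phi s).
      { rewrite psum_S_l. rewrite (psum_ext _ (fun _ => 0 * 0)) by (intros; ring).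
        rewrite psum_scal. simpl. ring. }
      rewrite e. replace (phi s - phi s) with (RtoC 0) by ring. rewrite Cmod_0.
      apply Rmult_le_pos; [apply Rmult_le_pos; auto|left; apply exp_pos].
      apply pow_le. apply Rmult_le_pos; [lra|apply Cmod_ge_0].
Qed.

Lemma taylor_id t0 : has_taylor 0 t0 (fun t _ => t).
Proof.
  exists (fun n _ => match n with O => t0 | 1%nat => 1 | _ => 0 end), (1 + Cmod t0)%R, 1%R.
  split; [lra|split].
  - intros n; apply contC_const.
  - intros t ht. split; [apply contC_const|]. intros N s hs.
    rewrite Rmult_0_l, exp_0, Rmult_1_r, Rmult_1_l.
    pose proof (Cmod_ge_0 t0). pose proof (Cmod_ge_0 (t - t0)).
    destruct N as [|[|N]].
    + simpl. replace (t - 0) with (t - t0 + t0) by ring.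
      eapply Rle_trans; [apply Cmod_triangle|]. lra.
    + simpl. replace (t - (0 + 1 * t0)) with (t - t0) by ring. nra.
    + assert (e : psum (fun n => (t - t0) ^ n * match n with O => t0 | 1%nat => 1 | _ => 0 end) (S (S N)) = t).
      { rewrite !psum_S_l. rewrite (psum_ext _ (fun _ => 0 * 0)) by (intros; ring).
        rewrite psum_scal. simpl. ring. }
      rewrite e. replace (t - t) with (RtoC 0) by ring. rewrite Cmod_0.
      apply Rmult_le_pos; [lra|]. apply pow_le; lra.
Qed.

Lemma taylor_plus c t0 h g : has_taylor c t0 h -> has_taylor c t0 g -> has_taylor c t0 (fun t s => h t s + g t s).
Proof.
  intros [a [A [M H]]] [b [B [M' H']]].
  apply (taylor_with_mono _ _ _ _ _ (Rmax M M')) in H; [|apply Rmax_l].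
  apply (taylor_with_mono _ _ _ _ _ (Rmax M M')) in H'; [|apply Rmax_r].
  set (m := Rmax M M') in *. clearbody m. destruct H as [hM [ha H]]; destruct H' as [_ [hb H']].
  exists (fun n s => a n s + b n s), (A + B)%R, m. split; [auto|split].
  - intros; now apply contC_plus.
  - intros t ht. destruct (H t ht) as [h1 h2], (H' t ht) as [h1' h2']. split; [now apply contC_plus|].
    intros N s hs. specialize (h2 N s hs). specialize (h2' N s hs).
    rewrite (psum_ext _ (fun n => (t - t0) ^ n * a n s + (t - t0) ^ n * b n s)) by (intros; ring).
    rewrite psum_plus.
    match goal with |- (Cmod (?x + ?y - (?u + ?v)) <= _)%R => replace (x + y - (u + v)) with ((x - u) + (y - v)) by ring end.
    eapply Rle_trans; [apply Cmod_triangle|]. lra.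
Qed.

Lemma INR_3pow N : (1 + 2 * INR N <= 3 ^ N)%R.
Proof.
  induction N; simpl pow; [simpl; lra|]. rewrite S_INR. pose proof (pos_INR N). lra.
Qed.

Lemma taylor_mult c1 c2 t0 h g : has_taylor c1 t0 h -> has_taylor c2 t0 g -> has_taylor (c1 + c2) t0 (fun t s => h t s * g t s).
Proof.
  intros [a [A [M H]]] [b [B [M' H']]].
  apply (taylor_with_mono _ _ _ _ _ (Rmax M M')) in H; [|apply Rmax_l].
  apply (taylor_with_mono _ _ _ _ _ (Rmax M M')) in H'; [|apply Rmax_r].
  set (m := Rmax M M') in *. clearbody m.
  assert (hA := taylor_with_nonneg _ _ _ _ _ _ H). assert (hB := taylor_with_nonneg _ _ _ _ _ _ H').
  assert (T := taylor_with_term _ _ _ _ _ _ H).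
  destruct H as [hm [ha H]]; destruct H' as [_ [hb H']].
  exists (fun n s => psum (fun k => a k s * b (n - k)%nat s) (S n)), (A * B)%R, (3 * m)%R.
  split; [lra|split].
  - intros n. apply (psum_contC (fun k s => a k s * b (n - k)%nat s)). intros; now apply contC_mult.
  - intros t ht. pose proof (Cmod_ge_0 (t - t0)) as h0.
    assert (ht' : (m * Cmod (t - t0) <= 1)%R) by nra.
    destruct (H t ht') as [h1 h2], (H' t ht') as [h1' h2']. split; [now apply contC_mult|].
    intros N s hs.
    rewrite (Cauchy_psum (fun k => a k s) (fun k => b k s)). cbv beta.
    set (P := fun j => psum (fun i => (t - t0) ^ i * b i s) j).
    replace (h t s * g t s - psum (fun k => (t - t0) ^ k * a k s * P (N - k)%nat) N)
      with ((h t s - psum (fun n => ((t - t0) ^ n * a n s)%C) N) * g t s +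
            psum (fun k => ((t - t0) ^ k * a k s * (g t s - P (N - k)%nat))%C) N).
    2: { rewrite (psum_ext (fun k => ((t - t0) ^ k * a k s * (g t s - P (N - k)%nat))%C)
           (fun k => g t s * ((t - t0) ^ k * a k s) + -(1) * ((t - t0) ^ k * a k s * P (N - k)%nat))) by (intros; ring).
         rewrite psum_plus, !psum_scal. unfold P. ring. }
    set (x := (m * Cmod (t - t0))%R) in *.
    assert (hx : (0 <= x)%R) by (apply Rmult_le_pos; lra).
    set (E := exp ((c1 + c2) * s)).
    assert (hE : E = (exp (c1 * s) * exp (c2 * s))%R) by (unfold E; rewrite <- exp_plus; f_equal; ring).
    pose proof (exp_pos (c1 * s)) as e1. pose proof (exp_pos (c2 * s)) as e2.
    pose proof (pow_le x N hx) as hxN.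
    assert (hg : (Cmod (g t s) <= B * exp (c2 * s))%R).
    { specialize (h2' O s hs). simpl in h2'. replace (g t s - 0) with (g t s) in h2' by ring. lra. }
    assert (p1 : (Cmod ((h t s - psum (fun n => ((t - t0) ^ n * a n s)%C) N) * g t s) <= A * B * x ^ N * E)%R).
    { rewrite Cmod_mult, hE.
      replace (A * B * x ^ N * (exp (c1 * s) * exp (c2 * s)))%R
        with ((A * x ^ N * exp (c1 * s)) * (B * exp (c2 * s)))%R by ring.
      apply Rmult_le_compat; auto using Cmod_ge_0. }
    assert (p2 : (Cmod (psum (fun k => ((t - t0) ^ k * a k s * (g t s - P (N - k)%nat))%C) N)
                  <= INR N * (2 * A * B * x ^ N * E))%R).
    { apply psum_le. intros n hn. rewrite Cmod_mult, hE.
      replace (2 * A * B * x ^ N * (exp (c1 * s) * exp (c2 * s)))%R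
        with ((2 * A * x ^ n * exp (c1 * s)) * (B * x ^ (N - n) * exp (c2 * s)))%R.
      2: { replace (x ^ N)%R with (x ^ n * x ^ (N - n))%R by (rewrite <- pow_add; f_equal; lia). ring. }
      apply Rmult_le_compat; auto using Cmod_ge_0. }
    eapply Rle_trans; [apply Cmod_triangle|].
    replace (3 * m * Cmod (t - t0))%R with (3 * x)%R by (unfold x; ring).
    rewrite Rpow_mult_distr.
    assert (hpos : (0 <= A * B * x ^ N * E)%R).
    { rewrite hE. repeat apply Rmult_le_pos; lra. }
    pose proof (INR_3pow N) as h3.
    replace (A * B * (3 ^ N * x ^ N) * E)%R with (3 ^ N * (A * B * x ^ N * E))%R by ring.
    replace (2 * A * B * x ^ N * E)%R with (2 * (A * B * x ^ N * E))%R in p2 by ring.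
    pose proof (Rmult_le_compat_r _ _ _ hpos h3). lra.
Qed.

Lemma taylor_pow t0 h n : has_taylor 0 t0 h -> has_taylor 0 t0 (fun t s => h t s ^ n).
Proof.
  intros H; induction n; simpl.
  - apply taylor_const with 1%R; [apply contC_const|]. intros. rewrite Cmod_1, Rmult_0_l, exp_0. lra.
  - replace 0%R with (0 + 0)%R by ring. now apply taylor_mult.
Qed.

Lemma taylor_tail c t0 h : (c < 0)%R -> has_taylor c t0 h -> has_taylor c t0 (fun t => tail (h t)).
Proof.
  intros c0 [a [A [M H]]]. assert (T := taylor_with_coef _ _ _ _ _ _ H).
  destruct H as [hM [ha H]].
  assert (haW : forall n, decaying (a n)).
  { intros n. split; auto. exists (2 * A * M ^ n)%R, (- c)%R. split; [lra|].
    intros s hs. rewrite Ropp_involutive. now apply T. }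
  exists (fun n => tail (a n)), (2 * A / (- c))%R, M. split; [auto|split].
  - intros n. apply tail_decaying; auto.
  - intros t ht. destruct (H t ht) as [h1 h2].
    assert (hW : decaying (h t)).
    { split; auto. exists A, (- c)%R. split; [lra|]. intros s hs. rewrite Ropp_involutive.
      specialize (h2 O s hs). simpl in h2. replace (h t s - 0) with (h t s) in h2 by ring. lra. }
    split; [apply tail_decaying; auto|].
    intros N s hs.
    assert (hs1 : decaying (fun s => psum (fun n => ((t - t0) ^ n * a n s)%C) N) /\
      tail (fun s => psum (fun n => ((t - t0) ^ n * a n s)%C) N) = fun s => psum (fun n => (t - t0) ^ n * tail (a n) s) N).
    { clear h2. induction N; simpl.
      - split; [apply decaying_zero|]. symmetry. apply tail_unique; [apply decaying_zero| |apply decaying_exp_decay, decaying_zero].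
        intros; eapply derC_eq; [apply derC_const|ring].
      - destruct IHN as [i1 i2]. split; [apply decaying_plus; auto using decaying_scal|].
        rewrite (tail_plus (fun s => psum (fun n => ((t - t0) ^ n * a n s)%C) N)); auto using decaying_scal.
        rewrite i2. now rewrite tail_scal. }
    destruct hs1 as [hs1 hs2].
    replace (tail (h t) s - psum (fun n => (t - t0) ^ n * tail (a n) s) N)
      with (tail (fun s => h t s + -(1) * psum (fun n => ((t - t0) ^ n * a n s)%C) N) s).
    2: { rewrite tail_plus, tail_scal, hs2; auto using decaying_scal. ring. }
    replace (2 * A / - c * (M * Cmod (t - t0)) ^ N * exp (c * s))%R
      with (2 * (A * (M * Cmod (t - t0)) ^ N) / (- c) * exp (- - c * s))%R
      by (rewrite Ropp_involutive; unfold Rdiv; ring).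
    apply tail_bound; [apply decaying_plus; auto using decaying_scal|lra| |auto].
    intros u hu. rewrite Ropp_involutive.
    replace (h t u + -(1) * psum (fun n => ((t - t0) ^ n * a n u)%C) N) with (h t u - psum (fun n => ((t - t0) ^ n * a n u)%C) N) by ring.
    auto.
Qed.

Lemma taylor_weight c c' t0 h : (c <= c')%R -> has_taylor c t0 h -> has_taylor c' t0 h.
Proof.
  intros hcc [a [A [M H]]]. assert (hA := taylor_with_nonneg _ _ _ _ _ _ H).
  destruct H as [hM [ha H]]. exists a, A, M. split; [auto|split; auto].
  intros t ht. destruct (H t ht) as [h1 h2]. split; auto.
  intros N s hs. eapply Rle_trans; [now apply h2|].
  apply Rmult_le_compat_l; [|apply exp_le; nra].
  apply Rmult_le_pos; auto. apply pow_le. apply Rmult_le_pos; [lra|apply Cmod_ge_0].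
Qed.

Definition at_param (t : C) (l : list (nat * (C -> R -> C))%type) : list (nat * (R -> C))%type :=
  map (fun p => (fst p, snd p t)) l.

Lemma taylor_op t0 l g : Forall (fun p => has_taylor (-1) t0 (snd p)) l -> has_taylor (1 / 2) t0 g ->
  has_taylor (1 / 2) t0 (fun t => steps (at_param t l) (g t)).
Proof.
  intros hl; revert g; induction hl as [|[n phi] l hp hl IH]; intros g hg; simpl; auto.
  apply (IH (fun t => step n (phi t) (g t))).
  apply (taylor_weight (-1 + 1 / 2)); [lra|].
  unfold step, tail_iter. clear IH. induction n; simpl.
  - now apply taylor_mult.
  - apply taylor_tail; [lra|auto].
Qed.

Lemma taylor_order1 c t0 h : has_taylor c t0 h -> exists a B d, (0 < d)%R /\ (0 <= B)%R /\
  forall t, (Cmod (t - t0) <= d)%R -> (Cmod (h t 0%R - h t0 0%R - (t - t0) * a) <= B * Cmod (t - t0) ^ 2)%R.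
Proof.
  intros [a [A [M H]]]. assert (hA := taylor_with_nonneg _ _ _ _ _ _ H).
  assert (h0 := taylor_with_coef0 _ _ _ _ _ _ H 0%R (Rle_refl 0)).
  destruct H as [hM [ha H]].
  exists (a 1%nat 0%R), (A * M ^ 2)%R, (/ M)%R.
  split; [now apply Rinv_0_lt_compat|split; [apply Rmult_le_pos; auto; apply pow_le; lra|]].
  intros t ht.
  assert (ht' : (M * Cmod (t - t0) <= 1)%R).
  { apply (Rmult_le_compat_l M) in ht; [|lra]. rewrite Rinv_r in ht; lra. }
  destruct (H t ht') as [_ h2]. specialize (h2 2%nat 0%R (Rle_refl 0)).
  rewrite Rmult_0_r, exp_0, Rmult_1_r in h2. rewrite <- h0.
  simpl psum in h2. eapply Rle_trans; [|eapply Rle_trans; [exact h2|right; simpl; ring]].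
  right. f_equal. simpl. ring.
Qed.

Fixpoint rsum (f : nat -> R) (N : nat) : R :=
  match N with O => 0%R | S m => (rsum f m + f m)%R end.
Lemma rsum_ext f g N : (forall n, (n < N)%nat -> f n = g n) -> rsum f N = rsum g N.
Proof. induction N; simpl; intros h; auto. rewrite IHN, h; auto. Qed.

Lemma rsum_scal a f N : rsum (fun n => a * f n)%R N = (a * rsum f N)%R.
Proof. induction N; simpl; [ring|]. rewrite IHN. ring. Qed.

Lemma psum_rsum (f : nat -> C) (g : nat -> R) N : (forall n, (n < N)%nat -> (Cmod (f n) <= g n)%R) ->
  (Cmod (psum f N) <= rsum g N)%R.
Proof.
  induction N; intros h; simpl.
  - rewrite Cmod_0. lra.
  - eapply Rle_trans; [apply Cmod_triangle|]. apply Rplus_le_compat; auto.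
Qed.

Definition recip_next (a : nat -> C) (m : nat) (T : nat -> C) : C :=
  match m with O => / a O | _ => - (/ a O) * psum (fun k => T k * a (m - k)%nat) m end.
Fixpoint recip_table (a : nat -> C) (n : nat) : nat -> C :=
  match n with
  | O => fun _ => 0
  | S m => fun k => if (k <? m)%nat then recip_table a m k else recip_next a m (recip_table a m)
  end.
Definition recip (a : nat -> C) (n : nat) : C := recip_table a (S n) n.

Lemma recip_table_eq a n k : (k < n)%nat -> recip_table a n k = recip a k.
Proof.
  induction n; [lia|]. intros h. destruct (Nat.eq_dec k n) as [->|hk]; auto.
  simpl. destruct (Nat.ltb_spec k n); [|lia]. apply IHn; auto.
Qed.

Lemma recip_eq a n : recip a n = recip_next a n (recip a).
Proof.
  unfold recip at 1. simpl. rewrite Nat.ltb_irrefl. unfold recip_next. destruct n; auto.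
  f_equal. apply psum_ext. intros k hk. now rewrite recip_table_eq.
Qed.

Lemma recip_Cauchy (a : nat -> C) n : a O <> 0 ->
  psum (fun k => recip a k * a (n - k)%nat) (S n) = match n with O => 1 | _ => 0 end.
Proof.
  intros ha. rewrite psum_S, Nat.sub_diag, (recip_eq a n). unfold recip_next.
  destruct n; [simpl; field; auto|]. set (P := psum _ _). field; auto.
Qed.

Lemma recip_contC (a : nat -> R -> C) n : (forall n, contC (a n)) -> (forall s, a O s <> 0) ->
  contC (fun s => recip (fun k => a k s) n).
Proof.
  intros ha h0. induction n as [n IH] using lt_wf_ind.
  assert (e : (fun s => recip (fun k => a k s) n) = (fun s => recip_next (fun k => a k s) n (recip (fun k => a k s)))).
  { apply functional_extensionality; intros; apply recip_eq. }
  rewrite e. unfold recip_next. destruct n; [now apply contC_inv|].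
  apply contC_mult; [apply contC_opp; now apply contC_inv|].
  assert (H : forall m, (m <= S n)%nat ->
    contC (fun s => psum (fun k => recip (fun k => a k s) k * a (S n - k)%nat s) m)).
  { induction m; intros hm; [apply (contC_const 0)|]. simpl psum.
    apply contC_plus; [apply IHm; lia|]. apply contC_mult; auto. }
  now apply H.
Qed.

Lemma geom_telescope (A dl M : R) n : (0 <= A)%R -> (0 < dl)%R -> (0 < M)%R ->
  (A / dl * rsum (fun k => (M * (1 + A / dl)) ^ k * M ^ (n - k)) n <= (M * (1 + A / dl)) ^ n)%R.
Proof.
  intros hA hd hM. assert (hq : (0 <= A / dl)%R) by (apply Rmult_le_pos; [lra|left; now apply Rinv_0_lt_compat]).
  set (q := (A / dl)%R) in *. clearbody q. set (m := (M * (1 + q))%R).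
  induction n as [|n IH]; [simpl; lra|].
  change (rsum ?f (S n)) with (rsum f n + f n)%R. cbv beta.
  rewrite Nat.sub_succ_l, Nat.sub_diag by lia.
  rewrite (rsum_ext (fun k => m ^ k * M ^ (S n - k))%R (fun k => M * (m ^ k * M ^ (n - k)))%R n).
  2: { intros k hk. rewrite Nat.sub_succ_l by lia. simpl. ring. }
  rewrite rsum_scal. simpl pow.
  replace (m * m ^ n)%R with (M * m ^ n + q * (m ^ n * M))%R by (unfold m; ring).
  rewrite Rmult_1_r. set (r := rsum _ n) in *. clearbody r.
  replace (q * (M * r + m ^ n * M))%R with (M * (q * r) + q * (m ^ n * M))%R by ring.
  apply Rplus_le_compat_r. apply Rmult_le_compat_l; lra.
Qed.

Lemma continuous_Rmax0 s : continuous (fun s => Rmax s 0) s.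
Proof.
  apply continuous_ext with (fun s => ((s + Rabs s) / 2)%R).
  { intros x. unfold Rmax, Rabs. destruct (Rle_dec x 0), (Rcase_abs x); lra. }
  unfold Rdiv. apply (continuous_mult (K := R_AbsRing)); [|apply continuous_const].
  apply (continuous_plus (V := R_NormedModule)); [apply continuous_id|apply continuous_Rabs].
Qed.

Lemma taylor_inv t0 q dl : has_taylor 0 t0 q -> (0 < dl)%R ->
  (forall s, (0 <= s)%R -> (2 * dl <= Cmod (q t0 s))%R) ->
  (forall t s, q t s = q t (Rmax s 0)) ->
  has_taylor 0 t0 (fun t s => / q t s).
Proof.
  intros [a0 [A [M H0]]] hd hq hclip.
  assert (H : has_taylor_with 0 t0 (fun n s => a0 n (Rmax s 0)) A M q).
  { destruct H0 as [hM [ha H]]. split; auto. split.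
    - intros n. apply (contC_comp (a0 n)); auto using continuous_Rmax0.
    - intros t ht. destruct (H t ht) as [h1 h2]. split; auto.
      intros N s hs. rewrite (psum_ext _ (fun n => (t - t0) ^ n * a0 n s)); auto.
      intros; now rewrite Rmax_left. }
  assert (hz : forall s, a0 O (Rmax s 0) = q t0 (Rmax s 0)).
  { intros s. apply (taylor_with_coef0 _ _ _ _ _ _ H0). apply Rmax_r. }
  set (a := fun n s => a0 n (Rmax s 0)) in *.
  assert (hA := taylor_with_nonneg _ _ _ _ _ _ H).
  assert (T := taylor_with_coef _ _ _ _ _ _ H).
  destruct H as [hM [ha H]]. clear H0.
  assert (ha0 : forall s, (2 * dl <= Cmod (a O s))%R).
  { intros s. unfold a. rewrite hz. apply hq. apply Rmax_r. }
  assert (hnz : forall s, a O s <> 0).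
  { intros s e. specialize (ha0 s). rewrite e, Cmod_0 in ha0. lra. }
  assert (hqq : (0 <= A / dl)%R) by (apply Rmult_le_pos; [lra|left; now apply Rinv_0_lt_compat]).
  set (M2 := (M * (1 + A / dl))%R).
  assert (hM2 : (0 < M2)%R) by (unfold M2; nra).
  assert (hMM2 : (M <= M2)%R) by (unfold M2; nra).
  assert (hAM : (A * M <= dl * M2)%R).
  { unfold M2. replace (dl * (M * (1 + A / dl)))%R with (dl * M + A * M)%R by (field; lra). nra. }
  assert (hb : forall n s, (0 <= s)%R -> (Cmod (recip (fun k => a k s) n) <= / (2 * dl) * M2 ^ n)%R).
  { intros n s hs. induction n as [n IH] using lt_wf_ind.
    assert (hi : (Cmod (/ a O s) <= / (2 * dl))%R).
    { rewrite Cmod_inv by auto. apply Rinv_le_contravar; [lra|auto]. }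
    rewrite recip_eq. unfold recip_next. destruct n as [|n].
    - simpl. rewrite Rmult_1_r. exact hi.
    - set (m := S n) in *. rewrite Cmod_mult, Cmod_opp.
      apply Rmult_le_compat; auto using Cmod_ge_0.
      eapply Rle_trans; [|apply (geom_telescope A dl M m); auto].
      rewrite <- rsum_scal. apply psum_rsum. intros k hk. rewrite Cmod_mult.
      eapply Rle_trans; [apply Rmult_le_compat; [apply Cmod_ge_0|apply Cmod_ge_0|apply IH, hk|apply T, hs]|].
      fold M2. right. rewrite Rmult_0_l, exp_0. field. lra. }
  exists (fun n s => recip (fun k => a k s) n), (/ dl)%R, M2.
  split; [auto|split].
  - intros n. now apply recip_contC.
  - intros t ht. pose proof (Cmod_ge_0 (t - t0)) as hc0.
    assert (ht' : (M * Cmod (t - t0) <= 1)%R) by nra.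
    destruct (H t ht') as [h1 h2].
    assert (hlow : forall s, (0 <= s)%R -> (dl <= Cmod (q t s))%R).
    { intros s hs. specialize (h2 1%nat s hs). simpl in h2.
      rewrite Rmult_0_l, exp_0, Rmult_1_r, Rmult_1_r in h2.
      replace (q t s - (0 + 1 * a O s)) with (q t s - a O s) in h2 by ring.
      assert (h3 := Cmod_triangle (q t s) (- (q t s - a O s))).
      rewrite Cmod_opp in h3. replace (q t s + - (q t s - a O s)) with (a O s) in h3 by ring.
      specialize (ha0 s).
      assert (A * (M * Cmod (t - t0)) <= dl)%R by nra. lra. }
    assert (hqn : forall s, q t s <> 0).
    { intros s e. rewrite hclip in e. specialize (hlow (Rmax s 0) (Rmax_r _ _)).
      rewrite e, Cmod_0 in hlow. lra. }
    split; [now apply contC_inv|].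
    intros N s hs. rewrite Rmult_0_l, exp_0, Rmult_1_r.
    set (x := Cmod (t - t0)) in *.
    set (b := recip (fun k => a k s)).
    set (BN := psum (fun n => ((t - t0) ^ n * b n)%C) N).
    assert (hl := hlow s hs). assert (hqs := hqn s).
    assert (key : (Cmod (1 - q t s * BN) <= (M2 * x) ^ N)%R).
    { destruct N as [|N'].
      { unfold BN; simpl. replace (1 - q t s * 0) with (RtoC 1) by ring. rewrite Cmod_1. lra. }
      set (N := S N') in *.
      assert (e1 : psum (fun n => (t - t0) ^ n * psum (fun k => b k * a (n - k)%nat s) (S n)) N = 1).
      { unfold N. rewrite psum_S_l.
        rewrite (psum_ext (fun n => (t - t0) ^ S n * psum (fun k => b k * a (S n - k)%nat s) (S (S n)))
                   (fun _ => 0 * 0)).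
        - rewrite (psum_scal 0 (fun _ => 0)). unfold b. cbv beta. rewrite (recip_Cauchy (fun k => a k s) 0); auto. simpl. ring.
        - intros n hn. unfold b. rewrite (recip_Cauchy (fun k => a k s) (S n)); auto. ring. }
      rewrite (Cauchy_psum b (fun k => a k s)) in e1.
      set (P := psum (fun i => (t - t0) ^ i * a i s)) in *.
      replace (1 - q t s * BN) with (psum (fun k => (t - t0) ^ k * b k * - (q t s - P (N - k)%nat)) N).
      2: { rewrite (psum_ext _ (fun k => - q t s * ((t - t0) ^ k * b k) + (t - t0) ^ k * b k * P (N - k)%nat)) by (intros; ring).
           rewrite psum_plus, psum_scal, e1. fold BN. ring. }
      apply Rle_trans with (A / dl * x ^ N * rsum (fun k => M2 ^ k * M ^ (N - k)) N)%R.
      - rewrite <- rsum_scal. apply psum_rsum. intros k hk.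
        rewrite !Cmod_mult, Cmod_opp, Cmod_pow. fold x.
        specialize (h2 (N - k)%nat s hs). rewrite Rmult_0_l, exp_0, Rmult_1_r in h2. fold (P (N - k)%nat) in h2.
        specialize (hb k s hs). fold b in hb. fold x in h2.
        apply Rle_trans with (x ^ k * (/ (2 * dl) * M2 ^ k) * (A * (M * x) ^ (N - k)))%R.
        + apply Rmult_le_compat; auto using Cmod_ge_0.
          * apply Rmult_le_pos; [now apply pow_le|apply Cmod_ge_0].
          * apply Rmult_le_compat_l; auto. now apply pow_le.
        + rewrite Rpow_mult_distr.
          replace (x ^ N)%R with (x ^ k * x ^ (N - k))%R by (rewrite <- pow_add; f_equal; lia).
          assert (hz0 : (0 <= A / dl * (x ^ k * x ^ (N - k)) * (M2 ^ k * M ^ (N - k)))%R).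
          { repeat first [exact hqq|apply pow_le; lra|apply Rmult_le_pos]. }
          replace (x ^ k * (/ (2 * dl) * M2 ^ k) * (A * (M ^ (N - k) * x ^ (N - k))))%R
            with (/ 2 * (A / dl * (x ^ k * x ^ (N - k)) * (M2 ^ k * M ^ (N - k))))%R by (field; lra).
          lra.
      - rewrite Rpow_mult_distr.
        assert (g := geom_telescope A dl M N hA hd hM). fold M2 in g.
        pose proof (pow_le x N hc0).
        replace (A / dl * x ^ N * rsum (fun k => M2 ^ k * M ^ (N - k)) N)%R
          with ((A / dl * rsum (fun k => M2 ^ k * M ^ (N - k)) N) * x ^ N)%R by ring.
        now apply Rmult_le_compat_r. }
    replace (/ q t s - BN) with (/ q t s * (1 - q t s * BN)) by (field; auto).
    rewrite Cmod_mult, Cmod_inv by auto.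
    apply Rmult_le_compat; auto using Cmod_ge_0.
    + left. apply Rinv_0_lt_compat. lra.
    + now apply Rinv_le_contravar.
Qed.

Definition pole_free (Y : C) : Prop := forall x : R, (0 <= x)%R -> Y * RtoC x <> 1.

Lemma pole_free_lower_bound (Y : C) : pole_free Y ->
  exists dl, (0 < dl)%R /\ forall x, (0 <= x)%R -> (dl <= Cmod (1 - Y * RtoC x))%R.
Proof.
  intros h. destruct (Rle_dec (Re Y) 0) as [hr|hr].
  - exists 1%R. split; [lra|]. intros x hx.
    eapply Rle_trans; [|apply Re_le_Cmod].
    destruct Y as [u v]; simpl in *. rewrite Rabs_pos_eq; nra.
  - assert (hi : Im Y <> 0%R).
    { intros hi. apply (h (/ Re Y)%R). left; apply Rinv_0_lt_compat; lra.
      destruct Y as [u v]; simpl in *. subst v. apply C_eq; simpl; field; lra. }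
    assert (hY : (0 < Cmod Y)%R).
    { apply Cmod_gt_0. intros e. rewrite e in hi. now apply hi. }
    assert (hi' : (0 < Rabs (Im Y))%R) by now apply Rabs_pos_lt.
    exists (Rmin (1 / 2) (Rabs (Im Y) * / (2 * Cmod Y)))%R. split.
    { apply Rmin_glb_lt; [lra|]. apply Rmult_lt_0_compat; auto. apply Rinv_0_lt_compat; lra. }
    intros x hx. destruct (Rle_dec x (/ (2 * Cmod Y))) as [hx'|hx'].
    + eapply Rle_trans; [apply Rmin_l|].
      assert (h3 := Cmod_triangle (1 - Y * RtoC x) (Y * RtoC x)).
      replace (1 - Y * RtoC x + Y * RtoC x) with (RtoC 1) in h3 by ring.
      rewrite Cmod_1, Cmod_mult, Cmod_R, Rabs_pos_eq in h3 by auto.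
      apply (Rmult_le_compat_l (Cmod Y)) in hx'; [|lra].
      replace (Cmod Y * / (2 * Cmod Y))%R with (1 / 2)%R in hx' by (field; lra). lra.
    + eapply Rle_trans; [apply Rmin_r|].
      eapply Rle_trans; [|apply Im_le_Cmod].
      replace (Im (1 - Y * RtoC x)) with (- (Im Y * x))%R by (destruct Y; simpl; ring).
      rewrite Rabs_Ropp, Rabs_mult, (Rabs_pos_eq x) by auto.
      apply Rmult_le_compat_l; lra.
Qed.

Definition frac (w : C) : C := w / (1 - w).
Definition geom (Y : C) (s : R) : C := frac (Y * RtoC (exp (- s))).
(* Same values as [geom Y] for [s >= 0], but continuous everywhere for small [Y]. *)
Definition geom_clip (Y : C) (s : R) : C := geom Y (Rmax s 0).

Lemma RtoC_exp_neq s : RtoC (exp s) <> 0.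
Proof. intros e. apply RtoC_inj in e. pose proof (exp_pos s). lra. Qed.

Lemma continuous_exp_opp s : continuous (fun s => exp (- s)) s.
Proof. apply (ex_derive_continuous (fun s => exp (- s))). auto_derive; auto. Qed.

Lemma taylor_geom_clip (Y t0 : C) m : pole_free (Y * t0 ^ m) -> has_taylor (-1) t0 (fun t => geom_clip (Y * t ^ m)).
Proof.
  intros hok. destruct (pole_free_lower_bound _ hok) as [dl [hd hb]].
  assert (he : has_taylor (-1) t0 (fun _ s => RtoC (exp (- Rmax s 0)))).
  { apply taylor_const with 1%R.
    - apply (contC_comp (fun s => RtoC (exp (- s)))); auto using continuous_Rmax0.
      apply contC_RtoC, continuous_exp_opp.
    - intros s hs. rewrite Cmod_R, Rmax_left by auto. rewrite Rabs_pos_eq by (left; apply exp_pos).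
      right. rewrite Rmult_1_l. f_equal; ring. }
  assert (hp : has_taylor 0 t0 (fun t s => Y * t ^ m)).
  { replace 0%R with (0 + 0)%R by ring. apply taylor_mult.
    - apply taylor_const with (Cmod Y); [apply contC_const|]. intros. rewrite Rmult_0_l, exp_0. lra.
    - apply (taylor_pow t0 (fun t _ => t)), taylor_id. }
  assert (hw : has_taylor (-1) t0 (fun t s => Y * t ^ m * RtoC (exp (- Rmax s 0)))).
  { replace (-1)%R with (0 + -1)%R by ring. now apply taylor_mult. }
  replace (-1)%R with (-1 + 0)%R by ring.
  unfold geom_clip, geom, frac, Cdiv. apply (taylor_mult (-1) 0); auto.
  apply taylor_inv with (dl / 2)%R; [|lra| |].
  - apply taylor_plus.
    + apply taylor_const with 1%R; [apply contC_const|]. intros. rewrite Cmod_1, Rmult_0_l, exp_0. lra.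
    + apply taylor_weight with (-1)%R; [lra|].
      assert (e : (fun t s => - (Y * t ^ m * RtoC (exp (- Rmax s 0)))) =
        (fun t s => RtoC (-1) * (Y * t ^ m * RtoC (exp (- Rmax s 0))))).
      { do 2 (apply functional_extensionality; intros).
        replace (RtoC (-1)) with (- (1)) by (apply C_eq; simpl; ring). ring. }
      rewrite e. replace (-1)%R with (0 + -1)%R at 1 by ring.
      apply taylor_mult; auto.
      apply taylor_const with 1%R; [apply contC_const|]. intros.
      rewrite Cmod_R, Rabs_left, Rmult_0_l, exp_0; lra.
  - intros s hs. replace (2 * (dl / 2))%R with dl by field. apply hb. left; apply exp_pos.
  - intros t s. rewrite (Rmax_left (Rmax s 0) 0); auto. apply Rmax_r.
Qed.

Lemma C_ball_Cmod (t t0 : C) (eps : R) : ball t0 eps t -> (Cmod (t - t0) < 2 * eps)%R.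
Proof.
  intros [h1 h2].
  assert (e1 : (Rabs (Re (t - t0)) < eps)%R) by exact h1.
  assert (e2 : (Rabs (Im (t - t0)) < eps)%R) by exact h2.
  pose proof (Cmod_le_Re_Im (t - t0)). lra.
Qed.

Lemma locally_Cmod (t0 : C) (P : C -> Prop) (d : R) : (0 < d)%R ->
  (forall t, (Cmod (t - t0) < d)%R -> P t) -> locally t0 P.
Proof.
  intros hd h. assert (hd' : (0 < d / 2)%R) by lra.
  exists (mkposreal _ hd'). intros t ht. apply h.
  apply C_ball_Cmod in ht. simpl in ht. lra.
Qed.

Lemma C_Cmod_ball (t t0 : C) (eps : R) : (Cmod (t - t0) < eps)%R -> ball t0 eps t.
Proof.
  intros h. split.
  - change (Rabs (Re (t - t0)) < eps)%R. eapply Rle_lt_trans; [apply Re_le_Cmod|auto].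
  - change (Rabs (Im (t - t0)) < eps)%R. eapply Rle_lt_trans; [apply Im_le_Cmod|auto].
Qed.

Lemma filterlim_C_seq (u : nat -> C) (l : C) (B r : R) (n0 : nat) :
  (0 <= r < 1)%R -> (forall n, (n0 <= n)%nat -> (Cmod (u n - l) <= B * r ^ n)%R) ->
  filterlim u eventually (locally l).
Proof.
  intros [r0 r1] h. apply filterlim_locally. intros eps.
  assert (hl : is_lim_seq (fun n => B * r ^ n)%R 0).
  { replace (Finite 0) with (Rbar_mult B 0) by (simpl; f_equal; ring).
    apply (is_lim_seq_scal_l _ B 0). apply is_lim_seq_geom. rewrite Rabs_pos_eq; auto. }
  apply is_lim_seq_spec in hl. destruct (hl eps) as [N HN].
  exists (max n0 N). intros n hn. apply C_Cmod_ball.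
  eapply Rle_lt_trans; [apply h; lia|].
  specialize (HN n ltac:(lia)). rewrite Rminus_0_r in HN.
  eapply Rle_lt_trans; [apply Rle_abs|exact HN].
Qed.

Lemma psum_sum_n (f : nat -> C) N : sum_n (G := C_AbelianMonoid) f N = psum f (S N).
Proof.
  induction N.
  - rewrite sum_O. simpl. now rewrite Cplus_0_l.
  - rewrite sum_Sn, IHN. reflexivity.
Qed.

Lemma taylor_analytic c t0 h : has_taylor c t0 h -> analytic_at (fun t => h t 0%R) t0.
Proof.
  intros [a [A [M H]]]. assert (hA := taylor_with_nonneg _ _ _ _ _ _ H).
  destruct H as [hM [ha H]]. exists (fun n => a n 0%R).
  apply (locally_Cmod _ _ (/ M)); [now apply Rinv_0_lt_compat|].
  intros t ht.
  assert (ht' : (M * Cmod (t - t0) < 1)%R).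
  { apply (Rmult_lt_compat_l M) in ht; [|lra]. rewrite Rinv_r in ht; lra. }
  destruct (H t ltac:(lra)) as [_ h2].
  assert (h0 : (0 <= M * Cmod (t - t0))%R) by (apply Rmult_le_pos; [lra|apply Cmod_ge_0]).
  unfold is_pseries, is_series.
  apply filterlim_C_seq with (B := A) (r := (M * Cmod (t - t0))%R) (n0 := O); [lra|].
  intros n _.
  specialize (h2 (S n) 0%R (Rle_refl 0)). rewrite Rmult_0_r, exp_0, Rmult_1_r in h2.
  match goal with |- (Cmod (?x - ?y) <= _)%R => replace (x - y) with (- (y - x)) by ring end.
  rewrite Cmod_opp.
  change (sum_n ?f n) with (sum_n (G := C_AbelianMonoid) f n).
  rewrite psum_sum_n.
  rewrite (psum_ext _ (fun n => ((t - t0) ^ n * a n 0%R)%C)).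
  2: { intros k _. change (scal ?x ?y) with (x * y). reflexivity. }
  eapply Rle_trans; [exact h2|].
  simpl. pose proof (pow_le _ n h0).
  assert ((M * Cmod (t - t0)) * (M * Cmod (t - t0)) ^ n <= (M * Cmod (t - t0)) ^ n)%R by nra.
  nra.
Qed.

(** * Uniqueness of the continuation along a segment *)

Definition psum_cvg (d : nat -> C) (u v : C) : Prop :=
  forall eps, (0 < eps)%R -> exists N, forall n, (N <= n)%nat ->
    (Cmod (psum (fun k => (u ^ k * d k)%C) n - v) < eps)%R.

Lemma pseries_cvp d u v : is_pseries (K := C_AbsRing) (V := C_NormedModule) d u v -> psum_cvg d u v.
Proof.
  intros h eps he. unfold is_pseries, is_series in h.
  assert (he2 : (0 < eps / 2)%R) by lra.
  assert (h1 := proj1 (filterlim_locally _ _) h (mkposreal _ he2)).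
  destruct h1 as [N HN]. exists (S N). intros [|n] hn; [lia|].
  specialize (HN n ltac:(lia)). apply C_ball_Cmod in HN. simpl in HN.
  replace (2 * (eps / 2))%R with eps in HN by field.
  eapply Rle_lt_trans; [|exact HN]. right. f_equal. f_equal.
  change (sum_n ?f n) with (sum_n (G := C_AbelianMonoid) f n). rewrite psum_sum_n.
  apply psum_ext. reflexivity.
Qed.

Lemma psum_cvg_minus a b u v w : psum_cvg a u v -> psum_cvg b u w -> psum_cvg (fun n => a n - b n) u (v - w).
Proof.
  intros h1 h2 eps he. destruct (h1 (eps / 2)%R) as [N1 H1]; [lra|]. destruct (h2 (eps / 2)%R) as [N2 H2]; [lra|].
  exists (max N1 N2). intros n hn. specialize (H1 n ltac:(lia)). specialize (H2 n ltac:(lia)).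
  rewrite (psum_ext _ (fun k => (u ^ k * a k + -(1) * (u ^ k * b k))%C)) by (intros; ring).
  rewrite psum_plus, psum_scal.
  match goal with |- (Cmod ?z < _)%R => replace z with
    ((psum (fun k => (u ^ k * a k)%C) n - v) + - (psum (fun k => (u ^ k * b k)%C) n - w)) by ring end.
  eapply Rle_lt_trans; [apply Cmod_triangle|]. rewrite Cmod_opp. lra.
Qed.

Lemma psum_cvg_terms_bounded d u v : psum_cvg d u v -> exists B, (0 <= B)%R /\ forall n, (Cmod (u ^ n * d n) <= B)%R.
Proof.
  intros h. destruct (h 1%R Rlt_0_1) as [N HN].
  assert (hfin : forall m, exists B, (0 <= B)%R /\ forall n, (n < m)%nat -> (Cmod (u ^ n * d n) <= B)%R).
  { induction m as [|m [B [B0 HB]]].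
    - exists 0%R. split; [lra|]. intros; lia.
    - exists (Rmax B (Cmod (u ^ m * d m))). split; [eapply Rle_trans; [exact B0|apply Rmax_l]|].
      intros n hn. destruct (Nat.eq_dec n m) as [->|]; [apply Rmax_r|].
      eapply Rle_trans; [apply HB; lia|apply Rmax_l]. }
  destruct (hfin N) as [B [B0 HB]]. exists (B + 2)%R. split; [lra|]. intros n.
  destruct (Nat.lt_ge_cases n N); [specialize (HB n H); lra|].
  assert (h1 := HN n H). assert (h2 := HN (S n) ltac:(lia)). simpl psum in h2.
  set (P := psum _ n) in *.
  replace (u ^ n * d n) with ((P + u ^ n * d n - v) + - (P - v)) by ring.
  eapply Rle_trans; [apply Cmod_triangle|]. rewrite Cmod_opp. lra.
Qed.

Lemma psum_cvg_zero_coefs (d : nat -> C) (rho dl : R) (F : R -> C) :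
  (0 < rho)%R -> (0 < dl)%R ->
  (forall u, (Rabs u < rho)%R -> psum_cvg d (RtoC u) (F u)) ->
  (forall u, (- dl < u < 0)%R -> F u = 0) ->
  forall n, d n = 0.
Proof.
  intros hr hd hc hz.
  set (r := (Rmin rho dl / 2)%R).
  assert (hr0 : (0 < r)%R) by (unfold r; apply Rdiv_lt_0_compat; [now apply Rmin_glb_lt|lra]).
  assert (hr1 : (r < rho)%R) by (unfold r; pose proof (Rmin_l rho dl); lra).
  assert (hr2 : (r < dl)%R) by (unfold r; pose proof (Rmin_r rho dl); lra).
  destruct (psum_cvg_terms_bounded d (RtoC r) (F r)) as [B [B0 HB]].
  { apply hc. rewrite Rabs_pos_eq; lra. }
  assert (HB' : forall n x, (0 <= x)%R -> (x ^ n * Cmod (d n) <= B * (x / r) ^ n)%R).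
  { intros n x hx. specialize (HB n). rewrite Cmod_mult, Cmod_pow, Cmod_R, Rabs_pos_eq in HB by lra.
    unfold Rdiv. rewrite Rpow_mult_distr, pow_inv.
    assert (hrn : (0 < r ^ n)%R) by (apply pow_lt; auto).
    assert (0 <= x ^ n)%R by (apply pow_le; auto).
    replace (x ^ n * Cmod (d n))%R with ((r ^ n * Cmod (d n)) * (x ^ n * / r ^ n))%R by (field; lra).
    replace (B * (x ^ n * / r ^ n))%R with (B * (x ^ n * / r ^ n))%R by ring.
    apply Rmult_le_compat_r; auto. apply Rmult_le_pos; auto. left; now apply Rinv_0_lt_compat. }
  intros m. induction m as [m IH] using lt_wf_ind.
  assert (tail : forall x N, (0 <= x)%R -> (2 * x <= r)%R ->
    (Cmod (psum (fun k => (RtoC (- x) ^ k * d k)%C) (S m + N) - RtoC (- x) ^ m * d m) <=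
      2 * B * (x / r) ^ S m * (1 - (1 / 2) ^ N))%R).
  { intros x N hx hxr.
    assert (hq : (0 <= x / r <= 1 / 2)%R).
    { split; [apply Rmult_le_pos; auto; left; now apply Rinv_0_lt_compat|].
      apply Rmult_le_reg_r with r; auto. unfold Rdiv. rewrite Rmult_assoc, Rinv_l; lra. }
    induction N.
    - rewrite Nat.add_0_r, psum_S.
      assert (e : psum (fun k => (RtoC (- x) ^ k * d k)%C) m = 0).
      { rewrite (psum_ext _ (fun _ => 0 * 0)); [rewrite psum_scal; ring|].
        intros k hk. rewrite IH by auto. ring. }
      rewrite e. match goal with |- (Cmod ?z <= _)%R => replace z with (RtoC 0) by ring end.
      rewrite Cmod_0. simpl. lra.
    - rewrite Nat.add_succ_r, psum_S.
      set (P := psum _ (S m + N)) in *.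
      match goal with |- (Cmod ?z <= _)%R =>
        replace z with (P - RtoC (- x) ^ m * d m + RtoC (- x) ^ (S m + N) * d (S m + N)%nat) by ring end.
      eapply Rle_trans; [apply Cmod_triangle|].
      rewrite (Cmod_mult (RtoC (- x) ^ (S m + N))), Cmod_pow, Cmod_R, Rabs_Ropp, (Rabs_pos_eq x) by auto.
      specialize (HB' (S m + N)%nat x hx).
      rewrite (pow_add (x / r)) in HB'.
      assert ((x / r) ^ N <= (1 / 2) ^ N)%R by (apply pow_incr; auto).
      assert (0 <= B * (x / r) ^ S m)%R by (apply Rmult_le_pos; auto; apply pow_le; lra).
      replace (2 * B * (x / r) ^ S m * (1 - (1 / 2) ^ S N))%R
        with (2 * B * (x / r) ^ S m * (1 - (1 / 2) ^ N) + B * (x / r) ^ S m * (1 / 2) ^ N)%R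
        by (simpl; field; lra).
      apply Rplus_le_compat; [exact IHN|].
      eapply Rle_trans; [exact HB'|]. rewrite <- Rmult_assoc. now apply Rmult_le_compat_l. }
  assert (key : forall x, (0 < x)%R -> (2 * x <= r)%R -> (Cmod (d m) <= 2 * B / r ^ S m * x)%R).
  { intros x hx hxr.
    assert (hxm : (0 < x ^ m)%R) by now apply pow_lt.
    assert (h1 : (x ^ m * Cmod (d m) <= 2 * B * (x / r) ^ S m)%R).
    { apply Rle_plus_epsilon. intros eps he.
      destruct (hc (- x)%R ltac:(rewrite Rabs_Ropp, Rabs_pos_eq; lra) eps he) as [N HN].
      rewrite (hz (- x)%R) in HN by lra.
      specialize (HN (S m + N)%nat ltac:(lia)). specialize (tail x N ltac:(lra) hxr).
      set (P := psum _ _) in *.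
      assert (e : (x ^ m * Cmod (d m))%R = Cmod (RtoC (- x) ^ m * d m)).
      { rewrite Cmod_mult, Cmod_pow, Cmod_R, Rabs_Ropp, Rabs_pos_eq; lra. }
      rewrite e.
      replace (RtoC (- x) ^ m * d m) with ((P - 0) + - (P - RtoC (- x) ^ m * d m)) by ring.
      eapply Rle_trans; [apply Cmod_triangle|]. rewrite Cmod_opp.
      assert (0 <= (1 / 2) ^ N)%R by (apply pow_le; lra).
      assert (0 <= 2 * B * (x / r) ^ S m)%R.
      { apply Rmult_le_pos; [lra|]. apply pow_le. left. now apply Rdiv_lt_0_compat. }
      nra. }
    apply Rmult_le_reg_l with (x ^ m)%R; auto.
    eapply Rle_trans; [exact h1|]. right. unfold Rdiv. rewrite Rpow_mult_distr, pow_inv.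
    simpl. field. split; [|lra]. apply pow_nonzero; lra. }
  assert (h0 : (Cmod (d m) <= 0)%R).
  { set (K := (2 * B / r ^ S m)%R) in *.
    assert (hK : (0 <= K)%R).
    { unfold K. apply Rmult_le_pos; [lra|]. left. apply Rinv_0_lt_compat. now apply pow_lt. }
    apply Rle_plus_epsilon. intros eps he. rewrite Rplus_0_l.
    set (x := Rmin (r / 2) (eps / (1 + K))).
    assert (0 < x)%R by (apply Rmin_glb_lt; [lra|apply Rdiv_lt_0_compat; lra]).
    assert (x <= r / 2)%R by apply Rmin_l.
    assert (hx2 : (x <= eps / (1 + K))%R) by apply Rmin_r.
    eapply Rle_trans; [apply (key x); lra|].
    apply (Rmult_le_compat_l (1 + K)) in hx2; [|lra].
    replace ((1 + K) * (eps / (1 + K)))%R with eps in hx2 by (field; lra). nra. }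
  apply Cmod_eq_0. pose proof (Cmod_ge_0 (d m)). lra.
Qed.

Lemma analytic_unique (g h : C -> C) :
  (forall t, (0 <= t <= 1)%R -> analytic_at g (RtoC t)) ->
  (forall t, (0 <= t <= 1)%R -> analytic_at h (RtoC t)) ->
  locally (RtoC 0) (fun t => g t = h t) -> g 1 = h 1.
Proof.
  intros hg hh h0.
  set (D := fun t : R => g (RtoC t) - h (RtoC t)).
  assert (hloc : forall t0, (0 <= t0 <= 1)%R -> exists (d : nat -> C) (rho : R), (0 < rho)%R /\
    forall u, (Rabs u < rho)%R -> psum_cvg d (RtoC u) (D (t0 + u)%R)).
  { intros t0 ht. destruct (hg t0 ht) as [a [e1 H1]]. destruct (hh t0 ht) as [b [e2 H2]].
    exists (fun n => a n - b n), (Rmin e1 e2). split; [apply Rmin_glb_lt; apply cond_pos|].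
    intros u hu.
    assert (hb : forall e : R, (Rabs u < e)%R -> ball (RtoC t0) e (RtoC (t0 + u))).
    { intros e he. apply C_Cmod_ball. rewrite RtoC_plus.
      replace (RtoC t0 + RtoC u - RtoC t0) with (RtoC u) by ring. now rewrite Cmod_R. }
    specialize (H1 (RtoC (t0 + u)) (hb _ (Rlt_le_trans _ _ _ hu (Rmin_l _ _)))).
    specialize (H2 (RtoC (t0 + u)) (hb _ (Rlt_le_trans _ _ _ hu (Rmin_r _ _)))).
    apply pseries_cvp in H1, H2.
    replace (RtoC (t0 + u) - RtoC t0) with (RtoC u) in H1, H2 by (rewrite RtoC_plus; ring).
    unfold D. now apply psum_cvg_minus. }
  set (E := fun tau : R => (0 <= tau <= 1)%R /\ forall t, (0 <= t <= tau)%R -> D t = 0).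
  assert (hE0 : exists e, (0 < e)%R /\ forall t, (Rabs t < e)%R -> D t = 0).
  { destruct h0 as [e He]. exists e. split; [apply cond_pos|]. intros t ht. unfold D.
    rewrite He; [ring|]. apply C_Cmod_ball. replace (RtoC t - RtoC 0) with (RtoC t) by ring.
    now rewrite Cmod_R. }
  destruct hE0 as [e0 [e0pos He0]].
  destruct (completeness E) as [tau [hub hlub]].
  { exists 1%R. intros x [hx _]. lra. }
  { exists 0%R. split; [lra|]. intros t ht. apply He0. replace t with 0%R by lra. now rewrite Rabs_R0. }
  assert (hbelow : forall t, (0 <= t < tau)%R -> D t = 0).
  { intros t ht. 
apply NNPP; intros hn.
assert (hu : is_upper_bound E t) by
      (intros x [hx1 hx2]; destruct (Rle_dec x t) as [|hxt]; auto; exfalso; apply hn, hx2; lra).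
apply hlub in hu; lra. }
  assert (htau1 : (tau <= 1)%R) by (apply hlub; intros x [hx _]; lra).
  assert (htau0 : (0 < tau)%R).
  { set (x := Rmin 1 (e0 / 2)).
    assert (0 < x)%R by (apply Rmin_glb_lt; lra).
    apply Rlt_le_trans with x; auto. apply hub. split.
    - split; [lra|apply Rmin_l].
    - intros t ht. apply He0. rewrite Rabs_pos_eq by lra.
      assert (x <= e0 / 2)%R by apply Rmin_r. lra. }
  destruct (hloc tau) as [d [rho [hrho hcv]]]; [lra|].
  assert (hd : forall n, d n = 0).
  { apply (psum_cvg_zero_coefs d rho tau (fun u => D (tau + u)%R)); auto.
    intros u hu. apply hbelow. lra. }
  assert (hz : forall u, (Rabs u < rho)%R -> D (tau + u)%R = 0).
  { intros u hu. apply Cmod_eq_0. apply Rle_antisym; [|apply Cmod_ge_0].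
    apply Rle_plus_epsilon. intros eps he. rewrite Rplus_0_l.
    destruct (hcv u hu eps he) as [N HN]. specialize (HN N (le_n N)).
    rewrite (psum_ext _ (fun _ => 0 * 0)) in HN by (intros; rewrite hd; ring).
    rewrite psum_scal in HN.
    replace (0 * psum (fun _ => 0) N - D (tau + u)%R) with (- D (tau + u)%R) in HN by ring.
    rewrite Cmod_opp in HN. lra. }
  assert (htau : tau = 1%R).
  { destruct (Rle_lt_or_eq_dec tau 1 htau1) as [hlt|]; auto. exfalso.
    set (x := Rmin 1 (tau + rho / 2)).
    assert (hx : (tau < x)%R) by (apply Rmin_glb_lt; lra).
    assert (hxE : E x).
    { split; [split; [lra|apply Rmin_l]|]. intros t ht.
      destruct (Rlt_dec t tau); [apply hbelow; lra|].
      replace t with (tau + (t - tau))%R by ring. apply hz. rewrite Rabs_pos_eq by lra.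
      assert (x <= tau + rho / 2)%R by apply Rmin_r. lra. }
    apply hub in hxE. lra. }
  assert (h1 : D 1%R = 0).
  { replace 1%R with (tau + 0)%R by lra. apply hz. now rewrite Rabs_R0. }
  unfold D in h1. replace (g 1) with (g 1 - h 1 + h 1) by ring. rewrite h1. ring.
Qed.

Lemma is_Li_unique n y v w : is_Li n y v -> is_Li n y w -> v = w.
Proof.
  intros [g [g1 [g2 g3]]] [h [h1 [h2 h3]]]. rewrite <- g3, <- h3.
  apply analytic_unique; auto.
  generalize (filter_and _ _ g2 h2). apply filter_imp. intros t [a b].
  exact (filterlim_locally_unique _ _ _ a b).
Qed.

(** * Multiple polylogarithms as iterated integrals *)

Lemma Csum_app l1 l2 : Csum (l1 ++ l2) = Csum l1 + Csum l2.
Proof. induction l1; simpl; [ring|]. rewrite IHl1. ring. Qed.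

Lemma Csum_scal {T} (a : C) (f : T -> C) l : Csum (map (fun x => a * f x) l) = a * Csum (map f l).
Proof. induction l; simpl; [ring|]. rewrite IHl. ring. Qed.

Lemma Csum_plus {T} (f g : T -> C) l : Csum (map (fun x => f x + g x) l) = Csum (map f l) + Csum (map g l).
Proof. induction l; simpl; [ring|]. rewrite IHl. ring. Qed.

Lemma decaying_Csum {T} (h : T -> R -> C) l : (forall x, In x l -> decaying (h x)) -> decaying (fun s => Csum (map (fun x => h x s) l)).
Proof.
  induction l; simpl; intros H; [apply decaying_zero|]. apply decaying_plus; auto.
Qed.

Lemma moderate_Csum {T} (h : T -> R -> C) l : (forall x, In x l -> moderate (h x)) -> moderate (fun s => Csum (map (fun x => h x s) l)).
Proof.
  induction l; simpl; intros H; [apply moderate_const|]. apply moderate_plus; auto.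
Qed.

Lemma tail_iter_Csum {T} n (h : T -> R -> C) l : (forall x, In x l -> decaying (h x)) ->
  tail_iter n (fun s => Csum (map (fun x => h x s) l)) = fun s => Csum (map (fun x => tail_iter n (h x) s) l).
Proof.
  induction l; simpl; intros H.
  - induction n; simpl; auto. unfold tail_iter in *; simpl. rewrite IHn. symmetry.
    apply tail_unique; [apply decaying_zero| |apply decaying_exp_decay, decaying_zero].
    intros; eapply derC_eq; [apply derC_const|ring].
  - rewrite tail_iter_plus; auto using decaying_Csum. now rewrite IHl by auto.
Qed.

Lemma steps_zero l : kernels l -> steps l (fun _ => 0) = fun _ => 0.
Proof.
  intros hl. assert (e := steps_scal l (fun _ => 0) 0 hl (moderate_const 0)). cbv beta in e.
  replace (fun _ : R => 0 * 0) with (fun _ : R => RtoC 0) in e by (apply functional_extensionality; intros; ring).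
  rewrite e. apply functional_extensionality; intros; ring.
Qed.

Lemma steps_Csum {T} L (h : T -> R -> C) l : kernels L -> (forall x, In x l -> moderate (h x)) ->
  steps L (fun s => Csum (map (fun x => h x s) l)) = fun s => Csum (map (fun x => steps L (h x) s) l).
Proof.
  intros hL. induction l; simpl; intros H; [now apply steps_zero|].
  rewrite steps_plus; auto using moderate_Csum. now rewrite IHl by auto.
Qed.

Lemma tail_iter_ext_ge n (f g : R -> C) : decaying f -> decaying g -> (forall u, (0 <= u)%R -> f u = g u) ->
  forall u, (0 <= u)%R -> tail_iter n f u = tail_iter n g u.
Proof.
  intros hf hg h. induction n; simpl; auto. intros u hu.
  unfold tail_iter in *; simpl. apply tail_ext_ge; auto.
  - intros v hv. apply IHn. lra.
  - apply (tail_iter_decaying n f hf).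
  - apply (tail_iter_decaying n g hg).
Qed.

Lemma steps_ext_ge ns (ks ks' : list (R -> C)) f g :
  Forall kernel ks -> Forall2 (fun p q => kernel q /\ forall s, (0 <= s)%R -> p s = q s) ks ks' ->
  moderate f -> moderate g -> (forall u, (0 <= u)%R -> f u = g u) ->
  forall u, (0 <= u)%R -> steps (combine ns ks) f u = steps (combine ns ks') g u.
Proof.
  intros hk h2; revert ns f g; induction h2 as [|p q ks ks' [hq hpq] h2 IH]; intros [|n ns] f g hf hg h; simpl; auto.
  inversion hk; subst. apply IH; auto; try (apply decaying_moderate; now apply step_decaying).
  unfold step. apply tail_iter_ext_ge; try now apply kernel_mul_decaying.
  intros u hu. now rewrite hpq, h.
Qed.

Lemma kernel_geom_clip Y : (exists dl, (0 < dl)%R /\ forall x, (0 <= x <= 1)%R -> (dl <= Cmod (1 - Y * RtoC x))%R) ->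
  kernel (geom_clip Y).
Proof.
  intros [dl [hd hb]].
  assert (hx : forall s, (0 <= exp (- Rmax s 0) <= 1)%R).
  { intros s. split; [left; apply exp_pos|]. rewrite <- exp_0. apply exp_le. pose proof (Rmax_r s 0). lra. }
  assert (hn : forall s, 1 - Y * RtoC (exp (- Rmax s 0)) <> 0).
  { intros s e. specialize (hb _ (hx s)). rewrite e, Cmod_0 in hb. lra. }
  assert (hce : contC (fun s => RtoC (exp (- Rmax s 0)))).
  { apply (contC_comp (fun s => RtoC (exp (- s)))); auto using continuous_Rmax0.
    apply contC_RtoC, continuous_exp_opp. }
  assert (hc : contC (fun s => Y * RtoC (exp (- Rmax s 0)))) by (apply contC_mult; auto using contC_const).
  split.
  - unfold geom_clip, geom, frac, Cdiv. apply contC_mult; auto. apply contC_inv; auto.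
    apply contC_plus; auto using contC_const, contC_opp.
  - exists (Cmod Y / dl)%R. intros s hs. unfold geom_clip, geom, frac.
    rewrite Cmod_div by apply hn. rewrite Cmod_mult, Cmod_R, Rmax_left by auto.
    rewrite Rabs_pos_eq by (left; apply exp_pos).
    specialize (hb _ (hx s)). rewrite Rmax_left in hb by auto.
    replace (Cmod Y / dl * exp (- s))%R with (Cmod Y * exp (- s) * / dl)%R by (field; lra).
    unfold Rdiv.
    apply Rmult_le_compat_l; [apply Rmult_le_pos; [apply Cmod_ge_0|left; apply exp_pos]|].
    now apply Rinv_le_contravar.
Qed.

Lemma kernel_geom Y : pole_free Y -> kernel (geom Y) /\ kernel (geom_clip Y).
Proof.
  intros h. destruct (pole_free_lower_bound Y h) as [dl [hd hb]].
  assert (hk : kernel (geom_clip Y)) by (apply kernel_geom_clip; exists dl; split; auto; intros; apply hb; lra).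
  split; auto. destruct hk as [_ [K hK]].
  assert (hn : forall s, 1 - Y * RtoC (exp (- s)) <> 0).
  { intros s e. specialize (hb _ (Rlt_le _ _ (exp_pos (- s)))). rewrite e, Cmod_0 in hb. lra. }
  assert (hc : contC (fun s => Y * RtoC (exp (- s)))).
  { apply contC_mult; auto using contC_const. apply contC_RtoC, continuous_exp_opp. }
  split.
  - unfold geom, frac, Cdiv. apply contC_mult; auto. apply contC_inv; auto.
    apply contC_plus; auto using contC_const, contC_opp.
  - exists K. intros s hs. specialize (hK s hs). unfold geom_clip in hK. rewrite Rmax_left in hK; auto.
Qed.

Fixpoint suffix_prods (ys : list C) : list C :=
  match ys with [] => [] | y :: ys' => y * Cprod ys' :: suffix_prods ys' end.

Definition LI (ns : list nat) (ys : list C) : C :=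
  steps (combine ns (map geom (suffix_prods ys))) (fun _ => 1) 0%R.

Definition exp_mono (P : C) (k : nat) (s : R) : C := (P * RtoC (exp (- s))) ^ k.

Lemma exp_mono_derC P k s : derC (exp_mono P k) s (- (RtoC (INR k) * exp_mono P k s)).
Proof.
  unfold exp_mono. induction k.
  - simpl. eapply derC_eq; [apply derC_const|]. ring.
  - rewrite S_INR, RtoC_plus. simpl. eapply derC_eq.
    + apply derC_mult; [|exact IHk]. apply derC_scal.
      apply (derC_RtoC (fun s => exp (- s))). auto_derive; auto.
    + replace (RtoC (- (1) * exp (- s))) with (- RtoC (exp (- s))).
      * ring.
      * apply C_eq; simpl; ring.
Qed.

Lemma exp_mono_cont P k : contC (exp_mono P k).
Proof. eapply derC_cont; intros; apply exp_mono_derC. Qed.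

Lemma exp_mono_Cmod P k s : (0 <= s)%R -> (Cmod (exp_mono P k s) <= Cmod P ^ k * exp (- INR k * s))%R.
Proof.
  intros hs. unfold exp_mono. rewrite Cmod_pow, Cmod_mult, Cmod_R, Rabs_pos_eq by (left; apply exp_pos).
  rewrite Rpow_mult_distr. right. f_equal.
  induction k; simpl pow; [simpl; rewrite Ropp_0, Rmult_0_l, exp_0; auto|].
  rewrite IHk, S_INR, <- exp_plus. f_equal. ring.
Qed.

Lemma exp_mono_decaying P k : decaying (exp_mono P (S k)).
Proof.
  split; [apply exp_mono_cont|]. exists (Cmod P ^ (S k))%R, (INR (S k)).
  split; [apply lt_0_INR; lia|]. intros; now apply exp_mono_Cmod.
Qed.

Lemma exp_mono_moderate P k : moderate (exp_mono P k).
Proof. destruct k; [apply (moderate_const 1)|apply decaying_moderate, exp_mono_decaying]. Qed.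

Lemma tail_iter_exp_mono n P k : (1 <= k)%nat -> tail_iter n (exp_mono P k) = fun s => / RtoC (INR k) ^ n * exp_mono P k s.
Proof.
  intros hk. assert (hW : decaying (exp_mono P k)) by (destruct k; [lia|apply exp_mono_decaying]). rename k into K.
  assert (hK : RtoC (INR K) <> 0).
  { intros e. apply RtoC_inj in e. revert e. apply not_0_INR. lia. }
  induction n; simpl.
  - apply functional_extensionality; intros. field.
  - unfold tail_iter in *; simpl. rewrite IHn. symmetry. apply tail_unique.
    + now apply decaying_scal.
    + intros s. eapply derC_eq; [apply derC_scal, exp_mono_derC|]. field.
      split; auto. now apply Cpow_nz.
    + now apply exp_decay_scal, decaying_exp_decay.
Qed.

Lemma frac_geom (w : C) k N : 1 - w <> 0 -> (k <= N)%nat ->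
  frac w * w ^ k = Csum (map (fun K => w ^ K) (seq (S k) (N - k))) + w ^ S N / (1 - w).
Proof.
  intros hw hk.
  enough (H : forall m, frac w * w ^ k = Csum (map (fun K => w ^ K) (seq (S k) m)) + w ^ S (k + m) / (1 - w)).
  { rewrite (H (N - k)%nat). now replace (k + (N - k))%nat with N by lia. }
  induction m as [|m IH].
  - rewrite Nat.add_0_r. simpl. unfold frac. field; auto.
  - rewrite seq_S, map_app, Csum_app, IH. replace (S k + m)%nat with (S (k + m)) by lia.
    replace (k + S m)%nat with (S (k + m)) by lia. simpl. field; auto.
Qed.

Lemma Csum_geom_bound (f : nat -> C) (B : R) a m : (forall K, (a <= K < a + m)%nat -> (Cmod (f K) <= B * (1 / 2) ^ K)%R) ->
  (Cmod (Csum (map f (seq a m))) <= 2 * B * ((1 / 2) ^ a - (1 / 2) ^ (a + m)))%R.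
Proof.
  induction m; intros h.
  - simpl. rewrite Cmod_0, Nat.add_0_r. lra.
  - rewrite seq_S, map_app, Csum_app. eapply Rle_trans; [apply Cmod_triangle|].
    simpl (Csum (map f [(a + m)%nat])). replace (f (a + m)%nat + 0) with (f (a + m)%nat) by ring.
    assert (h1 := h (a + m)%nat ltac:(lia)). rewrite Nat.add_succ_r. simpl pow.
    specialize (IHm ltac:(intros; apply h; lia)). lra.
Qed.

Definition klist (ny : list (nat * C)%type) : list (nat * (R -> C))%type :=
  combine (map fst ny) (map geom_clip (suffix_prods (map snd ny))).
Definition small (y : C) : Prop := (Cmod y <= 1 / 2)%R.

Lemma Cprod_small ys : Forall small ys -> (Cmod (Cprod ys) <= 1)%R.
Proof.
  induction 1 as [|y ys hy _ IH]; simpl; [rewrite Cmod_1; lra|].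
  rewrite Cmod_mult. red in hy. pose proof (Cmod_ge_0 y). pose proof (Cmod_ge_0 (Cprod ys)). nra.
Qed.

Lemma small_kernel Y : small Y -> (forall x, (0 <= x <= 1)%R -> (1 / 2 <= Cmod (1 - Y * RtoC x))%R).
Proof.
  unfold small. intros h x hx. assert (h3 := Cmod_triangle (1 - Y * RtoC x) (Y * RtoC x)).
  replace (1 - Y * RtoC x + Y * RtoC x) with (RtoC 1) in h3 by ring.
  rewrite Cmod_1, Cmod_mult, Cmod_R, Rabs_pos_eq in h3 by lra.
  pose proof (Cmod_ge_0 Y). nra.
Qed.

Lemma kernels_combine ns ks : Forall kernel ks -> kernels (combine ns ks).
Proof.
  intros h; revert ns; induction h; intros [|n ns]; simpl; constructor; auto. apply IHh.
Qed.

Lemma klist_kernels ny : Forall small (map snd ny) -> kernels (klist ny).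
Proof.
  intros h. apply kernels_combine. induction h; simpl; constructor; auto.
  apply kernel_geom_clip. exists (1 / 2)%R. split; [lra|]. apply small_kernel.
  red. rewrite Cmod_mult. red in H. pose proof (Cprod_small _ h).
  pose proof (Cmod_ge_0 x). pose proof (Cmod_ge_0 (Cprod l)). nra.
Qed.

Lemma series_bound ny : Forall small (map snd ny) -> exists A, (0 <= A)%R /\
  forall k N, (k <= N)%nat ->
    (Cmod (steps (klist ny) (exp_mono (Cprod (map snd ny)) k) 0%R - Li_trunc ny k N) <= A * (1 / 2) ^ N)%R.
Proof.
  induction ny as [|[n y] ny IH]; intros h.
  - exists 0%R. split; [lra|]. intros k N _. simpl. unfold exp_mono. rewrite Ropp_0, exp_0.
    replace (1 * 1) with (RtoC 1) by ring. rewrite Cpow_1_l.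
    replace (1 - 1) with (RtoC 0) by ring. rewrite Cmod_0. lra.
  - simpl in h. inversion h as [|? ? hy h' e1]; subst.
    destruct (IH h') as [A [hA HA]].
    assert (hk := klist_kernels _ h').
    destruct (steps_moderate_le _ hk) as [K [hK HK]].
    set (P := Cprod (map snd ny)) in *. set (Y := y * P).
    assert (hP : (Cmod P <= 1)%R) by now apply Cprod_small.
    assert (hY : small Y).
    { red. unfold Y. rewrite Cmod_mult. red in hy. pose proof (Cmod_ge_0 y). pose proof (Cmod_ge_0 P). nra. }
    assert (hlow := small_kernel Y hY).
    assert (hker : kernel (geom_clip Y)).
    { apply kernel_geom_clip. exists (1 / 2)%R. split; [lra|auto]. }
    exists (K * 4 ^ n + 2 * A)%R. split.
    { pose proof (pow_le 4 n ltac:(lra)). nra. }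
    intros k N hkN.
    set (L := seq (S k) (N - k)).
    assert (hL : forall K, In K L -> (1 <= K)%nat) by (intros j hj; apply in_seq in hj; lia).
    set (err := fun s => geom_clip Y s * exp_mono Y k s + -(1) * Csum (map (fun K => exp_mono Y K s) L)).
    assert (hek : decaying (fun s => Csum (map (fun K => exp_mono Y K s) L))).
    { apply decaying_Csum. intros j hj. apply hL in hj. destruct j; [lia|apply exp_mono_decaying]. }
    assert (herr : decaying err).
    { apply decaying_plus; [apply kernel_mul_decaying; auto using exp_mono_moderate|]. now apply decaying_scal. }
    assert (e1 : step n (geom_clip Y) (exp_mono Y k) =
      fun s => Csum (map (fun K => / RtoC (INR K) ^ n * y ^ K * exp_mono P K s) L) + tail_iter n err s).
    { unfold step.
      replace (fun s => geom_clip Y s * exp_mono Y k s) with (fun s => Csum (map (fun K => exp_mono Y K s) L) + err s).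
      2: { apply functional_extensionality; intros s. unfold err. ring. }
      rewrite tail_iter_plus; auto. apply functional_extensionality; intros s. f_equal.
      rewrite tail_iter_Csum.
      2: { intros j hj. apply hL in hj. destruct j; [lia|apply exp_mono_decaying]. }
      f_equal. apply map_ext_in. intros j hj. rewrite tail_iter_exp_mono by auto.
      unfold exp_mono, Y. rewrite <- Cmult_assoc, (Cpow_mult_l y). ring. }
    simpl klist. unfold klist. simpl. fold (klist ny). fold P. fold Y. rewrite e1.
    rewrite steps_plus; auto.
    2: { apply moderate_Csum. intros; apply moderate_scal, exp_mono_moderate. }
    2: { apply decaying_moderate. now apply tail_iter_decaying. }
    rewrite steps_Csum; auto.
    2: { intros; apply moderate_scal, exp_mono_moderate. }
    fold L.
    assert (berr : moderate_le (4 ^ n * (1 / 2) ^ N) (tail_iter n err)).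
    { assert (b0 : forall s, (0 <= s)%R -> (Cmod (err s) <= (1 / 2) ^ N * exp (- (1 / 2) * s))%R).
      { intros s hs. unfold err, geom_clip. rewrite Rmax_left by auto. unfold geom, exp_mono.
        set (w := Y * RtoC (exp (- s))).
        assert (hx : (0 <= exp (- s) <= 1)%R).
        { split; [left; apply exp_pos|]. rewrite <- exp_0. apply exp_le. lra. }
        assert (hl1 := hlow _ hx). fold w in hl1.
        assert (hw1 : 1 - w <> 0) by (intros e; rewrite e, Cmod_0 in hl1; lra).
        rewrite (frac_geom w k N) by auto. fold L.
        match goal with |- (Cmod ?z <= _)%R => replace z with (w ^ S N / (1 - w)) by ring end.
        rewrite Cmod_div by auto. rewrite Cmod_pow.
        assert (hwm : (Cmod w <= 1 / 2 * exp (- s))%R).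
        { unfold w. rewrite Cmod_mult, Cmod_R, Rabs_pos_eq by lra. apply Rmult_le_compat_r; [lra|exact hY]. }
        assert (hw2 : (Cmod w <= 1 / 2)%R) by lra.
        assert (hp : (Cmod w ^ N <= (1 / 2) ^ N)%R) by (apply pow_incr; split; auto; apply Cmod_ge_0).
        assert (hes : (exp (- s) <= exp (- (1 / 2) * s))%R) by (apply exp_le; lra).
        pose proof (pow_le (1 / 2) N ltac:(lra)) as hp0.
        pose proof (Cmod_ge_0 w). pose proof (pow_le _ N H).
        apply Rle_trans with (Cmod w ^ S N * 2)%R.
        - unfold Rdiv. apply Rmult_le_compat_l; [now apply pow_le|].
          replace 2%R with (/ (1 / 2))%R by field. apply Rinv_le_contravar; lra.
        - simpl. apply Rle_trans with ((1 / 2 * exp (- s)) * (1 / 2) ^ N * 2)%R.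
          + apply Rmult_le_compat_r; [lra|]. apply Rmult_le_compat; auto.
          + assert ((1 / 2) ^ N * exp (- s) <= (1 / 2) ^ N * exp (- (1 / 2) * s))%R by (apply Rmult_le_compat_l; auto).
            lra. }
      intros s hs. eapply Rle_trans; [apply (tail_iter_bound n err ((1 / 2) ^ N) (1 / 2) herr ltac:(lra) b0 s hs)|].
      replace (2 / (1 / 2))%R with 4%R by field.
      apply Rmult_le_compat_l; [apply Rmult_le_pos; apply pow_le; lra|]. apply exp_le; lra. }
    assert (b1 := HK _ _ (decaying_moderate _ (tail_iter_decaying n _ herr)) berr 0%R (Rle_refl 0)).
    replace (0 / 2)%R with 0%R in b1 by lra. rewrite exp_0, Rmult_1_r in b1.
    simpl Li_trunc. fold L.
    match goal with |- (Cmod (?S1 + ?E - ?S2) <= _)%R => replace (S1 + E - S2) with ((S1 + -(1) * S2) + E) by ring end.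
    rewrite <- Csum_scal, <- Csum_plus.
    eapply Rle_trans; [apply Cmod_triangle|].
    assert (b2 : (Cmod (Csum (map (fun K => (steps (klist ny) (fun s => / RtoC (INR K) ^ n * y ^ K * exp_mono P K s) 0%R
        + -(1) * (y ^ K / RtoC (INR K) ^ n * Li_trunc ny K N))%C) L)) <= 2 * A * (1 / 2) ^ N)%R).
    { unfold L. eapply Rle_trans; [apply (Csum_geom_bound _ (A * (1 / 2) ^ N))|].
      - intros j hj. rewrite steps_scal; auto using exp_mono_moderate.
        replace (/ RtoC (INR j) ^ n * y ^ j * steps (klist ny) (exp_mono P j) 0%R + -(1) * (y ^ j / RtoC (INR j) ^ n * Li_trunc ny j N))
          with (/ RtoC (INR j) ^ n * y ^ j * (steps (klist ny) (exp_mono P j) 0%R - Li_trunc ny j N)) by (unfold Cdiv; ring).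
        rewrite !Cmod_mult.
        assert (hj1 : (1 <= INR j)%R) by (replace 1%R with (INR 1) by reflexivity; apply le_INR; lia).
        assert (hjn : (1 <= INR j ^ n)%R) by now apply pow_R1_Rle.
        assert (i1 : (Cmod (/ RtoC (INR j) ^ n) <= 1)%R).
        { rewrite Cmod_inv.
          - rewrite Cmod_pow, Cmod_R, Rabs_pos_eq by lra. rewrite <- Rinv_1. apply Rinv_le_contravar; lra.
          - apply Cpow_nz. intros e. apply RtoC_inj in e. lra. }
        assert (i2 : (Cmod (y ^ j) <= (1 / 2) ^ j)%R).
        { rewrite Cmod_pow. apply pow_incr. split; auto using Cmod_ge_0. }
        assert (i3 := HA j N ltac:(lia)).
        replace (A * (1 / 2) ^ N * (1 / 2) ^ j)%R with (1 * (1 / 2) ^ j * (A * (1 / 2) ^ N))%R by ring.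
        apply Rmult_le_compat; auto using Cmod_ge_0.
        + apply Rmult_le_pos; apply Cmod_ge_0.
        + apply Rmult_le_compat; auto using Cmod_ge_0.
      - replace (2 * A * (1 / 2) ^ N)%R with (2 * (A * (1 / 2) ^ N) * 1)%R by ring.
        apply Rmult_le_compat_l.
        + pose proof (pow_le (1 / 2) N ltac:(lra)). nra.
        + pose proof (pow_le (1 / 2) (S k + (N - k)) ltac:(lra)).
          assert ((1 / 2) ^ S k <= 1)%R by (apply Rle_trans with (1 ^ S k)%R; [apply pow_incr; lra|rewrite pow1; lra]). lra. }
    lra.
Qed.

Definition off_ray (Y : C) : Prop := ~ exists x : R, (0 <= x)%R /\ Y = RtoC x.

Lemma off_ray_scale Y x : (0 < x)%R -> off_ray Y -> off_ray (Y * RtoC x).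
Proof.
  intros hx h [u [hu e]]. apply h. exists (u / x)%R. split.
  - apply Rmult_le_pos; auto. left. now apply Rinv_0_lt_compat.
  - unfold Rdiv. rewrite RtoC_mult, <- e, RtoC_inv by lra. field.
    intros e'. apply RtoC_inj in e'. lra.
Qed.

Lemma off_ray_pole_free Y : off_ray Y -> pole_free Y.
Proof.
  intros h x hx e. destruct hx as [hx|hx].
  - apply (off_ray_scale Y x hx h). exists 1%R. split; [lra|auto].
  - subst x. replace (Y * 0) with (RtoC 0) in e by ring. apply RtoC_inj in e. lra.
Qed.

Lemma pole_free_0 : pole_free 0.
Proof. intros x _ e. replace (0 * RtoC x) with (RtoC 0) in e by ring. apply RtoC_inj in e. lra. Qed.

Lemma off_ray_nonzero Y : off_ray Y -> Y <> 0.
Proof. intros h e. apply h. exists 0%R. split; [lra|auto]. Qed.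

Lemma off_ray_inv Y : off_ray Y -> off_ray (/ Y).
Proof.
  intros h [x [hx e]]. apply h. exists (/ x)%R.
  assert (hY := off_ray_nonzero Y h).
  assert (x <> 0%R).
  { intros ->. assert (e1 : Y * / Y = 1) by (field; auto). rewrite e in e1.
    replace (Y * 0) with (RtoC 0) in e1 by ring. apply RtoC_inj in e1. lra. }
  split; [left; apply Rinv_0_lt_compat; lra|].
  rewrite RtoC_inv, <- e by auto. field; auto.
Qed.

Fixpoint suffix_degs (ys : list C) : list (C * nat)%type :=
  match ys with [] => [] | y :: ys' => (y * Cprod ys', S (length ys')) :: suffix_degs ys' end.
Lemma suffix_prods_scale t ys : suffix_prods (map (Cmult t) ys) = map (fun p => fst p * t ^ snd p) (suffix_degs ys).
Proof.
  assert (e : forall l, Cprod (map (Cmult t) l) = Cprod l * t ^ length l).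
  { induction l; simpl; [ring|]. rewrite IHl. ring. }
  induction ys; simpl; auto. rewrite IHys, e. f_equal. ring.
Qed.

Lemma at_param_combine t ns (ks : list (C -> R -> C)) :
  at_param t (combine ns ks) = combine ns (map (fun k => k t) ks).
Proof.
  revert ks; induction ns; intros [|k ks]; simpl; auto. unfold at_param in *. now rewrite IHns.
Qed.

Lemma Forall_combine_r {T U} (P : U -> Prop) (l : list T) (l' : list U) :
  Forall P l' -> Forall (fun p => P (snd p)) (combine l l').
Proof. intros h; revert l; induction h; intros [|a l0]; simpl; constructor; auto. Qed.

Lemma scale_small ys : exists r, (0 < r)%R /\ forall t, (Cmod t < r)%R -> Forall small (map (Cmult t) ys).
Proof.
  induction ys as [|y ys [r [hr IH]]].
  - exists 1%R. split; [lra|]. constructor.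
  - pose proof (Cmod_ge_0 y).
    assert (hp : (0 < / (2 * (1 + Cmod y)))%R) by (apply Rinv_0_lt_compat; lra).
    exists (Rmin r (/ (2 * (1 + Cmod y))))%R.
    split; [now apply Rmin_glb_lt|].
    intros t ht. simpl. constructor.
    + red. rewrite Cmod_mult.
      assert (h1 : (Cmod t <= / (2 * (1 + Cmod y)))%R).
      { left. eapply Rlt_le_trans; [exact ht|apply Rmin_r]. }
      apply Rle_trans with (/ (2 * (1 + Cmod y)) * (1 + Cmod y))%R.
      * apply Rmult_le_compat; auto using Cmod_ge_0. lra.
      * right. field. lra.
    + apply IH. eapply Rlt_le_trans; [exact ht|apply Rmin_l].
Qed.

Lemma map_fst_combine {T U} (l : list T) (l' : list U) : length l = length l' -> map fst (combine l l') = l.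
Proof. revert l'; induction l; intros [|b l'] h; simpl in *; try lia; auto. rewrite IHl; auto. Qed.

Lemma map_snd_combine {T U} (l : list T) (l' : list U) : length l = length l' -> map snd (combine l l') = l'.
Proof. revert l'; induction l; intros [|b l'] h; simpl in *; try lia; auto. rewrite IHl; auto. Qed.

Lemma LI_is_Li ns ys : length ns = length ys -> Forall off_ray (suffix_prods ys) -> is_Li ns ys (LI ns ys).
Proof.
  intros hlen hoff.
  set (fam := combine ns (map (fun p t => geom_clip (fst p * t ^ snd p)) (suffix_degs ys))).
  exists (fun t => steps (at_param t fam) (fun _ => 1) 0%R).
  assert (efam : forall t, at_param t fam = combine ns (map geom_clip (suffix_prods (map (Cmult t) ys)))).
  { intros t. unfold fam. rewrite at_param_combine, suffix_prods_scale, !map_map. auto. }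
  split; [|split].
  - intros t ht. apply taylor_analytic with (c := (1 / 2)%R) (h := fun t => steps (at_param t fam) (fun _ => 1)).
    apply (taylor_op (RtoC t) fam (fun _ _ => 1)).
    + apply Forall_combine_r. rewrite Forall_map.
      assert (hd : Forall (fun p => off_ray (fst p) /\ exists m, snd p = S m) (suffix_degs ys)).
      { clear -hoff. induction ys; simpl in *; constructor; inversion hoff; subst; simpl; eauto. }
      eapply Forall_impl; [|exact hd]. intros [Y m'] [hY [m ->]]. simpl in *.
      apply (taylor_geom_clip Y (RtoC t) (S m)).
      destruct (Req_dec t 0) as [->|hn].
      * replace (Y * 0 ^ S m) with (RtoC 0) by (simpl; ring). apply pole_free_0.
      * apply off_ray_pole_free. rewrite <- RtoC_pow. apply off_ray_scale; auto. apply pow_lt; lra.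
    + apply (taylor_weight 0); [lra|]. apply taylor_const with 1%R; [apply contC_const|].
      intros. rewrite Cmod_1, Rmult_0_l, exp_0. lra.
  - destruct (scale_small ys) as [r [hr hsm]].
    apply (locally_Cmod _ _ r hr). intros t ht.
    replace (t - 0) with t in ht by ring. specialize (hsm t ht).
    set (ty := map (Cmult t) ys) in *.
    assert (hl : length ns = length ty) by (unfold ty; now rewrite length_map).
    rewrite efam. fold ty.
    destruct (series_bound (combine ns ty)) as [A [hA HA]].
    { now rewrite map_snd_combine. }
    unfold klist in HA. rewrite map_fst_combine, map_snd_combine in HA by auto.
    unfold is_Li_series. apply filterlim_C_seq with (B := A) (r := (1 / 2)%R) (n0 := O); [lra|].
    intros N _. specialize (HA O N (Nat.le_0_l N)).
    match goal with |- (Cmod (?x - ?y) <= _)%R => replace (x - y) with (- (y - x)) by ring end.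
    rewrite Cmod_opp. exact HA.
  - rewrite efam. replace (map (Cmult 1) ys) with ys.
    2: { symmetry. rewrite <- (map_id ys) at 2. apply map_ext. intros; ring. }
    assert (hok : Forall pole_free (suffix_prods ys)) by (eapply Forall_impl; [|exact hoff]; apply off_ray_pole_free).
    unfold LI. apply steps_ext_ge; auto using moderate_const; [| |lra].
    + rewrite Forall_map. eapply Forall_impl; [|exact hok]. intros Y hY. now apply kernel_geom.
    + clear -hok. induction hok; simpl; constructor; auto. split; [exact (proj1 (kernel_geom _ H))|].
      intros s hs. unfold geom_clip. now rewrite Rmax_left.
Qed.

Lemma Li_eq_LI ns ys : length ns = length ys -> Forall off_ray (suffix_prods ys) -> Li ns ys = LI ns ys.
Proof.
  intros h1 h2. assert (H := LI_is_Li ns ys h1 h2).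
  apply (is_Li_unique ns ys); auto. unfold Li.
  apply (epsilon_spec (inhabits (RtoC 0)) (is_Li ns ys)). eauto.
Qed.

(** * Bernoulli polynomials *)

Definition bhat (n : nat) (x : C) : C := bernoulli_poly n x / RtoC (INR (fact n)).

Lemma length_bernoulli_polys n x : length (bernoulli_polys n x) = n.
Proof. induction n; simpl; auto. rewrite length_app, IHn. simpl. lia. Qed.

Lemma nth_bernoulli_polys n k x : (k < n)%nat -> nth k (bernoulli_polys n x) 0 = bernoulli_poly k x.
Proof.
  induction n; [lia|]. intros hk. destruct (Nat.eq_dec k n) as [->|hn]; auto.
  simpl. rewrite app_nth1 by (rewrite length_bernoulli_polys; lia). apply IHn; lia.
Qed.

Lemma INR_fact_neq n : RtoC (INR (fact n)) <> 0.
Proof. intros e. apply RtoC_inj in e. revert e. apply INR_fact_neq_0. Qed.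

Lemma Csum_seq_psum f n : Csum (map f (seq 0 n)) = psum f n.
Proof.
  induction n; auto. rewrite seq_S, map_app, Csum_app, IHn. simpl. ring.
Qed.

Lemma bhat_rec m x : bhat m x =
  x ^ m / RtoC (INR (fact m)) - psum (fun k => bhat k x / RtoC (INR (fact (S m - k)))) m.
Proof.
  unfold bhat at 1. unfold bernoulli_poly. cbn [bernoulli_polys].
  rewrite app_nth2 by (rewrite length_bernoulli_polys; lia).
  rewrite length_bernoulli_polys, Nat.sub_diag. cbn [nth].
  rewrite Csum_seq_psum.
  rewrite (psum_ext _ (fun k => RtoC (INR (fact (S m))) * (bhat k x / RtoC (INR (fact (S m - k)))))).
  2: { intros k hk. rewrite nth_bernoulli_polys by auto. unfold Binomial.C, bhat.
       unfold Rdiv. rewrite RtoC_mult, RtoC_inv, RtoC_mult.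
       - field. split; apply INR_fact_neq.
       - apply Rmult_integral_contrapositive; split; apply INR_fact_neq_0. }
  rewrite psum_scal.
  assert (hm : RtoC (INR (S m)) <> 0) by (intros e; apply RtoC_inj in e; revert e; apply not_0_INR; lia).
  replace (RtoC (INR (fact (S m)))) with (RtoC (INR (S m)) * RtoC (INR (fact m)))
    by (rewrite <- RtoC_mult, <- mult_INR; reflexivity).
  assert (hf := INR_fact_neq m).
  set (P := psum _ m). set (M := INR (S m)) in *. field. auto.
Qed.

Lemma derC_psum (f : nat -> R -> C) (df : nat -> C) s n : (forall k, (k < n)%nat -> derC (f k) s (df k)) ->
  derC (fun t => psum (fun k => f k t) n) s (psum df n).
Proof. induction n; intros h; simpl; [apply derC_const|apply derC_plus; auto]. Qed.

Lemma derC_pow (x : R -> C) s v n : derC x s v -> derC (fun t => x t ^ n) s (RtoC (INR n) * x s ^ (n - 1) * v).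
Proof.
  intros h. induction n.
  - simpl. eapply derC_eq; [apply derC_const|ring].
  - rewrite S_INR, RtoC_plus. simpl. eapply derC_eq; [apply derC_mult; eauto|].
    cbv beta. destruct n; [simpl; ring|]. simpl. rewrite Nat.sub_0_r. ring.
Qed.

Lemma bhat_0 x : bhat 0 x = 1.
Proof. rewrite bhat_rec. simpl. field. Qed.

Lemma bhat_derC (x : R -> C) s v n : derC x s v ->
  derC (fun t => bhat n (x t)) s (match n with O => 0 | S m => v * bhat m (x s) end).
Proof.
  intros h. induction n as [n IH] using lt_wf_ind.
  assert (e : (fun t => bhat n (x t)) = (fun t => x t ^ n / RtoC (INR (fact n)) - psum (fun k => bhat k (x t) / RtoC (INR (fact (S n - k)))) n)).
  { apply functional_extensionality; intros; apply bhat_rec. }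
  rewrite e.
  eapply derC_eq.
  { apply derC_minus.
    - apply (derC_mult (fun t => x t ^ n) (fun _ => / RtoC (INR (fact n)))); [apply derC_pow, h|apply derC_const].
    - apply (derC_psum (fun k t => bhat k (x t) / RtoC (INR (fact (S n - k)))) (fun k => match k with O => 0 | S m => v * bhat m (x s) end / RtoC (INR (fact (S n - k))))).
      intros k hk. eapply derC_eq.
      + apply (derC_mult (fun t => bhat k (x t)) (fun _ => / RtoC (INR (fact (S n - k))))); [apply IH, hk|apply derC_const].
      + unfold Cdiv. ring. }
  destruct n as [|n]; [simpl; ring|].
  rewrite psum_S_l. rewrite (psum_ext (fun k => v * bhat k (x s) / RtoC (INR (fact (S (S n) - S k))))
    (fun k => v * (bhat k (x s) / RtoC (INR (fact (S n - k)))))) by (intros; unfold Cdiv; simpl; ring).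
  rewrite psum_scal, (bhat_rec n (x s)).
  replace (S n - 1)%nat with n by lia.
  replace (RtoC (INR (fact (S n)))) with (RtoC (INR (S n)) * RtoC (INR (fact n)))
    by (rewrite <- RtoC_mult, <- mult_INR; reflexivity).
  assert (hm : RtoC (INR (S n)) <> 0) by (intros e'; apply RtoC_inj in e'; revert e'; apply not_0_INR; lia).
  assert (hf := INR_fact_neq n). assert (hf' := INR_fact_neq (S (S n) - 0)).
  set (P := psum _ n). set (M := INR (S n)) in *. field. auto.
Qed.

Lemma bhat_1_1 : bhat 1 1 - bhat 1 0 = 1.
Proof.
  rewrite !(bhat_rec 1). simpl. rewrite !bhat_0.
  assert (RtoC 1 <> 0) by (intros e; apply RtoC_inj in e; lra).
  assert (RtoC (1 + 1) <> 0) by (intros e; apply RtoC_inj in e; lra).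
  field. auto.
Qed.

Lemma bhat_periodic n : bhat (S (S n)) 1 = bhat (S (S n)) 0.
Proof.
  induction n as [n IH] using lt_wf_ind.
  rewrite !(bhat_rec (S (S n))). rewrite !(psum_S_l _ (S n)), !(psum_S_l _ n), !bhat_0.
  rewrite (psum_ext (fun k => bhat (S (S k)) 1 / RtoC (INR (fact (S (S (S n)) - S (S k)))))
    (fun k => bhat (S (S k)) 0 / RtoC (INR (fact (S (S (S n)) - S (S k)))))).
  2: { intros k hk. now rewrite IH. }
  rewrite Cpow_1_l.
  replace (bhat 1 1) with ((bhat 1 1 - bhat 1 0) + bhat 1 0) by ring.
  rewrite bhat_1_1.
  replace (S (S (S n)) - 1)%nat with (S (S n)) by lia.
  replace (RtoC 0 ^ S (S n)) with (RtoC 0) by (simpl; ring).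
  set (P := psum _ _).
  unfold Cdiv. ring.
Qed.

Lemma bhat_double n x : 2 * bhat n (RtoC (2 * x)) = 2 ^ n * (bhat n (RtoC x) + bhat n (RtoC (x + 1 / 2))).
Proof.
  set (E := fun n x => 2 * bhat n (RtoC (2 * x)) - 2 ^ n * (bhat n (RtoC x) + bhat n (RtoC (x + 1 / 2)))).
  assert (hder : forall n x, derC (E n) x (match n with O => 0 | S m => 2 * E m x end)).
  { intros m y. unfold E.
    eapply derC_eq.
    - apply derC_minus; apply derC_scal.
      + apply (bhat_derC (fun t => RtoC (2 * t)) y (RtoC 2)). apply (derC_RtoC (fun t => 2 * t)%R). auto_derive; auto. ring.
      + apply derC_plus.
        * apply (bhat_derC RtoC y (RtoC 1)). apply (derC_RtoC (fun t => t)). auto_derive; auto.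
        * apply (bhat_derC (fun t => RtoC (t + 1 / 2)) y (RtoC 1)).
          apply (derC_RtoC (fun t => t + 1 / 2)%R). auto_derive; auto.
    - destruct m; simpl; ring. }
  enough (H : forall n x, E n x = 0).
  { specialize (H n x). unfold E in H.
    replace (2 * bhat n (RtoC (2 * x))) with (2 * bhat n (RtoC (2 * x)) - 2 ^ n * (bhat n (RtoC x) + bhat n (RtoC (x + 1 / 2)))
      + 2 ^ n * (bhat n (RtoC x) + bhat n (RtoC (x + 1 / 2)))) by ring. rewrite H. ring. }
  clear n x. induction n as [|n IH].
  - intros x. unfold E. rewrite !bhat_0. simpl. ring.
  - assert (hconst : forall y, E (S n) y = E (S n) 0%R).
    { intros y. apply derC_zero_const. intros s _. eapply derC_eq; [apply hder|]. rewrite IH. ring. }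
    set (k := E (S n) 0%R) in *.
    assert (h1 : E (S (S n)) (1 / 2)%R - 2 * RtoC (1 / 2) * k = E (S (S n)) 0%R - 2 * RtoC 0 * k).
    { apply (derC_zero_const (fun t => E (S (S n)) t - 2 * RtoC t * k)). intros s _.
      eapply derC_eq.
      - apply derC_minus; [apply hder|].
        apply (derC_mult (fun t => 2 * RtoC t) (fun _ => k)); [|apply derC_const].
        apply derC_scal. apply (derC_RtoC (fun t => t)). auto_derive; auto.
      - cbv beta. rewrite hconst. ring. }
    assert (h2 : E (S (S n)) (1 / 2)%R = E (S (S n)) 0%R).
    { unfold E. replace (2 * (1 / 2))%R with 1%R by field. replace (1 / 2 + 1 / 2)%R with 1%R by field.
      rewrite Rmult_0_r, Rplus_0_l, bhat_periodic. ring. }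
    rewrite h2 in h1. intros y. rewrite hconst.
    replace (2 * RtoC (1 / 2)) with (RtoC 1) in h1.
    2: { rewrite <- RtoC_mult. f_equal. field. }
    replace k with ((E (S (S n)) 0%R - 2 * RtoC 0 * k) - (E (S (S n)) 0%R - 1 * k)) by ring.
    rewrite h1. ring.
Qed.

Definition beta_log (n : nat) (zeta : C) : C := two_pi_i ^ n * bhat n (zeta / two_pi_i).

Lemma two_pi_i_neq : two_pi_i <> 0.
Proof.
  unfold two_pi_i. apply Cmult_neq_0; [|apply Ci_nz].
  intros e. apply RtoC_inj in e. pose proof PI_RGT_0. lra.
Qed.

Lemma beta_beta_log n z : beta n z = beta_log n (Clog (- z) + RtoC PI * Ci).
Proof.
  unfold beta, beta_log, bhat.
  replace ((Clog (- z) + RtoC PI * Ci) / two_pi_i) with (/ 2 + Clog (- z) / two_pi_i).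
  - unfold Cdiv. ring.
  - pose proof two_pi_i_neq as h. unfold two_pi_i in *. rewrite RtoC_mult in *.
    assert (RtoC PI <> 0) by (intros e; apply h; rewrite e; ring).
    assert (RtoC 2 <> 0) by (intros e; apply RtoC_inj in e; lra).
    field. repeat split; auto. apply Ci_nz.
Qed.

Lemma beta_log_derC (x : R -> C) s v n : derC x s v ->
  derC (fun t => beta_log n (x t)) s (match n with O => 0 | S m => v * beta_log m (x s) end).
Proof.
  intros h. unfold beta_log. eapply derC_eq.
  - apply derC_scal. apply (bhat_derC (fun t => x t / two_pi_i) s (v / two_pi_i)).
    eapply derC_eq; [apply (derC_mult x (fun _ => / two_pi_i)); [exact h|apply derC_const]|].
    unfold Cdiv. ring.
  - destruct n; [ring|]. simpl. field. apply two_pi_i_neq.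
Qed.

Lemma beta_log_0 z : beta_log 0 z = 1.
Proof. unfold beta_log. rewrite bhat_0. simpl. ring. Qed.

Lemma Clog_scale (w : C) s : w <> 0 -> Clog (w * RtoC (exp (- s))) = Clog w - RtoC s.
Proof.
  intros hw. assert (hm : (0 < Cmod w)%R) by (apply Cmod_gt_0; exact hw).
  assert (he := exp_pos (- s)).
  assert (e1 : Cmod (w * RtoC (exp (- s))) = (Cmod w * exp (- s))%R).
  { rewrite Cmod_mult, Cmod_R, Rabs_pos_eq; auto; lra. }
  assert (eR : Re (w * RtoC (exp (- s))) = (Re w * exp (- s))%R) by (unfold Re, Im; simpl; ring).
  assert (eI : Im (w * RtoC (exp (- s))) = (Im w * exp (- s))%R) by (unfold Re, Im; simpl; ring).
  unfold Clog, Carg. rewrite e1, eR, eI, ln_mult, ln_exp by auto.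
  replace (Re w * exp (- s) / (Cmod w * exp (- s)))%R with (Re w / Cmod w)%R by (field; lra).
  apply C_eq; simpl; [lra|].
  destruct (Rle_dec 0 (Im w * exp (- s))), (Rle_dec 0 (Im w)); try lra; exfalso.
  - apply n. apply Rmult_le_reg_r with (exp (- s)); lra.
  - apply n. apply Rmult_le_pos; lra.
Qed.

Lemma beta_scale n (Y : C) s : Y <> 0 -> beta n (Y * RtoC (exp (- s))) = beta_log n (Clog (- Y) + RtoC PI * Ci - RtoC s).
Proof.
  intros h. rewrite beta_beta_log. f_equal.
  replace (- (Y * RtoC (exp (- s)))) with (- Y * RtoC (exp (- s))) by ring.
  rewrite Clog_scale; [ring|]. intros e. apply h. replace Y with (- - Y) by ring. rewrite e. ring.
Qed.

Lemma beta_derC n (Y : C) s : Y <> 0 -> derC (fun t => beta n (Y * RtoC (exp (- t)))) s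
  (match n with O => 0 | S m => - beta m (Y * RtoC (exp (- s))) end).
Proof.
  intros h. replace (fun t => beta n (Y * RtoC (exp (- t)))) with (fun t => beta_log n (Clog (- Y) + RtoC PI * Ci - RtoC t))
    by (apply functional_extensionality; intros; now rewrite beta_scale).
  eapply derC_eq.
  - apply (beta_log_derC (fun t => Clog (- Y) + RtoC PI * Ci - RtoC t) s (0 - RtoC 1)).
    apply derC_minus; [apply derC_const|]. apply (derC_RtoC (fun t => t)). auto_derive; auto.
  - destruct n; auto. rewrite beta_scale by auto. ring.
Qed.

(** * Jonquiere's inversion formula *)

Definition global_le (A : R) (h : R -> C) : Prop :=
  forall u, (Cmod (h u) <= A * exp (- (1 / 2) * u))%R.
Definition global_decay (h : R -> C) : Prop := contC h /\ exists A, global_le A h.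

Lemma global_decay_decaying h : global_decay h -> decaying h.
Proof. intros [hc [A hA]]. split; auto. exists A, (1 / 2)%R. split; [lra|]. intros; apply hA. Qed.

Lemma global_le_nonneg A h : global_le A h -> (0 <= A)%R.
Proof.
  intros H. specialize (H 0%R). rewrite Rmult_0_r, exp_0 in H. pose proof (Cmod_ge_0 (h 0%R)). lra.
Qed.

Lemma global_le_shift A h a : global_le A h -> global_le (A * exp (- (1 / 2) * a)) (fun s => h (s + a)%R).
Proof.
  intros H u. eapply Rle_trans; [apply H|]. right. rewrite Rmult_assoc, <- exp_plus. do 2 f_equal. ring.
Qed.

Lemma continuous_shift a s : continuous (fun s => (s + a)%R) s.
Proof. apply (ex_derive_continuous (fun s => (s + a)%R)). auto_derive; auto. Qed.

Lemma global_decay_shift h a : global_decay h -> global_decay (fun s => h (s + a)%R).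
Proof.
  intros [hc [A hA]]. split.
  - apply (contC_comp h); auto. intros; apply continuous_shift.
  - eexists. apply global_le_shift, hA.
Qed.

Lemma tail_shift h a : global_decay h -> tail (fun s => h (s + a)%R) = fun s => tail h (s + a)%R.
Proof.
  intros hG. set (I := tail (fun s => h (s + a)%R)).
  assert (hG' := global_decay_shift h a hG).
  apply functional_extensionality. intros s.
  assert (hcst : forall x y, I x - tail h (x + a)%R = I y - tail h (y + a)%R).
  { intros x y. apply (derC_zero_const (fun s => I s - tail h (s + a)%R)). intros t _.
    eapply derC_eq; [apply derC_minus; [apply tail_derC; now apply global_decay_decaying|]|].
    - apply derC_shift. apply tail_derC. now apply global_decay_decaying.
    - cbv beta. ring. }
  assert (hd1 := decaying_exp_decay _ (tail_decaying _ (global_decay_decaying _ hG'))). fold I in hd1.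
  destruct hd1 as [A1' [c1 [c1p H1]]].
  destruct (decaying_exp_decay _ (tail_decaying _ (global_decay_decaying _ hG))) as [A2' [c2 [c2p H2]]].
  assert (hz : (Cmod (I s - tail h (s + a)%R) <= 0)%R).
  { set (c := Rmin c1 c2). assert (hc : (0 < c)%R) by now apply Rmin_glb_lt.
    apply (exp_decay_zero (Rabs A1' + Rabs A2' * exp (- c2 * a)) c _ (Rmax 0 (- a)) hc).
    intros t ht. assert (0 <= t)%R by (eapply Rle_trans; [apply Rmax_l|exact ht]).
    assert (- a <= t)%R by (eapply Rle_trans; [apply Rmax_r|exact ht]).
    rewrite (hcst s t). eapply Rle_trans; [apply Cmod_triangle|]. rewrite Cmod_opp.
    rewrite Rmult_plus_distr_r. apply Rplus_le_compat.
    - eapply Rle_trans; [apply H1; auto|]. eapply Rle_trans.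
      + apply Rmult_le_compat_r; [left; apply exp_pos|apply Rle_abs].
      + apply Rmult_le_compat_l; [apply Rabs_pos|]. apply exp_le.
        assert (c <= c1)%R by apply Rmin_l. nra.
    - eapply Rle_trans; [apply H2; lra|]. eapply Rle_trans.
      + apply Rmult_le_compat_r; [left; apply exp_pos|apply Rle_abs].
      + rewrite Rmult_assoc, <- exp_plus. apply Rmult_le_compat_l; [apply Rabs_pos|]. apply exp_le.
        assert (c <= c2)%R by apply Rmin_r. nra. }
  assert (e : I s - tail h (s + a)%R = 0).
  { apply Cmod_eq_0. pose proof (Cmod_ge_0 (I s - tail h (s + a)%R)). lra. }
  replace (I s) with (I s - tail h (s + a)%R + tail h (s + a)%R) by ring. rewrite e; ring.
Qed.

Lemma global_le_tail A h : contC h -> global_le A h -> global_le (4 * A) (tail h).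
Proof.
  intros hc hA u. assert (hG : global_decay h) by (split; eauto).
  replace (tail h u) with (tail (fun s => h (s + u)%R) 0%R).
  2: { rewrite tail_shift by auto. f_equal. ring. }
  eapply Rle_trans.
  { apply (tail_bound _ (A * exp (- (1 / 2) * u)) (1 / 2)); [|lra| |lra].
    - apply global_decay_shift, hG.
    - intros s hs. apply global_le_shift, hA. }
  rewrite Rmult_0_r, exp_0. right. field.
Qed.

Lemma global_decay_tail h : global_decay h -> global_decay (tail h).
Proof.
  intros hG. split; [apply (tail_decaying h (global_decay_decaying h hG))|]. destruct hG as [hc [A hA]].
  exists (4 * A)%R. now apply global_le_tail.
Qed.

Lemma tail_iter_global_decay n h : global_decay h -> global_decay (tail_iter n h).
Proof. intros hG; induction n; simpl; auto. now apply global_decay_tail. Qed.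

Lemma tail_iter_shift n h a : global_decay h -> tail_iter n (fun s => h (s + a)%R) = fun s => tail_iter n h (s + a)%R.
Proof.
  intros hG; induction n; simpl; auto. unfold tail_iter in *; simpl. rewrite IHn.
  apply (tail_shift (Nat.iter n tail h)). now apply (tail_iter_global_decay n).
Qed.

Definition Lis (n : nat) (Y : C) : R -> C := tail_iter n (geom Y).

Lemma geom_nz Y s : pole_free Y -> 1 - Y * RtoC (exp (- s)) <> 0.
Proof.
  intros h e. apply (h (exp (- s)) (Rlt_le _ _ (exp_pos _))).
  replace (Y * RtoC (exp (- s))) with (1 - (1 - Y * RtoC (exp (- s)))) by ring. rewrite e; ring.
Qed.

Lemma geom_global Y : pole_free Y -> exists K, (0 <= K)%R /\
  global_le K (geom Y) /\ global_le K (fun s => geom Y s * (1 + geom Y s)).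
Proof.
  intros h. destruct (pole_free_lower_bound Y h) as [dl [hd hb]].
  set (D := (/ dl)%R). assert (hD : (0 < D)%R) by now apply Rinv_0_lt_compat.
  set (K := (Cmod Y * D + 1 + D)%R).
  assert (hY := Cmod_ge_0 Y).
  assert (hYD : (0 <= Cmod Y * D)%R) by (apply Rmult_le_pos; lra).
  assert (hK : (0 <= K)%R) by (unfold K; lra).
  assert (hinv : forall s, (Cmod (/ (1 - Y * RtoC (exp (- s)))) <= D)%R).
  { intros s. rewrite Cmod_inv by now apply geom_nz. apply Rinv_le_contravar; auto.
    apply hb. left; apply exp_pos. }
  assert (h1f : forall s, 1 + geom Y s = / (1 - Y * RtoC (exp (- s)))).
  { intros s. unfold geom, frac. field. now apply geom_nz. }
  assert (hf : global_le K (geom Y)).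
  { intros u. destruct (Rle_dec 0 u) as [hu|hu].
    - unfold geom, frac, Cdiv. rewrite !Cmod_mult, Cmod_R, Rabs_pos_eq by (left; apply exp_pos).
      assert (exp (- u) <= exp (- (1 / 2) * u))%R by (apply exp_le; lra).
      pose proof (exp_pos (- u)). pose proof (exp_pos (- (1 / 2) * u)).
      apply Rle_trans with (Cmod Y * exp (- (1 / 2) * u) * D)%R.
      + apply Rmult_le_compat; auto using Cmod_ge_0.
        * apply Rmult_le_pos; lra.
        * apply Rmult_le_compat_l; auto.
      + unfold K. nra.
    - replace (geom Y u) with ((1 + geom Y u) + - (1)) by ring. rewrite h1f.
      eapply Rle_trans; [apply Cmod_triangle|]. rewrite Cmod_opp, Cmod_1.
      assert (hx := exp_le 0 (- (1 / 2) * u) ltac:(lra)). rewrite exp_0 in hx.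
      specialize (hinv u). unfold K. nra. }
  exists (K + K * D)%R. split; [nra|split].
  - intros u. eapply Rle_trans; [apply hf|]. apply Rmult_le_compat_r; [left; apply exp_pos|nra].
  - intros u. rewrite Cmod_mult, h1f.
    apply Rle_trans with (K * exp (- (1 / 2) * u) * D)%R.
    + apply Rmult_le_compat; auto using Cmod_ge_0.
    + pose proof (exp_pos (- (1 / 2) * u)). nra.
Qed.

Lemma geom_global_decay Y : pole_free Y -> global_decay (geom Y).
Proof. intros h. split; [apply (kernel_geom Y h)|]. destruct (geom_global Y h) as [K [_ [H _]]]; eauto. Qed.

Lemma Lis_global_decay n Y : pole_free Y -> global_decay (Lis n Y).
Proof. intros; now apply tail_iter_global_decay, geom_global_decay. Qed.

Lemma Lis_derC n Y s : pole_free Y -> derC (Lis (S n) Y) s (- Lis n Y s).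
Proof. intros h. apply (tail_derC (Lis n Y)). now apply global_decay_decaying, Lis_global_decay. Qed.

Lemma derC_inv (f : R -> C) s a : derC f s a -> (forall t, f t <> 0) ->
  derC (fun t => / f t) s (- (a / (f s * f s))).
Proof.
  intros [h1 h2] hall.
  assert (hn : forall t, (Re (f t) ^ 2 + Im (f t) ^ 2 <> 0)%R).
  { intros t e. apply (hall t). apply C_eq; simpl; nra. }
  split.
  - apply (is_derive_ext (fun t => Re (f t) / (Re (f t) ^ 2 + Im (f t) ^ 2))%R); [reflexivity|].
    evar_last.
    + apply is_derive_div; [exact h1| |apply hn].
      apply (is_derive_plus (V := R_NormedModule)); apply is_derive_pow; eassumption.
    + unfold plus; simpl. assert (hns := hn s). unfold Cdiv, Cinv.
      destruct (f s) as [p q], a as [u v]. simpl in *. field.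
      split; intros e'; apply hns; nra.
  - apply (is_derive_ext (fun t => - Im (f t) / (Re (f t) ^ 2 + Im (f t) ^ 2))%R); [reflexivity|].
    evar_last.
    + apply is_derive_div; [apply (is_derive_opp (V := R_NormedModule)), h2| |apply hn].
      apply (is_derive_plus (V := R_NormedModule)); apply is_derive_pow; eassumption.
    + unfold plus, opp; simpl. assert (hns := hn s). unfold Cdiv, Cinv.
      destruct (f s) as [p q], a as [u v]. simpl in *. field.
      split; intros e'; apply hns; nra.
Qed.

Lemma geom_derC Y s : pole_free Y -> derC (geom Y) s (- (geom Y s * (1 + geom Y s))).
Proof.
  intros h. unfold geom, frac, Cdiv.
  assert (he : derC (fun s => Y * RtoC (exp (- s))) s (- (Y * RtoC (exp (- s))))).
  { eapply derC_eq; [apply derC_scal, (derC_RtoC (fun s => exp (- s)) s (- exp (- s))%R)|].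
    - auto_derive; auto. ring.
    - apply C_eq; simpl; ring. }
  eapply derC_eq.
  - apply derC_mult; [exact he|].
    apply derC_inv.
    + apply derC_minus; [apply derC_const|exact he].
    + intros t. now apply geom_nz.
  - cbv beta. field. now apply geom_nz.
Qed.

Lemma second_order_R (p q r : R -> R) (u B : R) :
  (forall v, is_derive p v (q v)) -> (forall v, is_derive q v (r v)) ->
  (forall v, (Rabs (v - u) <= 1)%R -> (Rabs (r v) <= B)%R) ->
  forall d, (Rabs d <= 1)%R -> (Rabs (p (u + d) - p u - d * q u) <= B * d ^ 2)%R.
Proof.
  intros hp hq hr d hd.
  assert (cont : forall (f g : R -> R), (forall v, is_derive f v (g v)) -> forall x, continuity_pt f x).
  { intros f g hf x. apply continuity_pt_filterlim.
    apply (ex_derive_continuous (K := R_AbsRing) (V := R_NormedModule)). eexists; apply hf. }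
  destruct (MVT_gen p u (u + d) q) as [c [hc ec]].
  { intros; apply hp. } { intros; eapply cont; eauto. }
  destruct (MVT_gen q u c r) as [c' [hc' ec']].
  { intros; apply hq. } { intros; eapply cont; eauto. }
  rewrite ec. replace (q c * (u + d - u) - d * q u)%R with (d * (q c - q u))%R by ring.
  rewrite ec', !Rabs_mult.
  assert (hcu : (Rabs (c - u) <= Rabs d)%R).
  { revert hc. unfold Rmin, Rmax, Rabs. destruct (Rle_dec u (u + d)), (Rcase_abs (c - u)), (Rcase_abs d); lra. }
  assert (hcu' : (Rabs (c' - u) <= Rabs (c - u))%R).
  { revert hc'. unfold Rmin, Rmax, Rabs. destruct (Rle_dec u c), (Rcase_abs (c' - u)), (Rcase_abs (c - u)); lra. }
  assert (hrc := hr c' ltac:(lra)).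
  rewrite <- (pow2_abs d). pose proof (Rabs_pos d). pose proof (Rabs_pos (c - u)). pose proof (Rabs_pos (r c')).
  apply Rle_trans with (Rabs d * (B * Rabs d))%R; [|right; ring].
  apply Rmult_le_compat_l; auto. apply Rmult_le_compat; auto.
Qed.

Lemma second_order_C (p q r : R -> C) (u B : R) :
  (forall v, derC p v (q v)) -> (forall v, derC q v (r v)) ->
  (forall v, (Rabs (v - u) <= 1)%R -> (Cmod (r v) <= B)%R) ->
  forall d, (Rabs d <= 1)%R -> (Cmod (p (u + d)%R - p u - RtoC d * q u) <= 2 * B * d ^ 2)%R.
Proof.
  intros hp hq hr d hd.
  assert (h1 := second_order_R (fun t => Re (p t)) (fun t => Re (q t)) (fun t => Re (r t)) u B
    (fun v => proj1 (hp v)) (fun v => proj1 (hq v)) (fun v hv => Rle_trans _ _ _ (Re_le_Cmod _) (hr v hv)) d hd).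
  assert (h2 := second_order_R (fun t => Im (p t)) (fun t => Im (q t)) (fun t => Im (r t)) u B
    (fun v => proj2 (hp v)) (fun v => proj2 (hq v)) (fun v hv => Rle_trans _ _ _ (Im_le_Cmod _) (hr v hv)) d hd).
  eapply Rle_trans; [apply Cmod_le_Re_Im|].
  replace (Re (p (u + d)%R - p u - RtoC d * q u)) with (Re (p (u + d)) - Re (p u) - d * Re (q u))%R by (unfold Re; simpl; ring).
  replace (Im (p (u + d)%R - p u - RtoC d * q u)) with (Im (p (u + d)) - Im (p u) - d * Im (q u))%R by (unfold Im; simpl; ring).
  lra.
Qed.

Lemma Lis_second_order n Y : pole_free Y -> exists B, (0 <= B)%R /\ forall u d, (Rabs d <= 1)%R ->
  (Cmod (Lis (S n) Y (u + d)%R - Lis (S n) Y u + RtoC d * Lis n Y u) <= B * d ^ 2 * exp (- (1 / 2) * u))%R.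
Proof.
  intros h.
  assert (H : exists m, (exists K, global_le K m) /\ forall v, derC (Lis n Y) v (- m v)).
  { destruct n.
    - exists (fun s => geom Y s * (1 + geom Y s)). destruct (geom_global Y h) as [K [_ [_ HK]]].
      split; eauto. intros v. now apply geom_derC.
    - exists (Lis n Y). split; [apply (Lis_global_decay n Y h)|]. intros v. now apply Lis_derC. }
  destruct H as [m [[K HK] Hm]].
  assert (hK := global_le_nonneg _ _ HK).
  exists (2 * (K * exp (1 / 2)))%R. split; [pose proof (exp_pos (1 / 2)); nra|].
  intros u d hd.
  assert (T := second_order_C (Lis (S n) Y) (fun v => - Lis n Y v) m u (K * exp (1 / 2) * exp (- (1 / 2) * u))
    (fun v => Lis_derC n Y v h)).
  replace (Lis (S n) Y (u + d)%R - Lis (S n) Y u + RtoC d * Lis n Y u)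
    with (Lis (S n) Y (u + d)%R - Lis (S n) Y u - RtoC d * - Lis n Y u) by ring.
  eapply Rle_trans; [apply T; auto|right; ring].
  - intros v. eapply derC_eq; [apply derC_opp, Hm|ring].
  - intros v hv. eapply Rle_trans; [apply HK|].
    rewrite Rmult_assoc, <- exp_plus. apply Rmult_le_compat_l; auto. apply exp_le.
    revert hv. unfold Rabs. destruct (Rcase_abs (v - u)); lra.
Qed.

Lemma geom_shift Y a s : geom Y (s + a)%R = geom (Y * RtoC (exp (- a))) s.
Proof.
  unfold geom. f_equal. rewrite <- Cmult_assoc, <- RtoC_mult, <- exp_plus. do 3 f_equal. ring.
Qed.

Lemma Lis_shift n Y a s : pole_free Y -> Lis n Y (s + a)%R = Lis n (Y * RtoC (exp (- a))) s.
Proof.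
  intros h. unfold Lis.
  replace (geom (Y * RtoC (exp (- a)))) with (fun s => geom Y (s + a)%R)
    by (apply functional_extensionality; intros; apply geom_shift).
  now rewrite (tail_iter_shift n (geom Y) a) by now apply geom_global_decay.
Qed.

Lemma quadratic_derC_loc (G : R -> C) (s : R) (a : C) (B r : R) : (0 < r)%R ->
  (forall d, (Rabs d <= r)%R -> (Cmod (G (s + d)%R - G s - RtoC d * a) <= B * d ^ 2)%R) ->
  derC G s a.
Proof.
  intros hr h.
  assert (H : derC (fun u => G (s + r * (u - s))%R) s (RtoC r * a)).
  { apply quadratic_derC with (B * r ^ 2)%R. intros d hd.
    replace (s + r * (s + d - s))%R with (s + r * d)%R by ring.
    replace (s + r * (s - s))%R with s by ring.
    replace (RtoC d * (RtoC r * a)) with (RtoC (r * d) * a) by (rewrite RtoC_mult; ring).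
    eapply Rle_trans; [apply h|right; ring].
    rewrite Rabs_mult, (Rabs_pos_eq r) by lra. nra. }
  assert (e : G = fun u => (fun v => G (s + r * (v - s))%R) (s + (u - s) / r)%R).
  { apply functional_extensionality; intros u. f_equal. field. lra. }
  rewrite e. eapply derC_eq.
  - apply (derC_comp (fun v => G (s + r * (v - s))%R) (fun u => (s + (u - s) / r)%R) s (RtoC r * a) (/ r)%R).
    + replace (s + (s - s) / r)%R with s by (field; lra). exact H.
    + auto_derive; auto. field. lra.
  - rewrite Cmult_assoc, <- RtoC_mult, Rinv_l, Cmult_1_l by lra. reflexivity.
Qed.

Lemma second_order_compose (G : C -> C) (a : C) (B d : R) (gam : R -> C) (v : C) (B' : R) :
  (0 < d)%R -> (0 <= B)%R ->
  (forall t, (Cmod (t - 1) <= d)%R -> (Cmod (G t - G 1 - (t - 1) * a) <= B * Cmod (t - 1) ^ 2)%R) ->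
  (0 <= B')%R ->
  (forall e, (Rabs e <= 1)%R -> (Cmod (gam e - 1 - RtoC e * v) <= B' * e ^ 2)%R) -> gam 0%R = 1 ->
  derC (fun e => G (gam e)) 0 (v * a).
Proof.
  intros hd hB hG hB' hg g0.
  set (K := (Cmod v + B')%R). assert (hK : (0 <= K)%R) by (unfold K; pose proof (Cmod_ge_0 v); lra).
  assert (hlin : forall e, (Rabs e <= 1)%R -> (Cmod (gam e - 1) <= K * Rabs e)%R).
  { intros e he. replace (gam e - 1) with (gam e - 1 - RtoC e * v + RtoC e * v) by ring.
    eapply Rle_trans; [apply Cmod_triangle|]. rewrite Cmod_mult, Cmod_R.
    specialize (hg e he). rewrite <- (pow2_abs e) in hg. pose proof (Rabs_pos e). unfold K.
    assert (B' * Rabs e ^ 2 <= B' * Rabs e)%R by (apply Rmult_le_compat_l; auto; nra). nra. }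
  set (r := Rmin 1 (d / (1 + K))).
  assert (hr : (0 < r)%R) by (apply Rmin_glb_lt; [lra|apply Rdiv_lt_0_compat; lra]).
  apply quadratic_derC_loc with (B * K ^ 2 + B' * Cmod a)%R r; auto.
  intros e he. rewrite Rplus_0_l, g0.
  assert (he1 : (Rabs e <= 1)%R) by (eapply Rle_trans; [exact he|apply Rmin_l]).
  assert (he2 : (Rabs e <= d / (1 + K))%R) by (eapply Rle_trans; [exact he|apply Rmin_r]).
  assert (hl := hlin e he1).
  assert (hpos := Rabs_pos e).
  assert (hgd : (Cmod (gam e - 1) <= d)%R).
  { apply (Rmult_le_compat_l (1 + K)) in he2; [|lra].
    replace ((1 + K) * (d / (1 + K)))%R with d in he2 by (field; lra). nra. }
  specialize (hG _ hgd). specialize (hg e he1).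
  replace (G (gam e) - G 1 - RtoC e * (v * a))
    with ((G (gam e) - G 1 - (gam e - 1) * a) + (gam e - 1 - RtoC e * v) * a) by ring.
  eapply Rle_trans; [apply Cmod_triangle|]. rewrite Cmod_mult.
  pose proof (Cmod_ge_0 (gam e - 1)). pose proof (Cmod_ge_0 a).
  assert (h1 : (Cmod (gam e - 1) ^ 2 <= (K * Rabs e) ^ 2)%R) by (apply pow_incr; lra).
  rewrite Rpow_mult_distr, pow2_abs in h1.
  assert (B * Cmod (gam e - 1) ^ 2 <= B * (K ^ 2 * e ^ 2))%R by now apply Rmult_le_compat_l.
  assert (Cmod (gam e - 1 - RtoC e * v) * Cmod a <= B' * e ^ 2 * Cmod a)%R by now apply Rmult_le_compat_r.
  lra.
Qed.

Definition cis (x : R) : C := (cos x, sin x).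
Lemma cis_plus x y : cis (x + y) = cis x * cis y.
Proof. unfold cis. rewrite cos_plus, sin_plus. apply C_eq; simpl; ring. Qed.

Lemma cis_0 : cis 0 = 1.
Proof. unfold cis. rewrite cos_0, sin_0. reflexivity. Qed.

Lemma cis_Cmod x : Cmod (cis x) = 1%R.
Proof.
  unfold Cmod, cis. simpl fst; simpl snd. rewrite <- sqrt_1. f_equal.
  pose proof (sin2_cos2 x) as h. unfold Rsqr in h. lra.
Qed.

Lemma cis_derC x : derC cis x (Ci * cis x).
Proof.
  split; simpl.
  - auto_derive; auto. unfold Im, Re; simpl. ring.
  - auto_derive; auto. unfold Im, Re; simpl. ring.
Qed.

Lemma exp_second_order e : (Rabs e <= 1)%R -> (Cmod (RtoC (exp (- e)) - 1 - RtoC e * - (1)) <= 2 * exp 1 * e ^ 2)%R.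
Proof.
  intros he.
  assert (hd : forall v, derC (fun t => RtoC (exp (- t))) v (- RtoC (exp (- v)))).
  { intros v. eapply derC_eq; [apply (derC_RtoC (fun t => exp (- t)) v (- exp (- v))%R)|].
    - auto_derive; auto. ring.
    - apply C_eq; simpl; ring. }
  assert (T := second_order_C (fun t => RtoC (exp (- t))) (fun t => - RtoC (exp (- t))) (fun t => RtoC (exp (- t))) 0 (exp 1) hd).
  specialize (T ltac:(intros v; eapply derC_eq; [apply derC_opp, hd|ring])).
  assert (T' := T ltac:(intros v hv; cbv beta; rewrite Cmod_R, Rabs_pos_eq by (left; apply exp_pos); apply exp_le; revert hv; unfold Rabs; destruct (Rcase_abs (v - 0)); lra) e he).
  cbv beta in T'. rewrite Rplus_0_l, Ropp_0, exp_0 in T'. exact T'.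
Qed.

Lemma cis_second_order e : (Rabs e <= 1)%R -> (Cmod (cis e - 1 - RtoC e * Ci) <= 2 * 1 * e ^ 2)%R.
Proof.
  intros he.
  assert (T := second_order_C cis (fun t => Ci * cis t) (fun t => Ci * (Ci * cis t)) 0 1 cis_derC
    (fun v => derC_scal Ci cis v _ (cis_derC v))).
  assert (T' := T ltac:(intros v hv; cbv beta; rewrite !Cmod_mult, cis_Cmod, Cmod_Ci; lra) e he).
  cbv beta in T'. rewrite Rplus_0_l, cis_0, Cmult_1_r in T'. exact T'.
Qed.

Lemma Lis_angular n Y : pole_free Y -> (exists r, (0 < r)%R /\ forall e, (Rabs e < r)%R -> pole_free (Y * cis e)) ->
  derC (fun e => Lis (S n) (Y * cis e) 0%R) 0 (Ci * Lis n Y 0%R).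
Proof.
  intros hok [r [hr hloc]].
  assert (hA : has_taylor (1 / 2) 1 (fun t => steps (at_param t [(S n, fun t => geom_clip (Y * t ^ 1))]) (fun _ => 1))).
  { apply (taylor_op 1 [(S n, fun t => geom_clip (Y * t ^ 1))] (fun _ _ => 1)).
    - constructor; [|constructor]. apply (taylor_geom_clip Y 1 1). now replace (Y * 1 ^ 1) with Y by ring.
    - apply (taylor_weight 0); [lra|]. apply taylor_const with 1%R; [apply contC_const|].
      intros. rewrite Cmod_1, Rmult_0_l, exp_0. lra. }
  apply taylor_order1 in hA. destruct hA as [a [B [d [hd [hB hT]]]]].
  set (G := fun t => steps (at_param t [(S n, fun t => geom_clip (Y * t ^ 1))]) (fun _ => 1) 0%R) in hT.
  assert (hG : forall t, pole_free (Y * t) -> G t = Lis (S n) (Y * t) 0%R).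
  { intros t ht. unfold G, Lis. cbn [steps at_param map fst snd].
    unfold step. apply tail_iter_ext_ge.
    - apply kernel_mul_decaying; [|apply moderate_const]. rewrite Cpow_1_r. now apply kernel_geom.
    - now apply global_decay_decaying, geom_global_decay.
    - intros u hu. unfold geom_clip. rewrite Rmax_left, Cpow_1_r by auto. ring.
    - lra. }
  assert (ha : Lis n Y 0%R = a).
  { assert (h1 := second_order_compose G a B d (fun e => RtoC (exp (- e))) (- (1)) (2 * exp 1) hd hB hT
      ltac:(pose proof (exp_pos 1); lra) exp_second_order ltac:(cbv beta; now rewrite Ropp_0, exp_0)).
    assert (h2 : derC (fun e => G (RtoC (exp (- e)))) 0 (- Lis n Y 0%R)).
    { replace (fun e => G (RtoC (exp (- e)))) with (Lis (S n) Y); [now apply Lis_derC|].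
      apply functional_extensionality; intros e. rewrite hG.
      - rewrite <- Lis_shift by auto. f_equal. ring.
      - intros x hx. rewrite <- Cmult_assoc, <- RtoC_mult. apply hok. apply Rmult_le_pos; auto. left; apply exp_pos. }
    assert (e : - (1) * a = - Lis n Y 0%R).
    { destruct h1 as [h1 h1'], h2 as [h2 h2']. apply C_eq.
      - rewrite <- (is_derive_unique _ _ _ h1). apply is_derive_unique, h2.
      - rewrite <- (is_derive_unique _ _ _ h1'). apply is_derive_unique, h2'. }
    replace (Lis n Y 0%R) with (- - Lis n Y 0%R) by ring. rewrite <- e. ring. }
  rewrite ha.
  assert (h1 := second_order_compose G a B d cis Ci (2 * 1) hd hB hT ltac:(lra) cis_second_order cis_0).
  destruct h1 as [h1 h1'].
  assert (hl : locally 0%R (fun e => G (cis e) = Lis (S n) (Y * cis e) 0%R)).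
  { exists (mkposreal r hr). intros e he. apply hG, hloc.
    change (Rabs (e - 0) < r)%R in he. now rewrite Rminus_0_r in he. }
  split.
  - apply (is_derive_ext_loc (fun e => Re (G (cis e)))); auto.
    revert hl. apply filter_imp. intros e ->. auto.
  - apply (is_derive_ext_loc (fun e => Im (G (cis e)))); auto.
    revert hl. apply filter_imp. intros e ->. auto.
Qed.

Lemma cis_off_ray x : (0 < x < 2 * PI)%R \/ (0 < - x < 2 * PI)%R -> off_ray (cis x).
Proof.
  intros hx [r [hr e]].
  assert (hc : cos x = r) by (apply (f_equal Re) in e; exact e).
  assert (hs : sin x = 0%R) by (apply (f_equal Im) in e; exact e).
  assert (h1 := sin2_cos2 x). unfold Rsqr in h1. rewrite hs, hc in h1.
  assert (hr1 : r = 1%R) by nra.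
  assert (h2 : cos x = (1 - 2 * sin (x / 2) * sin (x / 2))%R).
  { replace x with (2 * (x / 2))%R at 1 by field. apply cos_2a_sin. }
  assert (h3 : sin (x / 2) = 0%R) by nra.
  destruct hx as [hx|hx].
  - assert (0 < sin (x / 2))%R by (apply sin_gt_0; lra). lra.
  - assert (h4 : (0 < sin (- x / 2))%R) by (apply sin_gt_0; lra).
    replace (- x / 2)%R with (- (x / 2))%R in h4 by field. rewrite sin_neg in h4. lra.
Qed.

Lemma cis_inv x : / cis x = cis (- x).
Proof.
  assert (h : cis x * cis (- x) = 1) by (rewrite <- cis_plus, Rplus_opp_r; apply cis_0).
  assert (hn : cis x <> 0).
  { intros e. assert (h1 := cis_Cmod x). rewrite e, Cmod_0 in h1. lra. }
  replace (cis (- x)) with (/ cis x * (cis x * cis (- x))) by (field; auto).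
  rewrite h. ring.
Qed.

Lemma derC_translate (f : R -> C) x l : derC (fun e => f (x + e)%R) 0 l -> derC f x l.
Proof.
  intros h. assert (e : f = fun t => (fun e => f (x + e)%R) (t - x)%R).
  { apply functional_extensionality; intros t. f_equal. ring. }
  rewrite e. eapply derC_eq.
  - apply (derC_comp (fun e => f (x + e)%R) (fun t => (t - x)%R) x l 1).
    + replace (x - x)%R with 0%R by ring. exact h.
    + auto_derive; auto.
  - ring.
Qed.

Lemma Lis_cis_derC n x : (0 < x < 2 * PI)%R \/ (0 < - x < 2 * PI)%R ->
  derC (fun t => Lis (S n) (cis t) 0%R) x (Ci * Lis n (cis x) 0%R).
Proof.
  intros hx. apply derC_translate.
  replace (fun e => Lis (S n) (cis (x + e)) 0%R) with (fun e => Lis (S n) (cis x * cis e) 0%R).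
  2: { apply functional_extensionality; intros e. now rewrite cis_plus. }
  apply Lis_angular; [apply off_ray_pole_free, cis_off_ray, hx|].
  destruct hx as [hx|hx].
  - exists (Rmin x (2 * PI - x)). split; [apply Rmin_glb_lt; lra|].
    intros e he. rewrite <- cis_plus. apply off_ray_pole_free, cis_off_ray. left.
    assert (h1 := Rmin_l x (2 * PI - x)). assert (h2 := Rmin_r x (2 * PI - x)).
    apply Rabs_def2 in he. lra.
  - exists (Rmin (- x) (2 * PI + x)). split; [apply Rmin_glb_lt; lra|].
    intros e he. rewrite <- cis_plus. apply off_ray_pole_free, cis_off_ray. right.
    assert (h1 := Rmin_l (- x) (2 * PI + x)). assert (h2 := Rmin_r (- x) (2 * PI + x)).
    apply Rabs_def2 in he. lra.
Qed.

Lemma frac_inv (w : C) : w <> 0 -> 1 - w <> 0 -> frac w + frac (/ w) = - (1).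
Proof.
  intros h0 h1. unfold frac. field. repeat split; auto.
  intros e. apply h1. replace (1 - w) with (- (w - 1)) by ring. rewrite e. ring.
Qed.

(* The error term of Jonquiere's inversion formula at [exp (i x)]. Its derivative is [i]
   times the error term of index [n - 1], so by induction it is constant, and the
   duplication formulas at [i] turn this constant [c] into [2 ^ n * c]. *)
Definition circle_defect (n : nat) (x : R) : C :=
  Lis n (cis x) 0%R + (- (1)) ^ n * Lis n (cis (- x)) 0%R + beta_log n (RtoC x * Ci).

Lemma circle_defect_derC n x : (0 < x < 2 * PI)%R ->
  derC (circle_defect (S n)) x (Ci * circle_defect n x).
Proof.
  intros hx. unfold circle_defect. eapply derC_eq.
  - apply derC_plus; [apply derC_plus|].
    + apply Lis_cis_derC. auto.
    + apply derC_scal. apply (derC_comp (fun t => Lis (S n) (cis t) 0%R) Ropp x (Ci * Lis n (cis (- x)) 0%R) (-1)).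
      * apply Lis_cis_derC. right. lra.
      * auto_derive; auto; ring.
    + apply (beta_log_derC (fun t => RtoC t * Ci) x Ci (S n)).
      eapply derC_eq; [apply (derC_mult RtoC (fun _ => Ci)); [|apply derC_const]|].
      * apply (derC_RtoC (fun t => t) x 1). auto_derive; auto.
      * cbv beta. ring.
  - replace (RtoC (-1)) with (- (1)) by (apply C_eq; simpl; ring). simpl. ring.
Qed.

Lemma circle_defect_0 x : (0 < x < 2 * PI)%R -> circle_defect 0 x = 0.
Proof.
  intros hx. unfold circle_defect. rewrite beta_log_0, <- cis_inv. unfold Lis. simpl. unfold geom.
  rewrite Ropp_0, exp_0, !Cmult_1_r.
  assert (ho := cis_off_ray x (or_introl hx)).
  assert (h0 := off_ray_nonzero _ ho).
  replace (frac (cis x) + 1 * frac (/ cis x)) with (frac (cis x) + frac (/ cis x)) by ring.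
  rewrite frac_inv; auto; [ring|].
  intros e. apply (off_ray_pole_free _ ho 1%R); [lra|]. rewrite Cmult_1_r.
  replace (cis x) with (1 - (1 - cis x)) by ring. rewrite e. ring.
Qed.

Lemma Lis_double n s : 2 * Lis n (- (1)) (2 * s)%R = 2 ^ n * (Lis n Ci s + Lis n (- Ci) s).
Proof.
  assert (o1 : pole_free (- (1))).
  { apply off_ray_pole_free. intros [r [hr e]]. apply (f_equal Re) in e. simpl in e. lra. }
  assert (o2 : pole_free Ci).
  { apply off_ray_pole_free. intros [r [hr e]]. apply (f_equal Im) in e. simpl in e. lra. }
  assert (o3 : pole_free (- Ci)).
  { apply off_ray_pole_free. intros [r [hr e]]. apply (f_equal Im) in e. simpl in e. lra. }
  revert s. induction n as [|n IH]; intros s.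
  - unfold Lis. simpl. unfold geom, frac.
    assert (h2 := geom_nz Ci s o2). assert (h3 := geom_nz (- Ci) s o3).
    set (w := Ci * RtoC (exp (- s))) in *.
    replace (- Ci * RtoC (exp (- s))) with (- w) in * by (unfold w; ring).
    replace (- (1) * RtoC (exp (- (2 * s)))) with (w * w).
    2: { unfold w. replace (exp (- (2 * s))) with (exp (- s) * exp (- s))%R by (rewrite <- exp_plus; f_equal; ring).
         rewrite RtoC_mult. apply C_eq; simpl; ring. }
    assert (h1 : 1 - w * w <> 0).
    { replace (1 - w * w) with ((1 - w) * (1 - - w)) by ring. now apply Cmult_neq_0. }
    field. auto.
  - set (h := fun s => 2 ^ S n * (Lis n Ci s + Lis n (- Ci) s)).
    assert (hW : decaying h) by (apply decaying_scal, decaying_plus; now apply global_decay_decaying, Lis_global_decay).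
    assert (e1 : (fun s => 2 * Lis (S n) (- (1)) (2 * s)%R) = tail h).
    { apply tail_unique; auto.
      - intros t. eapply derC_eq.
        + apply derC_scal. apply (derC_comp (Lis (S n) (- (1))) (fun t => (2 * t)%R) t (- Lis n (- (1)) (2 * t)%R) 2).
          * now apply Lis_derC.
          * auto_derive; auto. ring.
        + unfold h. simpl. rewrite <- Cmult_assoc, <- IH. ring.
      - apply exp_decay_scal. destruct (Lis_global_decay (S n) (- (1)) o1) as [_ [A HA]].
        exists A, 1%R. split; [lra|]. intros t ht. eapply Rle_trans; [apply HA|].
        right. do 2 f_equal. field. }
    assert (e2 : (fun s => 2 ^ S n * (Lis (S n) Ci s + Lis (S n) (- Ci) s)) = tail h).
    { apply tail_unique; auto.
      - intros t. eapply derC_eq.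
        + apply derC_scal, derC_plus; now apply Lis_derC.
        + unfold h. ring.
      - apply decaying_exp_decay, decaying_scal, decaying_plus; now apply global_decay_decaying, Lis_global_decay. }
    assert (e3 := f_equal (fun f => f s) (eq_trans e1 (eq_sym e2))). exact e3.
Qed.

Lemma circle_defect_zero n x : (0 < x < 2 * PI)%R -> circle_defect n x = 0.
Proof.
  assert (hPI := PI_RGT_0).
  revert x. induction n as [|n IH]; intros x hx; [now apply circle_defect_0|].
  assert (hconst : forall y, (0 < y < 2 * PI)%R -> circle_defect (S n) y = circle_defect (S n) x).
  { intros y hy. apply derC_zero_const. intros s hs.
    assert (0 < s < 2 * PI)%R.
    { revert hs. unfold Rmin, Rmax. destruct (Rle_dec y x); lra. }
    eapply derC_eq; [now apply circle_defect_derC|]. rewrite IH by auto. ring. }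
  set (k := circle_defect (S n) x) in *.
  assert (c1 : cis PI = - (1)) by (unfold cis; rewrite cos_PI, sin_PI; apply C_eq; simpl; ring).
  assert (c2 : cis (PI / 2) = Ci) by (unfold cis; rewrite cos_PI2, sin_PI2; reflexivity).
  assert (c3 : cis (3 * (PI / 2)) = - Ci).
  { replace (3 * (PI / 2))%R with (PI + PI / 2)%R by field. rewrite cis_plus, c1, c2. ring. }
  assert (i1 : cis (- PI) = - (1)).
  { rewrite <- cis_inv, c1. field. }
  assert (i2 : cis (- (PI / 2)) = - Ci) by (rewrite <- cis_inv, c2; apply Ci_inv).
  assert (i3 : cis (- (3 * (PI / 2))) = Ci).
  { rewrite <- cis_inv, c3. replace (- Ci) with (/ Ci) by apply Ci_inv. field. apply Ci_nz. }
  assert (h1 : circle_defect (S n) PI = k) by (apply hconst; lra).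
  assert (h2 : circle_defect (S n) (PI / 2) = k) by (apply hconst; lra).
  assert (h3 : circle_defect (S n) (3 * (PI / 2)) = k) by (apply hconst; lra).
  unfold circle_defect in h1, h2, h3.
  rewrite c1, i1 in h1. rewrite c2, i2 in h2. rewrite c3, i3 in h3.
  assert (dF := Lis_double (S n) 0). rewrite Rmult_0_r in dF.
  assert (hp : forall r, beta_log (S n) (RtoC (r * (2 * PI)) * Ci) = two_pi_i ^ S n * bhat (S n) (RtoC r)).
  { intros r. unfold beta_log. do 2 f_equal. unfold two_pi_i. rewrite RtoC_mult. field.
    split; [apply Ci_nz|]. intros e. apply RtoC_inj in e. lra. }
  assert (dB := bhat_double (S n) (1 / 4)).
  replace (2 * (1 / 4))%R with (1 / 2)%R in dB by field.
  replace (1 / 4 + 1 / 2)%R with (3 / 4)%R in dB by field.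
  assert (e1 := hp (1 / 2)%R). replace (1 / 2 * (2 * PI))%R with PI in e1 by field.
  assert (e2 := hp (1 / 4)%R). replace (1 / 4 * (2 * PI))%R with (PI / 2)%R in e2 by field.
  assert (e3 := hp (3 / 4)%R). replace (3 / 4 * (2 * PI))%R with (3 * (PI / 2))%R in e3 by field.
  rewrite e1 in h1. rewrite e2 in h2. rewrite e3 in h3.
  assert (hk : 2 * k = 2 ^ S n * (2 * k)).
  { rewrite <- h1 at 1. replace (2 ^ S n * (2 * k)) with (2 ^ S n * (k + k)) by ring.
    rewrite <- h2 at 1. rewrite <- h3.
    set (m := (- (1)) ^ S n). set (T := two_pi_i ^ S n).
    replace (2 * (Lis (S n) (- (1)) 0%R + m * Lis (S n) (- (1)) 0%R + T * bhat (S n) (RtoC (1 / 2))))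
      with ((1 + m) * (2 * Lis (S n) (- (1)) 0%R) + T * (2 * bhat (S n) (RtoC (1 / 2)))) by ring.
    rewrite dF, dB. ring. }
  assert (hz : (1 - 2 ^ S n) * k = 0).
  { replace ((1 - 2 ^ S n) * k) with ((2 * k - 2 ^ S n * (2 * k)) / 2).
    - rewrite <- hk. unfold Cdiv. ring.
    - field. }
  destruct (Ceq_dec k 0) as [|hk0]; auto. exfalso. revert hz.
  apply Cmult_neq_0; auto. intros hz.
  assert (e : RtoC (2 ^ S n) = RtoC 1).
  { rewrite RtoC_pow. replace (RtoC 2 ^ S n) with (1 - (1 - RtoC 2 ^ S n)) by ring. rewrite hz. ring. }
  apply RtoC_inj in e. assert (hp2 := pow_R1_Rle 2 n ltac:(lra)). simpl in e. lra.
Qed.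

Lemma Cmod_sq (w : C) : (Cmod w * Cmod w = Re w * Re w + Im w * Im w)%R.
Proof.
  unfold Cmod. rewrite sqrt_sqrt; [unfold Re, Im; ring|]. nra.
Qed.

Lemma cis_Carg (w : C) : w <> 0 -> w = RtoC (Cmod w) * cis (Carg w).
Proof.
  intros hw. assert (hm : (0 < Cmod w)%R) by now apply Cmod_gt_0.
  assert (hsq := Cmod_sq w).
  set (x := (Re w / Cmod w)%R).
  assert (hx : (Rabs (Re w) <= Cmod w)%R) by apply Re_le_Cmod.
  assert (hx1 : (-1 <= x <= 1)%R).
  { apply Rabs_le_between. unfold x, Rdiv. rewrite Rabs_mult, Rabs_inv, (Rabs_pos_eq (Cmod w)) by lra.
    apply Rmult_le_reg_r with (Cmod w); auto. rewrite Rmult_assoc, Rinv_l; lra. }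
  assert (h1 : (1 - Rsqr x = Rsqr (Im w / Cmod w))%R).
  { unfold Rsqr, x. apply Rmult_eq_reg_r with (Cmod w * Cmod w)%R; [|nra].
    field_simplify; [|lra|lra]. nra. }
  unfold Carg. fold x. apply C_eq; simpl.
  - destruct (Rle_dec 0 (Im w)); rewrite ?cos_neg, cos_acos by auto; unfold x; unfold Re; field; unfold Re in *; lra.
  - destruct (Rle_dec 0 (Im w)) as [hi|hi]; rewrite ?sin_neg, sin_acos, h1, sqrt_Rsqr_abs by auto.
    + rewrite Rabs_pos_eq by (apply Rmult_le_pos; [auto|left; now apply Rinv_0_lt_compat]).
      field. lra.
    + rewrite Rabs_left; [field; lra|]. apply Rmult_lt_reg_r with (Cmod w); auto.
      unfold Rdiv. rewrite Rmult_assoc, Rinv_l; lra.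
Qed.

Lemma Carg_bound w : (- PI <= Carg w <= PI)%R.
Proof.
  unfold Carg. pose proof (acos_bound (Re w / Cmod w)). pose proof PI_RGT_0.
  destruct (Rle_dec 0 (Im w)); lra.
Qed.

Lemma jonquiere n Y s : off_ray Y ->
  Lis n Y s + (- (1)) ^ n * Lis n (/ Y) (- s)%R = - beta n (Y * RtoC (exp (- s))).
Proof.
  intros hY. assert (hY' := off_ray_inv Y hY). assert (hn := off_ray_nonzero Y hY).
  assert (hm : (0 < Cmod Y)%R) by now apply Cmod_gt_0.
  set (J := fun n s => Lis n Y s + (- (1)) ^ n * Lis n (/ Y) (- s)%R + beta n (Y * RtoC (exp (- s)))).
  enough (H : forall n s, J n s = 0).
  { specialize (H n s). unfold J in H. set (b := beta n _) in *.
    replace (- b) with (Lis n Y s + (- (1)) ^ n * Lis n (/ Y) (- s)%R - (Lis n Y s + (- (1)) ^ n * Lis n (/ Y) (- s)%R + b)) by ring.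
    rewrite H. ring. }
  clear n s. intros n. induction n as [|n IH]; intros s.
  - unfold J. rewrite beta_scale, beta_log_0 by auto. unfold Lis. simpl. unfold geom.
    rewrite Ropp_involutive.
    assert (hz := geom_nz Y s (off_ray_pole_free Y hY)).
    set (w := Y * RtoC (exp (- s))) in *.
    assert (he : RtoC (exp s) = / RtoC (exp (- s))).
    { rewrite <- RtoC_inv by (apply Rgt_not_eq, exp_pos). f_equal. rewrite exp_Ropp, Rinv_inv. auto. }
    assert (hen := RtoC_exp_neq (- s)).
    replace (/ Y * RtoC (exp s)) with (/ w) by (rewrite he; unfold w; field; auto).
    replace (frac w + 1 * frac (/ w) + 1) with (frac w + frac (/ w) + 1) by ring.
    rewrite frac_inv; auto; [ring|]. unfold w. now apply Cmult_neq_0.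
  - assert (hconst : forall t, J (S n) s = J (S n) t).
    { intros t. apply derC_zero_const. intros u _. unfold J.
      eapply derC_eq.
      - apply derC_plus; [apply derC_plus|].
        + apply Lis_derC, off_ray_pole_free, hY.
        + apply derC_scal.
          apply (derC_comp (Lis (S n) (/ Y)) Ropp u (- Lis n (/ Y) (- u)%R) (-1)).
          * apply Lis_derC, off_ray_pole_free, hY'.
          * auto_derive; auto; ring.
        + apply beta_derC; auto.
      - cbv beta iota.
        replace (RtoC (-1)) with (- (1)) by (apply C_eq; simpl; ring).
        transitivity (- J n u); [unfold J; simpl; ring|rewrite IH; ring]. }
    set (th := (PI + Carg (- Y))%R).
    assert (hmY : - Y <> 0) by (intros e; apply hn; replace Y with (- - Y) by ring; rewrite e; ring).
    assert (eY : Y = RtoC (Cmod Y) * cis th).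
    { unfold th. rewrite cis_plus.
      replace (cis PI) with (- (1)) by (unfold cis; rewrite cos_PI, sin_PI; apply C_eq; simpl; ring).
      assert (h := cis_Carg (- Y) hmY). rewrite Cmod_opp in h.
      replace Y with (- - Y) at 1 by ring. rewrite h at 1. ring. }
    assert (hth : (0 < th < 2 * PI)%R).
    { assert (hb := Carg_bound (- Y)). fold th.
      assert (h0 : cis th <> 1).
      { intros e. rewrite e in eY. apply hY. exists (Cmod Y). split; [lra|]. rewrite eY at 1. ring. }
      destruct (Req_dec th 0) as [e|]; [exfalso; apply h0; rewrite e; apply cis_0|].
      destruct (Req_dec th (2 * PI)) as [e|]; [|unfold th in *; lra].
      exfalso; apply h0. rewrite e. unfold cis. rewrite cos_2PI, sin_2PI. reflexivity. }
    rewrite (hconst (ln (Cmod Y))). rewrite <- (circle_defect_zero (S n) th hth).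
    unfold J, circle_defect.
    assert (hexp : exp (- ln (Cmod Y)) = (/ Cmod Y)%R) by (rewrite exp_Ropp, exp_ln; auto).
    assert (hcm : RtoC (Cmod Y) <> 0) by (intros e; apply RtoC_inj in e; lra).
    assert (ecis : Y * RtoC (/ Cmod Y) = cis th).
    { rewrite eY at 1. rewrite RtoC_inv by lra. field. auto. }
    f_equal; [f_equal|].
    + rewrite <- (Rplus_0_l (ln (Cmod Y))). rewrite Lis_shift by now apply off_ray_pole_free.
      now rewrite hexp, ecis.
    + f_equal. rewrite <- (Rplus_0_l (- ln (Cmod Y))). rewrite Lis_shift by now apply off_ray_pole_free.
      f_equal. rewrite Ropp_involutive, exp_ln by auto. rewrite <- cis_inv, <- ecis.
      rewrite RtoC_inv by lra. field. auto.
    + rewrite beta_scale by auto. f_equal. unfold Clog, th. rewrite Cmod_opp.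
      apply C_eq; simpl; ring.
Qed.

(** * Scaling the first argument *)

(* For [e = 1]: Li with its first argument scaled by [exp (- sigma)], as a function of
   [sigma]. For [e = -1]: the part of [Li(1/z)] left over by Jonquiere's formula. *)
Definition translate_steps (e : R) (l : list (nat * (R -> C))%type) (j : nat) (Y : C) (sigma : R) : C :=
  steps l (fun s => Lis j Y (sigma + e * s)%R) 0%R.

Section translate_steps.
Variables (e : R) (l : list (nat * (R -> C))%type) (Y : C).
Hypothesis he : (Rabs e <= 1)%R.
Hypothesis hl : kernels l.
Hypothesis hY : pole_free Y.

Lemma affine_exp_bound (A sigma s : R) : (0 <= A)%R -> (0 <= s)%R ->
  (A * exp (- (1 / 2) * (sigma + e * s)) <= A * exp (- (1 / 2) * sigma) * exp (s / 2))%R.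
Proof.
  intros hA hs. rewrite Rmult_assoc, <- exp_plus. apply Rmult_le_compat_l; auto. apply exp_le.
  apply Rabs_le_between in he. nra.
Qed.

Lemma translate_steps_moderate_le (j : nat) : exists A, (0 <= A)%R /\ forall sigma,
  moderate (fun s => Lis j Y (sigma + e * s)%R) /\
  moderate_le (A * exp (- (1 / 2) * sigma)) (fun s => Lis j Y (sigma + e * s)%R).
Proof.
  destruct (Lis_global_decay j Y hY) as [hc [A hA]]. exists A. assert (h0 := global_le_nonneg _ _ hA).
  split; auto. intros sigma.
  assert (h1 : moderate_le (A * exp (- (1 / 2) * sigma)) (fun s => Lis j Y (sigma + e * s)%R)).
  { intros s hs. eapply Rle_trans; [apply hA|]. now apply affine_exp_bound. }
  split; auto. split; [|eauto].
  apply (contC_comp (Lis j Y)); auto. intros s.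
  apply (ex_derive_continuous (fun s => (sigma + e * s)%R)). auto_derive; auto.
Qed.

Lemma translate_steps_derC j sigma : derC (translate_steps e l (S j) Y) sigma (- translate_steps e l j Y sigma).
Proof.
  destruct (Lis_second_order j Y hY) as [B [hB HB]].
  destruct (translate_steps_moderate_le j) as [A [_ HA]]. destruct (translate_steps_moderate_le (S j)) as [A' [_ HA']].
  assert (hV : moderate (fun s => -(1) * Lis j Y (sigma + e * s)%R)) by (apply moderate_scal, HA).
  eapply derC_eq.
  - apply (steps_param_derC l (fun u s => Lis (S j) Y (u + e * s)%R) (fun s => -(1) * Lis j Y (sigma + e * s)%R) sigma
      (B * exp (- (1 / 2) * sigma))); auto.
    + intros u. apply HA'.
    + intros d hd s hs.
      replace (Lis (S j) Y (sigma + d + e * s)%R + - (1) * Lis (S j) Y (sigma + e * s)%R +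
        - RtoC d * (- (1) * Lis j Y (sigma + e * s)%R))
        with (Lis (S j) Y (sigma + e * s + d)%R - Lis (S j) Y (sigma + e * s)%R + RtoC d * Lis j Y (sigma + e * s)%R).
      2: { replace (sigma + d + e * s)%R with (sigma + e * s + d)%R by ring. ring. }
      eapply Rle_trans; [apply HB, hd|].
      eapply Rle_trans; [apply affine_exp_bound; auto; apply Rmult_le_pos; auto; apply pow2_ge_0|].
      right. ring.
  - rewrite steps_scal; auto; [|apply HA]. unfold translate_steps. ring.
Qed.

Lemma translate_steps_exp_decay j : exp_decay (translate_steps e l j Y).
Proof.
  destruct (translate_steps_moderate_le j) as [A [hA HA]]. destruct (steps_moderate_le l hl) as [K [hK HK]].
  exists (K * A)%R, (1 / 2)%R. split; [lra|]. intros sigma _.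
  destruct (HA sigma) as [h1 h2]. specialize (HK _ _ h1 h2 0%R (Rle_refl 0)).
  replace (0 / 2)%R with 0%R in HK by lra. rewrite exp_0, Rmult_1_r, <- Rmult_assoc in HK. exact HK.
Qed.

Lemma translate_steps_decaying j : decaying (translate_steps e l (S j) Y).
Proof.
  split; [|apply translate_steps_exp_decay]. eapply derC_cont. intros; apply translate_steps_derC.
Qed.

Lemma translate_steps_tail j : decaying (translate_steps e l j Y) -> translate_steps e l (S j) Y = tail (translate_steps e l j Y).
Proof.
  intros hW. apply tail_unique; auto; [intros; apply translate_steps_derC|apply translate_steps_exp_decay].
Qed.

Lemma translate_steps_tail_iter j n : decaying (translate_steps e l j Y) -> tail_iter n (translate_steps e l j Y) = translate_steps e l (n + j) Y.
Proof.
  intros hW. induction n; auto.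
  rewrite tail_iter_S, IHn. simpl. symmetry. apply translate_steps_tail. destruct n; simpl; auto. apply translate_steps_decaying.
Qed.
End translate_steps.

Lemma step_one n Y : step n (geom Y) (fun _ => 1) = Lis n Y.
Proof.
  unfold step, Lis. f_equal. apply functional_extensionality; intros; ring.
Qed.

Lemma frac_mul (eta w : C) : 1 - w <> 0 -> 1 - eta * w <> 0 -> 1 - eta <> 0 ->
  frac w * frac (eta * w) = frac eta * frac w + - (1 + frac eta) * frac (eta * w).
Proof. intros. unfold frac. field. auto. Qed.

Lemma frac_mul_inv (eta w : C) : w <> 0 -> eta <> 0 -> 1 - / w <> 0 -> 1 - eta * w <> 0 -> 1 - eta <> 0 ->
  1 - / (eta * w) <> 0 ->
  frac (/ w) * frac (eta * w) = frac eta * (frac (/ w) + - (1) * frac (/ (eta * w))).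
Proof.
  intros h1 h2 h3 h4 h5 h6.
  assert (w - 1 <> 0).
  { intros e. apply h3. replace (1 - / w) with ((w - 1) * / w) by (field; auto). rewrite e. ring. }
  assert (eta * w - 1 <> 0).
  { intros e. apply h4. replace (1 - eta * w) with (- (eta * w - 1)) by ring. rewrite e. ring. }
  unfold frac. field. repeat split; auto.
Qed.

Lemma pole_free_scale Y x : (0 <= x)%R -> pole_free Y -> pole_free (Y * RtoC x).
Proof.
  intros hx h u hu. rewrite <- Cmult_assoc, <- RtoC_mult. apply h. now apply Rmult_le_pos.
Qed.

Lemma translate_steps_zero L n2 z1 Y2 sigma : kernels L -> pole_free z1 -> pole_free Y2 -> pole_free (z1 * Y2) ->
  translate_steps 1 ((n2, geom Y2) :: L) 0 (z1 * Y2) sigma =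
  geom z1 sigma * steps L (Lis n2 Y2) 0%R - (1 + geom z1 sigma) * translate_steps 1 L n2 (z1 * Y2) sigma.
Proof.
  intros hL h1 h2 h12. unfold translate_steps. cbn [steps fst snd]. change (geom z1 sigma) with (frac (z1 * RtoC (exp (- sigma)))).
  set (eta := z1 * RtoC (exp (- sigma))).
  assert (heta : pole_free eta) by (apply pole_free_scale; auto; left; apply exp_pos).
  assert (e : (fun s => geom Y2 s * Lis 0 (z1 * Y2) (sigma + 1 * s)%R) =
    (fun s => frac eta * geom Y2 s + - (1 + frac eta) * geom (z1 * Y2) (s + sigma)%R)).
  { apply functional_extensionality; intros s.
    unfold Lis. simpl. unfold geom.
    replace (z1 * Y2 * RtoC (exp (- (sigma + 1 * s)))) with (eta * (Y2 * RtoC (exp (- s)))).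
    2: { unfold eta. replace (- (sigma + 1 * s))%R with (- sigma + - s)%R by ring. rewrite exp_plus, RtoC_mult. ring. }
    replace (z1 * Y2 * RtoC (exp (- (s + sigma)))) with (eta * (Y2 * RtoC (exp (- s)))).
    2: { unfold eta. replace (- (s + sigma))%R with (- sigma + - s)%R by ring. rewrite exp_plus, RtoC_mult. ring. }
    apply frac_mul.
    - now apply geom_nz.
    - replace (eta * (Y2 * RtoC (exp (- s)))) with (z1 * Y2 * RtoC (exp (- (s + sigma)))).
      2: { unfold eta. replace (- (s + sigma))%R with (- sigma + - s)%R by ring. rewrite exp_plus, RtoC_mult. ring. }
      now apply geom_nz.
    - now apply geom_nz. }
  unfold step. cbv beta. rewrite e.
  assert (g1 := geom_global_decay Y2 h2). assert (g2 := geom_global_decay _ h12).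
  assert (w2 := global_decay_decaying _ (global_decay_shift _ sigma g2)).
  rewrite tail_iter_plus, !tail_iter_scal; auto using decaying_scal, global_decay_decaying.
  rewrite (tail_iter_shift n2 _ sigma g2). fold (Lis n2 Y2) (Lis n2 (z1 * Y2)).
  assert (v1 : moderate (Lis n2 Y2)) by (now apply decaying_moderate, global_decay_decaying, Lis_global_decay).
  assert (v2 : moderate (fun s => Lis n2 (z1 * Y2) (s + sigma)%R)) by (now apply decaying_moderate, global_decay_decaying, global_decay_shift, Lis_global_decay).
  rewrite steps_plus, !steps_scal; auto using moderate_scal.
  replace (fun s => Lis n2 (z1 * Y2) (sigma + 1 * s)%R) with (fun s => Lis n2 (z1 * Y2) (s + sigma)%R)
    by (apply functional_extensionality; intros; f_equal; ring).
  ring.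
Qed.

Lemma translate_steps_zero_inv L n2 z1 Y2 sigma : kernels L -> off_ray z1 -> off_ray Y2 -> off_ray (z1 * Y2) ->
  translate_steps (-1) ((n2, geom (/ Y2)) :: L) 0 (z1 * Y2) sigma =
  geom z1 sigma * (steps L (Lis n2 (/ Y2)) 0%R - steps L (Lis n2 (/ (z1 * RtoC (exp (- sigma)) * Y2))) 0%R).
Proof.
  intros hL h1 h2 h12. unfold translate_steps. cbn [steps fst snd]. change (geom z1 sigma) with (frac (z1 * RtoC (exp (- sigma)))).
  set (eta := z1 * RtoC (exp (- sigma))).
  assert (heta : off_ray eta) by (apply off_ray_scale; auto; apply exp_pos).
  assert (heta2 : off_ray (eta * Y2)).
  { replace (eta * Y2) with (z1 * Y2 * RtoC (exp (- sigma))) by (unfold eta; ring).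
    apply off_ray_scale; auto; apply exp_pos. }
  assert (n1' := off_ray_nonzero _ heta). assert (n2' := off_ray_nonzero _ h2).
  assert (hexp : forall s, RtoC (exp (- s)) = / RtoC (exp s)).
  { intros s. rewrite <- RtoC_inv by (apply Rgt_not_eq, exp_pos). f_equal. apply exp_Ropp. }
  assert (hexn := RtoC_exp_neq).
  assert (e : (fun s => geom (/ Y2) s * Lis 0 (z1 * Y2) (sigma + -1 * s)%R) =
    (fun s => frac eta * (geom (/ Y2) s + -(1) * geom (/ (eta * Y2)) s))).
  { apply functional_extensionality; intros s.
    unfold Lis. simpl. unfold geom.
    set (w := Y2 * RtoC (exp s)).
    assert (ew : / Y2 * RtoC (exp (- s)) = / w) by (rewrite hexp; unfold w; field; auto).
    assert (eew : / (eta * Y2) * RtoC (exp (- s)) = / (eta * w)) by (rewrite hexp; unfold w; field; auto).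
    assert (e3 : z1 * Y2 * RtoC (exp (- (sigma + -1 * s))) = eta * w).
    { unfold eta, w. replace (- (sigma + -1 * s))%R with (- sigma + s)%R by ring. rewrite exp_plus, RtoC_mult. ring. }
    assert (hw : w <> 0) by (now apply Cmult_neq_0).
    rewrite ew, eew, e3. apply frac_mul_inv; auto.
    - rewrite <- ew. apply geom_nz, off_ray_pole_free, off_ray_inv, h2.
    - rewrite <- e3. apply geom_nz, off_ray_pole_free, h12.
    - apply geom_nz, off_ray_pole_free, h1.
    - rewrite <- eew. apply geom_nz, off_ray_pole_free, off_ray_inv, heta2. }
  unfold step. cbv beta. rewrite e.
  assert (g1 := geom_global_decay _ (off_ray_pole_free _ (off_ray_inv _ h2))).
  assert (g2 := geom_global_decay _ (off_ray_pole_free _ (off_ray_inv _ heta2))).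
  apply global_decay_decaying in g1, g2.
  rewrite tail_iter_scal, tail_iter_plus, tail_iter_scal; auto using decaying_scal, decaying_plus.
  fold (Lis n2 (/ Y2)) (Lis n2 (/ (eta * Y2))).
  assert (v1 : moderate (Lis n2 (/ Y2))) by (now apply decaying_moderate, tail_iter_decaying).
  assert (v2 : moderate (Lis n2 (/ (eta * Y2)))) by (now apply decaying_moderate, tail_iter_decaying).
  rewrite steps_scal, steps_plus, steps_scal; auto using moderate_scal, moderate_plus. ring.
Qed.

Lemma zprod_cons_S z zs i j : (1 <= i)%nat -> zprod (z :: zs) (S i) (S j) = zprod zs i j.
Proof.
  intros hi. unfold zprod. replace (S j - S i)%nat with (j - i)%nat by lia.
  destruct i; [lia|]. simpl. now rewrite Nat.sub_0_r.
Qed.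

Lemma zprod_cons_1 z zs j : (1 <= j)%nat -> zprod (z :: zs) 1 (S j) = z * zprod zs 1 j.
Proof.
  intros hj. unfold zprod. replace (S j - 1 + 1)%nat with (S (j - 1 + 1)) by lia. reflexivity.
Qed.

Lemma zprod_cons_11 z zs : zprod (z :: zs) 1 1 = z.
Proof. unfold zprod. simpl. ring. Qed.

Lemma zprod_full z zs : zprod (z :: zs) 1 (S (length zs)) = Cprod (z :: zs).
Proof.
  unfold zprod. replace (S (length zs) - 1 + 1)%nat with (length (z :: zs)) by (simpl; lia).
  simpl skipn. now rewrite firstn_all.
Qed.

Lemma domain_zprod d zs i j : domain d zs -> (1 <= i <= j)%nat -> (j <= d)%nat -> off_ray (zprod zs i j).
Proof. intros [_ h] h1 h2. exact (h i j h1 h2). Qed.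

Lemma domain_tail d z zs : domain (S d) (z :: zs) -> domain d zs.
Proof.
  intros [hl h]. split; [now injection hl|]. intros i j hi hj.
  rewrite <- (zprod_cons_S z) by lia. apply h; lia.
Qed.

Lemma domain_head d z zs : domain (S d) (z :: zs) -> off_ray z.
Proof.
  intros h. rewrite <- (zprod_cons_11 z zs). apply (domain_zprod _ _ _ _ h); lia.
Qed.

Lemma domain_full d z zs : domain (S d) (z :: zs) -> off_ray (Cprod (z :: zs)).
Proof.
  intros h. rewrite <- zprod_full. assert (hl := proj1 h). simpl in hl.
  apply (domain_zprod _ _ _ _ h); lia.
Qed.

Lemma domain_suffix_prods d zs : domain d zs -> Forall off_ray (suffix_prods zs).
Proof.
  revert d; induction zs as [|z zs IH]; intros d h; simpl; constructor.
  - destruct d; [destruct h as [hl _]; discriminate|]. apply (domain_full d z zs h).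
  - destruct d; [destruct h as [hl _]; discriminate|]. apply (IH d), (domain_tail d z zs h).
Qed.

Lemma domain_merge d z1 z2 zt x : (0 < x)%R -> domain (S (S d)) (z1 :: z2 :: zt) ->
  domain (S d) (z1 * z2 * RtoC x :: zt).
Proof.
  intros hx h. split; [destruct h as [hl _]; simpl in *; lia|].
  intros i j hi hj. change (off_ray (zprod (z1 * z2 * RtoC x :: zt) i j)).
  destruct i as [|[|i]]; [lia| |].
  - destruct j as [|[|j]]; [lia| |].
    + rewrite zprod_cons_11. apply off_ray_scale; auto.
      replace (z1 * z2) with (zprod (z1 :: z2 :: zt) 1 2).
      * apply (domain_zprod _ _ _ _ h); lia.
      * rewrite zprod_cons_1, zprod_cons_11 by lia. reflexivity.
    + rewrite zprod_cons_1 by lia.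
      replace (z1 * z2 * RtoC x * zprod zt 1 (S j)) with (zprod (z1 :: z2 :: zt) 1 (S (S (S j))) * RtoC x).
      * apply off_ray_scale; auto. apply (domain_zprod _ _ _ _ h); lia.
      * rewrite !zprod_cons_1 by lia. ring.
  - destruct j as [|j]; [lia|]. rewrite zprod_cons_S by lia.
    rewrite <- (zprod_cons_S z2), <- (zprod_cons_S z1) by lia. apply (domain_zprod _ _ _ _ h); lia.
Qed.

Lemma domain_nonzero d zs : domain d zs -> Forall (fun z : C => z <> 0) zs.
Proof.
  revert d; induction zs as [|z zs IH]; intros d h; constructor;
    (destruct d; [destruct h as [hl _]; discriminate|]).
  - apply off_ray_nonzero, (domain_head d z zs h).
  - apply (IH d), (domain_tail d z zs h).
Qed.

Lemma Cprod_inv l : Forall (fun z : C => z <> 0) l -> Cprod (map Cinv l) = / Cprod l /\ Cprod l <> 0.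
Proof.
  induction 1 as [|z l hz hl [IH IH']]; simpl.
  - split; [field|]. intros e. apply RtoC_inj in e. lra.
  - rewrite IH. split; [field; auto|now apply Cmult_neq_0].
Qed.

Lemma domain_inv d zs : domain d zs -> domain d (map Cinv zs).
Proof.
  intros h. assert (hn := domain_nonzero d zs h). split.
  - rewrite length_map. apply h.
  - intros i j hi hj. change (off_ray (zprod (map Cinv zs) i j)).
    replace (zprod (map Cinv zs) i j) with (/ zprod zs i j).
    + apply off_ray_inv, (domain_zprod _ _ _ _ h); auto.
    + unfold zprod. rewrite skipn_map, firstn_map.
      symmetry. apply Cprod_inv. apply Forall_forall. intros z hz.
      rewrite Forall_forall in hn. apply hn.
      rewrite <- (firstn_skipn (i - 1) zs), in_app_iff. right.
      rewrite <- (firstn_skipn (j - i + 1) (skipn (i - 1) zs)), in_app_iff. auto.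
Qed.

Lemma suffix_prods_kernels ns zs : Forall off_ray (suffix_prods zs) -> kernels (combine ns (map geom (suffix_prods zs))).
Proof.
  intros h. apply kernels_combine. rewrite Forall_map. eapply Forall_impl; [|exact h].
  intros Y hY. apply (kernel_geom Y (off_ray_pole_free Y hY)).
Qed.

(** * The parity recursion *)

(* [(-1)^(|n| - d)], without truncated subtraction. *)
Definition parity_sign (ns : list nat) : C := (- (1)) ^ (list_sum ns + length ns).
Definition PLI (ns : list nat) (zs : list C) : C :=
  LI ns zs - parity_sign ns * LI ns (map Cinv zs).

Lemma parity_sign_cons n ns : parity_sign (n :: ns) = - (- (1)) ^ n * parity_sign ns.
Proof.
  unfold parity_sign. simpl. replace (n + list_sum ns + S (length ns))%nat with (S (n + (list_sum ns + length ns))) by lia.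
  simpl. rewrite Cpow_add_r. ring.
Qed.

Lemma sign_sq n : (- (1)) ^ n * (- (1)) ^ n = 1.
Proof. rewrite <- Cpow_mult_l. replace (- (1) * - (1)) with (RtoC 1) by ring. apply Cpow_1_l. Qed.

Lemma decaying_mult_bounded f g A : decaying f -> contC g -> (forall s, (0 <= s)%R -> (Cmod (g s) <= A)%R) ->
  decaying (fun s => g s * f s).
Proof.
  intros [hf [B [c [c0 hB]]]] hg hA. split; [now apply contC_mult|].
  exists (A * B)%R, c. split; auto. intros s hs. rewrite Cmod_mult, Rmult_assoc.
  apply Rmult_le_compat; auto using Cmod_ge_0.
Qed.

Lemma LI_cons n ns z zs : LI (n :: ns) (z :: zs) = steps (combine ns (map geom (suffix_prods zs))) (Lis n (z * Cprod zs)) 0%R.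
Proof. unfold LI. cbn [suffix_prods map combine steps fst snd]. now rewrite step_one. Qed.

Lemma LI_scale_translate_steps n ns z zs sigma : off_ray (z * Cprod zs) ->
  LI (n :: ns) (z * RtoC (exp (- sigma)) :: zs) =
  translate_steps 1 (combine ns (map geom (suffix_prods zs))) n (z * Cprod zs) sigma.
Proof.
  intros h. rewrite LI_cons. unfold translate_steps. f_equal. apply functional_extensionality; intros s.
  replace (sigma + 1 * s)%R with (s + sigma)%R by ring.
  rewrite Lis_shift by now apply off_ray_pole_free. f_equal. ring.
Qed.

Lemma LI_tail_iter j n ns z zs : (1 <= n)%nat -> Forall off_ray (suffix_prods (z :: zs)) ->
  decaying (fun sigma => LI (n :: ns) (z * RtoC (exp (- sigma)) :: zs)) /\
  tail_iter j (fun sigma => LI (n :: ns) (z * RtoC (exp (- sigma)) :: zs)) =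
    fun sigma => LI ((j + n)%nat :: ns) (z * RtoC (exp (- sigma)) :: zs).
Proof.
  intros hn h. inversion h as [|? ? hz hzs]; subst.
  assert (e : forall m, (fun sigma => LI (m :: ns) (z * RtoC (exp (- sigma)) :: zs)) =
    translate_steps 1 (combine ns (map geom (suffix_prods zs))) m (z * Cprod zs)).
  { intros m. apply functional_extensionality; intros. now apply LI_scale_translate_steps. }
  rewrite !e. destruct n; [lia|].
  assert (hW : decaying (translate_steps 1 (combine ns (map geom (suffix_prods zs))) (S n) (z * Cprod zs))).
  { apply translate_steps_decaying; [rewrite Rabs_R1; lra|now apply suffix_prods_kernels|now apply off_ray_pole_free]. }
  split; auto. apply translate_steps_tail_iter; auto; [rewrite Rabs_R1; lra|now apply suffix_prods_kernels|now apply off_ray_pole_free].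
Qed.

(* In differential form: [z_1 d/dz_1 Li_(1,n,...) (z_1, z_2, ...)] equals
   [f(z_1) Li_(n,...) (z_2, ...) - (1 + f(z_1)) Li_(n,...) (z_1 z_2, ...)]. *)
Lemma LI_first_variable j n ns z1 z2 zt : (1 <= n)%nat -> off_ray z1 -> Forall off_ray (suffix_prods (z1 :: z2 :: zt)) ->
  let h := fun sigma => geom z1 sigma * LI (n :: ns) (z2 :: zt)
      - (1 + geom z1 sigma) * LI (n :: ns) (z1 * z2 * RtoC (exp (- sigma)) :: zt) in
  decaying h /\ tail_iter j h 0%R = LI (j :: n :: ns) (z1 :: z2 :: zt).
Proof.
  intros hn h1 hc h. inversion hc as [|? ? h12 hc']; subst. inversion hc' as [|? ? h2 hzt]; subst.
  set (L := combine ns (map geom (suffix_prods zt))).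
  assert (hL : kernels L) by now apply suffix_prods_kernels.
  assert (h12' : off_ray (z1 * (z2 * Cprod zt))) by exact h12.
  assert (eh : h = translate_steps 1 ((n, geom (z2 * Cprod zt)) :: L) 0 (z1 * (z2 * Cprod zt))).
  { apply functional_extensionality; intros sigma. rewrite translate_steps_zero; auto using off_ray_pole_free.
    unfold h. rewrite LI_cons, LI_scale_translate_steps; [|now rewrite <- Cmult_assoc].
    now rewrite <- Cmult_assoc. }
  assert (hW : decaying h).
  { apply decaying_minus.
    - replace (fun s => geom z1 s * LI (n :: ns) (z2 :: zt)) with (fun s => LI (n :: ns) (z2 :: zt) * geom z1 s)
        by (apply functional_extensionality; intros; ring).
      apply decaying_scal. now apply global_decay_decaying, geom_global_decay, off_ray_pole_free.
    - destruct (geom_global_decay z1 (off_ray_pole_free _ h1)) as [hfc [A hA]].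
      apply decaying_mult_bounded with (1 + A)%R.
      + refine (proj1 (LI_tail_iter 0 n ns (z1 * z2) zt hn _)). constructor; auto. now rewrite <- Cmult_assoc.
      + apply contC_plus; auto using contC_const.
      + intros s hs. eapply Rle_trans; [apply Cmod_triangle|]. rewrite Cmod_1. specialize (hA s).
        assert (h0 := exp_le (- (1 / 2) * s) 0 ltac:(lra)). rewrite exp_0 in h0.
        pose proof (exp_pos (- (1 / 2) * s)). pose proof (Cmod_ge_0 (geom z1 s)).
        apply Rplus_le_compat_l. eapply Rle_trans; [exact hA|].
        assert (0 <= A)%R by nra. nra. }
  split; auto. rewrite eh in hW |- *.
  rewrite translate_steps_tail_iter; auto.
  - rewrite Nat.add_0_r. unfold translate_steps. rewrite LI_cons. cbn [map suffix_prods combine steps fst snd].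
    change (step n (geom (z2 * Cprod zt))) with (step n (geom (z2 * Cprod zt))).
    unfold L. simpl Cprod. do 2 f_equal. apply functional_extensionality; intros s. f_equal. ring.
  - rewrite Rabs_R1; lra.
  - constructor; auto. exact (proj1 (kernel_geom _ (off_ray_pole_free _ h2))).
  - now apply off_ray_pole_free.
Qed.

Lemma domain_Cprod_inv d zs : domain d zs -> Cprod (map Cinv zs) = / Cprod zs /\ Cprod zs <> 0.
Proof. intros h. apply Cprod_inv, (domain_nonzero d zs h). Qed.

Lemma jonquiere_inv n Y s : off_ray Y ->
  Lis n (/ Y) s = - (- (1)) ^ n * (beta n (Y * RtoC (exp s)) + Lis n Y (- s)%R).
Proof.
  intros h. assert (J := jonquiere n Y (- s)%R h). rewrite !Ropp_involutive in J.
  replace (beta n (Y * RtoC (exp s))) with (- - beta n (Y * RtoC (exp s))) by ring.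
  rewrite <- J.
  replace (- (- (1)) ^ n * (- (Lis n Y (- s)%R + (- (1)) ^ n * Lis n (/ Y) s) + Lis n Y (- s)%R))
    with (((- (1)) ^ n * (- (1)) ^ n) * Lis n (/ Y) s) by ring.
  rewrite sign_sq. ring.
Qed.

Definition inv_kernels (ns : list nat) (zs : list C) : list (nat * (R -> C))%type :=
  combine ns (map geom (suffix_prods (map Cinv zs))).

Section ParityStep.
Variables (n1 m2 : nat) (ns : list nat) (z1 z2 : C) (zt : list C) (d : nat).
Hypothesis hdom : domain (S (S d)) (z1 :: z2 :: zt).
Let n2 := S m2.
Let Y2 := z2 * Cprod zt.
Let Y1 := z1 * Y2.
Let zm sigma := z1 * z2 * RtoC (exp (- sigma)) :: zt.

Lemma parity_inverse_part :
  decaying (fun sigma => geom z1 sigma *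
     (LI (n2 :: ns) (map Cinv (z2 :: zt)) - LI (n2 :: ns) (map Cinv (zm sigma)))) /\
  LI (n1 :: n2 :: ns) (map Cinv (z1 :: z2 :: zt)) =
    - (- (1)) ^ n1 * (steps (inv_kernels (n2 :: ns) (z2 :: zt)) (fun s => beta n1 (Y1 * RtoC (exp s))) 0%R +
      tail_iter n1 (fun sigma => geom z1 sigma *
        (LI (n2 :: ns) (map Cinv (z2 :: zt)) - LI (n2 :: ns) (map Cinv (zm sigma)))) 0%R).
Proof.
  assert (h1 : off_ray z1) by apply (domain_head _ _ _ hdom).
  assert (hd2 := domain_tail _ _ _ hdom). assert (hd3 := domain_tail _ _ _ hd2).
  assert (hY1 : off_ray Y1) by apply (domain_full _ _ _ hdom).
  assert (hY2 : off_ray Y2) by apply (domain_full _ _ _ hd2).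
  assert (hz2 := off_ray_nonzero _ (domain_head _ _ _ hd2)).
  assert (hz1 := off_ray_nonzero _ h1).
  destruct (domain_Cprod_inv _ _ hd3) as [ePi hP].
  set (L := inv_kernels ns zt).
  assert (hL : kernels L) by (apply suffix_prods_kernels, (domain_suffix_prods d), domain_inv, hd3).
  assert (eY2 : / z2 * / Cprod zt = / Y2) by (unfold Y2; field; auto).
  assert (eY1 : / z1 * (/ z2 * / Cprod zt) = / Y1) by (unfold Y1, Y2; field; auto).
  assert (el : inv_kernels (n2 :: ns) (z2 :: zt) = (n2, geom (/ Y2)) :: L).
  { unfold inv_kernels. cbn [map suffix_prods combine]. rewrite ePi, eY2. reflexivity. }
  assert (hl : kernels ((n2, geom (/ Y2)) :: L)).
  { constructor; auto. exact (proj1 (kernel_geom _ (off_ray_pole_free _ (off_ray_inv _ hY2)))). }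
  assert (he : (Rabs (-1) <= 1)%R) by (rewrite Rabs_left; lra).
  assert (eA : LI (n2 :: ns) (map Cinv (z2 :: zt)) = steps L (Lis n2 (/ Y2)) 0%R).
  { cbn [map]. rewrite LI_cons, ePi, eY2. reflexivity. }
  assert (eB : forall sigma, LI (n2 :: ns) (map Cinv (zm sigma)) = steps L (Lis n2 (/ (z1 * RtoC (exp (- sigma)) * Y2))) 0%R).
  { intros sigma. unfold zm. cbn [map]. rewrite LI_cons, ePi. f_equal. f_equal. unfold Y2.
    assert (hen := RtoC_exp_neq (- sigma)).
    field. auto. }
  assert (eR : (fun sigma => geom z1 sigma *
     (LI (n2 :: ns) (map Cinv (z2 :: zt)) - LI (n2 :: ns) (map Cinv (zm sigma))))
     = translate_steps (-1) ((n2, geom (/ Y2)) :: L) 0 Y1).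
  { apply functional_extensionality; intros sigma. unfold Y1. rewrite translate_steps_zero_inv; auto.
    now rewrite eA, eB. }
  assert (hW : decaying (translate_steps (-1) ((n2, geom (/ Y2)) :: L) 0 Y1)).
  { split; [|apply translate_steps_exp_decay; auto using off_ray_pole_free].
    rewrite <- eR. apply contC_mult; [apply (geom_global_decay z1), off_ray_pole_free, h1|].
    apply contC_plus; [apply contC_const|]. apply contC_opp.
    replace (fun sigma => LI (n2 :: ns) (map Cinv (zm sigma))) with (fun sigma => translate_steps 1 L n2 (/ Y1) (- sigma)%R).
    - apply (contC_comp (translate_steps 1 L n2 (/ Y1)) Ropp).
      + intros s. apply (ex_derive_continuous Ropp). auto_derive; auto.
      + apply translate_steps_decaying; auto using off_ray_pole_free, off_ray_inv. rewrite Rabs_R1; lra.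
    - apply functional_extensionality; intros sigma. rewrite eB. unfold translate_steps. f_equal.
      apply functional_extensionality; intros s.
      replace (- sigma + 1 * s)%R with (s + - sigma)%R by ring.
      rewrite Lis_shift by now apply off_ray_pole_free, off_ray_inv. f_equal.
      rewrite Ropp_involutive. unfold Y1.
      assert (hn2 := off_ray_nonzero _ hY2).
      assert (hexn := RtoC_exp_neq (- sigma)).
      replace (RtoC (exp sigma)) with (/ RtoC (exp (- sigma))).
      + field. auto.
      + rewrite <- RtoC_inv by (apply Rgt_not_eq, exp_pos). f_equal. rewrite exp_Ropp, Rinv_inv. auto. }
  rewrite eR. split; auto.
  rewrite (translate_steps_tail_iter (-1) _ Y1 he hl (off_ray_pole_free _ hY1) 0 n1 hW), Nat.add_0_r.
  rewrite el. cbn [map]. rewrite LI_cons. cbn [Cprod fold_right map].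
  fold (Cprod (map Cinv zt)). rewrite ePi, eY1.
  change (combine (n2 :: ns) (map geom (suffix_prods (/ z2 :: map Cinv zt)))) with (inv_kernels (n2 :: ns) (z2 :: zt)).
  rewrite el.
  destruct (translate_steps_moderate_le (-1) Y1 he (off_ray_pole_free _ hY1) n1) as [A [_ HA]]. destruct (HA 0%R) as [v1 _]. clear HA.
  assert (v2 : moderate (Lis n1 (/ Y1))) by (apply decaying_moderate, global_decay_decaying, Lis_global_decay, off_ray_pole_free, off_ray_inv, hY1).
  assert (ej : Lis n1 (/ Y1) = fun s => - (- (1)) ^ n1 * (beta n1 (Y1 * RtoC (exp s)) + Lis n1 Y1 (0 + -1 * s)%R)).
  { apply functional_extensionality; intros s. rewrite jonquiere_inv by auto. do 3 f_equal. ring. }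
  assert (v3 : moderate (fun s => beta n1 (Y1 * RtoC (exp s)))).
  { replace (fun s => beta n1 (Y1 * RtoC (exp s)))
      with (fun s => - (- (1)) ^ n1 * Lis n1 (/ Y1) s + - (1) * Lis n1 Y1 (0 + -1 * s)%R).
    - apply moderate_plus; now apply moderate_scal.
    - apply functional_extensionality; intros s. rewrite ej.
      replace (- (- (1)) ^ n1 * (- (- (1)) ^ n1 * (beta n1 (Y1 * RtoC (exp s)) + Lis n1 Y1 (0 + -1 * s)%R)) + - (1) * Lis n1 Y1 (0 + -1 * s)%R)
        with (((- (1)) ^ n1 * (- (1)) ^ n1) * (beta n1 (Y1 * RtoC (exp s)) + Lis n1 Y1 (0 + -1 * s)%R) - Lis n1 Y1 (0 + -1 * s)%R) by ring.
      rewrite sign_sq. ring. }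
  rewrite ej at 1. rewrite steps_scal, steps_plus; auto using moderate_plus.
Qed.

Lemma parity_step :
  decaying (fun sigma => geom z1 sigma * (PLI (n2 :: ns) (z2 :: zt) - PLI (n2 :: ns) (zm sigma))) /\
  PLI (n1 :: n2 :: ns) (z1 :: z2 :: zt) =
    - LI ((n1 + n2)%nat :: ns) (z1 * z2 :: zt)
    - parity_sign (n2 :: ns) *
        steps (inv_kernels (n2 :: ns) (z2 :: zt)) (fun s => beta n1 (Y1 * RtoC (exp s))) 0%R
    + tail_iter n1 (fun sigma => geom z1 sigma * (PLI (n2 :: ns) (z2 :: zt) - PLI (n2 :: ns) (zm sigma))) 0%R.
Proof.
  destruct parity_inverse_part as [wR eR].
  assert (h1 : off_ray z1) by apply (domain_head _ _ _ hdom).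
  assert (hn2 : (1 <= n2)%nat) by (unfold n2; lia).
  destruct (LI_first_variable n1 n2 ns z1 z2 zt hn2 h1 (domain_suffix_prods _ _ hdom)) as [wL eL].
  assert (hc12 : Forall off_ray (suffix_prods (z1 * z2 :: zt))).
  { apply (domain_suffix_prods (S d)). replace (z1 * z2) with (z1 * z2 * RtoC 1) by ring.
    apply domain_merge; auto; lra. }
  destruct (LI_tail_iter n1 n2 ns (z1 * z2) zt hn2 hc12) as [wB eB].
  set (B := fun sigma => LI (n2 :: ns) (z1 * z2 * RtoC (exp (- sigma)) :: zt)) in *.
  set (gL := fun sigma => geom z1 sigma * LI (n2 :: ns) (z2 :: zt) - (1 + geom z1 sigma) * LI (n2 :: ns) (z1 * z2 * RtoC (exp (- sigma)) :: zt)) in *.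
  set (gR := fun sigma => geom z1 sigma * (LI (n2 :: ns) (map Cinv (z2 :: zt)) - LI (n2 :: ns) (map Cinv (zm sigma)))) in *.
  set (ep := parity_sign (n2 :: ns)).
  assert (e : (fun sigma => geom z1 sigma * (PLI (n2 :: ns) (z2 :: zt) - PLI (n2 :: ns) (zm sigma)))
    = fun sigma => (gL sigma + - ep * gR sigma) + B sigma).
  { apply functional_extensionality; intros sigma. unfold gL, gR, B, PLI, zm. fold ep. ring. }
  rewrite e. split; [apply decaying_plus; auto; apply decaying_plus; auto using decaying_scal|].
  rewrite tail_iter_plus, tail_iter_plus, tail_iter_scal; auto using decaying_plus, decaying_scal.
  rewrite eL, eB. unfold PLI at 1. rewrite eR. fold gR. rewrite (parity_sign_cons n1). fold ep.
  set (E := steps _ _ _). rewrite Ropp_0, exp_0, Cmult_1_r.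
  set (LL := LI (n1 :: n2 :: ns) (z1 :: z2 :: zt)). set (LM := LI _ _). set (RR := tail_iter n1 gR 0%R).
  replace (LL - - (- (1)) ^ n1 * ep * (- (- (1)) ^ n1 * (E + RR)))
    with (LL - ((- (1)) ^ n1 * (- (1)) ^ n1) * ep * (E + RR)) by ring.
  rewrite sign_sq. ring.
Qed.
End ParityStep.

(** * Integration by parts against Bernoulli polynomials *)

Definition chain (e : Z) (p : nat -> R -> C) : Prop :=
  (Rabs (IZR e) <= 1)%R /\ (forall s, p O s = 1) /\
  forall k s, derC (p (S k)) s (RtoC (IZR e) * p k s).

Lemma chain_contC e p k : chain e p -> contC (p k).
Proof.
  intros [_ [h0 h]]. destruct k; [|eapply derC_cont; apply h].
  replace (p O) with (fun _ : R => RtoC 1) by (apply functional_extensionality; auto). apply contC_const.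
Qed.

Lemma derive_growth (f df : R -> R) (A c : R) : (0 < c)%R -> (0 <= A)%R ->
  (forall s, is_derive f s (df s)) -> (forall s, (0 <= s)%R -> (Rabs (df s) <= A * exp (c / 2 * s))%R) ->
  forall s, (0 <= s)%R -> (Rabs (f s) <= (Rabs (f 0) + A * (2 / c)) * exp (c * s))%R.
Proof.
  intros hc hA hd hb s hs.
  destruct (MVT_gen f 0 s df) as [x [hx ex]].
  { intros; apply hd. }
  { intros. apply continuity_pt_filterlim.
    apply (ex_derive_continuous (K := R_AbsRing) (V := R_NormedModule)). eexists; apply hd. }
  rewrite Rmin_left, Rmax_right in hx by auto.
  assert (h1 := hb x ltac:(lra)).
  assert (h2 : (exp (c / 2 * x) <= exp (c / 2 * s))%R) by (apply exp_le; nra).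
  assert (h3 : (s <= 2 / c * exp (c / 2 * s))%R).
  { assert (h := exp_ineq1_le (c / 2 * s)).
    apply Rle_trans with (2 / c * (c / 2 * s))%R; [right; field; lra|].
    apply Rmult_le_compat_l; [|lra]. apply Rmult_le_pos; [lra|left; now apply Rinv_0_lt_compat]. }
  assert (hE : exp (c * s) = (exp (c / 2 * s) * exp (c / 2 * s))%R) by (rewrite <- exp_plus; f_equal; field).
  assert (hE1 : (1 <= exp (c * s))%R) by (rewrite <- exp_0; apply exp_le; nra).
  replace (f s) with (f 0 + df x * (s - 0))%R by lra.
  eapply Rle_trans; [apply Rabs_triang|]. rewrite Rabs_mult, Rminus_0_r, (Rabs_pos_eq s) by auto.
  pose proof (Rabs_pos (f 0)). pose proof (exp_pos (c / 2 * s)).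
  rewrite Rmult_plus_distr_r. apply Rplus_le_compat; [nra|].
  apply Rle_trans with ((A * exp (c / 2 * s)) * (2 / c * exp (c / 2 * s)))%R; [|rewrite hE; right; ring].
  apply Rmult_le_compat; auto using Rabs_pos. eapply Rle_trans; [exact h1|]. now apply Rmult_le_compat_l.
Qed.

Lemma chain_growth e p : chain e p -> forall k c, (0 < c)%R -> exists A, (0 <= A)%R /\
  forall s, (0 <= s)%R -> (Cmod (p k s) <= A * exp (c * s))%R.
Proof.
  intros [he [h0 h]] k. induction k as [|k IH]; intros c hc.
  - exists 1%R. split; [lra|]. intros s hs. rewrite h0, Cmod_1.
    assert (hx := exp_le 0 (c * s) ltac:(nra)). rewrite exp_0 in hx. lra.
  - destruct (IH (c / 2)%R ltac:(lra)) as [A [hA HA]].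
    assert (hb : forall s, (0 <= s)%R -> (Cmod (RtoC (IZR e) * p k s) <= A * exp (c / 2 * s))%R).
    { intros s hs. rewrite Cmod_mult, Cmod_R. specialize (HA s hs). pose proof (Cmod_ge_0 (p k s)). nra. }
    assert (g1 := derive_growth (fun t => Re (p (S k) t)) (fun t => Re (RtoC (IZR e) * p k t)) A c hc hA
      (fun s => proj1 (h k s)) (fun s hs => Rle_trans _ _ _ (Re_le_Cmod _) (hb s hs))).
    assert (g2 := derive_growth (fun t => Im (p (S k) t)) (fun t => Im (RtoC (IZR e) * p k t)) A c hc hA
      (fun s => proj2 (h k s)) (fun s hs => Rle_trans _ _ _ (Im_le_Cmod _) (hb s hs))).
    exists ((Rabs (Re (p (S k) 0%R)) + A * (2 / c)) + (Rabs (Im (p (S k) 0%R)) + A * (2 / c)))%R.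
    assert (0 <= A * (2 / c))%R.
    { apply Rmult_le_pos; auto. apply Rmult_le_pos; [lra|left; now apply Rinv_0_lt_compat]. }
    split; [pose proof (Rabs_pos (Re (p (S k) 0%R))); pose proof (Rabs_pos (Im (p (S k) 0%R))); lra|].
    intros s hs. eapply Rle_trans; [apply Cmod_le_Re_Im|].
    specialize (g1 s hs). specialize (g2 s hs). lra.
Qed.

Lemma chain_decaying e p k h : chain e p -> decaying h -> decaying (fun s => p k s * h s).
Proof.
  intros hp [hc [B [c [c0 hB]]]].
  destruct (chain_growth e p hp k (c / 2)%R ltac:(lra)) as [A [hA HA]].
  split; [apply contC_mult; auto; apply (chain_contC e p k hp)|].
  exists (A * B)%R, (c / 2)%R. split; [lra|]. intros s hs. rewrite Cmod_mult.
  replace (A * B * exp (- (c / 2) * s))%R with ((A * exp (c / 2 * s)) * (B * exp (- c * s)))%R.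
  - apply Rmult_le_compat; auto using Cmod_ge_0.
  - replace (- (c / 2) * s)%R with (c / 2 * s + - c * s)%R by field. rewrite exp_plus. ring.
Qed.

Definition bounded (h : R -> C) : Prop :=
  contC h /\ exists A, forall s, (0 <= s)%R -> (Cmod (h s) <= A)%R.
Lemma bounded_moderate h : bounded h -> moderate h.
Proof. intros [hc [A hA]]. now apply moderate_bounded with A. Qed.

Lemma decaying_is_bounded h : decaying h -> bounded h.
Proof.
  intros [hc [A [c [c0 hA]]]]. split; auto. exists (Rabs A). intros s hs.
  eapply Rle_trans; [apply hA, hs|].
  assert (hx := exp_le (- c * s) 0 ltac:(nra)). rewrite exp_0 in hx.
  pose proof (exp_pos (- c * s)). pose proof (Rle_abs A). pose proof (Rabs_pos A). nra.
Qed.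

Lemma chain_moderate e p k h : chain e p -> bounded h -> moderate (fun s => p k s * h s).
Proof.
  intros hp [hc [B hB]].
  destruct (chain_growth e p hp k (1 / 2)%R ltac:(lra)) as [A [hA HA]].
  split; [apply contC_mult; auto; apply (chain_contC e p k hp)|].
  exists (A * B)%R. intros s hs. rewrite Cmod_mult.
  replace (A * B * exp (s / 2))%R with ((A * exp (1 / 2 * s)) * B)%R.
  - apply Rmult_le_compat; auto using Cmod_ge_0.
  - replace (s / 2)%R with (1 / 2 * s)%R by field. ring.
Qed.

Lemma tail_chain_0 e p h : chain e p -> decaying h -> tail (fun s => p O s * h s) = tail h.
Proof.
  intros [_ [h0 _]] _. f_equal. apply functional_extensionality; intros s. rewrite h0; ring.
Qed.

Lemma tail_chain_S e p k h : chain e p -> decaying h ->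
  tail (fun s => p (S k) s * h s) = fun s => p (S k) s * tail h s + RtoC (IZR e) * tail (fun s => p k s * tail h s) s.
Proof.
  intros hp hW. symmetry.
  assert (hI := tail_decaying h hW).
  apply tail_unique.
  - now apply (chain_decaying e).
  - intros s. eapply derC_eq.
    + apply derC_plus.
      * apply derC_mult; [apply hp|now apply tail_derC].
      * apply derC_scal, tail_derC. now apply (chain_decaying e).
    + cbv beta. ring.
  - apply decaying_exp_decay, decaying_plus; [now apply (chain_decaying e)|].
    apply decaying_scal, tail_decaying. now apply (chain_decaying e).
Qed.

Lemma Csum_flat_map {T U} (f : U -> C) (g : T -> list U) l :
  Csum (map f (flat_map g l)) = Csum (map (fun x => Csum (map f (g x))) l).
Proof. induction l; simpl; auto. now rewrite map_app, Csum_app, IHl. Qed.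

Lemma Csum_map_ext {T} (f g : T -> C) l : (forall x, In x l -> f x = g x) -> Csum (map f l) = Csum (map g l).
Proof. intros h. f_equal. now apply map_ext_in. Qed.

Lemma tail_Csum {T} (h : T -> R -> C) l : (forall x, In x l -> decaying (h x)) ->
  tail (fun s => Csum (map (fun x => h x s) l)) = fun s => Csum (map (fun x => tail (h x) s) l).
Proof. exact (tail_iter_Csum 1 h l). Qed.

Local Notation ZtoC c := (RtoC (IZR c)).

Lemma tail_chain_expand e k : exists l : list (Z * nat)%type, Forall (fun q => (snd q <= k)%nat) l /\
  forall p h s, chain e p -> decaying h ->
    tail (fun s => p k s * h s) s = Csum (map (fun q => ZtoC (fst q) * p (k - snd q)%nat s * tail_iter (S (snd q)) h s) l).
Proof.
  induction k as [|k [l [hl IH]]].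
  - exists [(1%Z, O)]. split; [repeat constructor|]. intros p h s hp hW.
    rewrite (tail_chain_0 e) by auto. simpl. rewrite (proj1 (proj2 hp)). unfold tail_iter; simpl. ring.
  - exists ((1%Z, O) :: map (fun q => ((e * fst q)%Z, S (snd q))) l). split.
    + constructor; [simpl; lia|]. rewrite Forall_map. eapply Forall_impl; [|exact hl].
      simpl. intros; lia.
    + intros p h s hp hW. rewrite (tail_chain_S e) by auto.
      rewrite (IH p (tail h) s hp (tail_decaying h hW)).
      cbn [map Csum fold_right fst snd]. rewrite map_map. fold Csum.
      rewrite <- Csum_scal. f_equal.
      * unfold tail_iter; simpl. ring.
      * change (fold_right Cplus 0 ?x) with (Csum x). apply Csum_map_ext.
        intros [c a] hq. cbn [fst snd]. rewrite mult_IZR, RtoC_mult.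
        rewrite (tail_iter_S_r (S a)). simpl Nat.sub. ring.
Qed.

Lemma tail_iter_chain_expand e n k : exists l : list (Z * nat)%type, Forall (fun q => (snd q <= k)%nat) l /\
  forall p h s, chain e p -> decaying h ->
    tail_iter n (fun s => p k s * h s) s = Csum (map (fun q => ZtoC (fst q) * p (k - snd q)%nat s * tail_iter (n + snd q) h s) l).
Proof.
  revert k. induction n as [|n IH]; intros k.
  - exists [(1%Z, O)]. split; [repeat constructor; simpl; lia|]. intros p h s hp hW.
    simpl. rewrite Nat.sub_0_r. unfold tail_iter; simpl. ring.
  - destruct (IH k) as [l [hl Hl]].
    assert (hex : forall j, exists l : list (Z * nat)%type, Forall (fun q => (snd q <= j)%nat) l /\
      forall p h s, chain e p -> decaying h ->
      tail (fun s => p j s * h s) s = Csum (map (fun q => ZtoC (fst q) * p (j - snd q)%nat s * tail_iter (S (snd q)) h s) l))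
      by (intros; apply tail_chain_expand).
    set (g := fun j => proj1_sig (constructive_indefinite_description _ (hex j))).
    assert (hg : forall j, Forall (fun q => (snd q <= j)%nat) (g j) /\
      forall p h s, chain e p -> decaying h ->
      tail (fun s => p j s * h s) s = Csum (map (fun q => ZtoC (fst q) * p (j - snd q)%nat s * tail_iter (S (snd q)) h s) (g j)))
      by (intros j; apply (proj2_sig (constructive_indefinite_description _ (hex j)))).
    exists (flat_map (fun q => map (fun q' => ((fst q * fst q')%Z, (snd q + snd q')%nat)) (g (k - snd q)%nat)) l).
    split.
    + apply Forall_flat_map. eapply Forall_impl; [|exact hl]. intros [c a] ha. cbn [fst snd] in *.
      rewrite Forall_map. eapply Forall_impl; [|apply hg]. intros [c' a'] ha'. cbn [fst snd] in *. lia.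
    + intros p h s hp hW. rewrite tail_iter_S.
      replace (tail_iter n (fun s => p k s * h s)) with
        (fun s => Csum (map (fun q => ZtoC (fst q) * (p (k - snd q)%nat s * tail_iter (n + snd q) h s)) l)).
      2: { apply functional_extensionality; intros u. rewrite (Hl p h u hp hW). apply Csum_map_ext. intros; ring. }
      rewrite (tail_Csum (fun q s => ZtoC (fst q) * (p (k - snd q)%nat s * tail_iter (n + snd q) h s)) l).
      2: { intros q hq. apply decaying_scal, (chain_decaying e); auto. now apply tail_iter_decaying. }
      rewrite Csum_flat_map. apply Csum_map_ext. intros [c a] hq. cbn [fst snd].
      rewrite tail_scal by (apply (chain_decaying e); auto; now apply tail_iter_decaying).
      rewrite (proj2 (hg (k - a)%nat) p _ s hp (tail_iter_decaying _ _ hW)).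
      rewrite map_map, <- Csum_scal. apply Csum_map_ext. intros [c' a'] _. cbn [fst snd].
      rewrite mult_IZR, RtoC_mult, <- tail_iter_add.
      replace (S a' + (n + a))%nat with (S n + (a + a'))%nat by lia.
      replace (k - a - a')%nat with (k - (a + a'))%nat by lia. ring.
Qed.

Lemma steps_chain_expand e ns : forall k, exists l : list (Z * (nat * list nat))%type,
  Forall (fun q => Forall2 le ns (snd (snd q)) /\
    (fst (snd q) + list_sum (snd (snd q)) = k + list_sum ns)%nat) l /\
  forall Ys p h, length Ys = length ns -> Forall pole_free Ys -> chain e p -> bounded h ->
    steps (combine ns (map geom Ys)) (fun s => p k s * h s) =
    fun s => Csum (map (fun q => ZtoC (fst q) * (p (fst (snd q)) s * steps (combine (snd (snd q)) (map geom Ys)) h s)) l).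
Proof.
  induction ns as [|n ns IH]; intros k.
  - exists [(1%Z, (k, []))]. split; [repeat constructor|].
    intros Ys p h hl _ hp hb. apply functional_extensionality; intros s. simpl. ring.
  - destruct (tail_iter_chain_expand e n k) as [l1 [hl1 H1]].
    set (g := fun j => proj1_sig (constructive_indefinite_description _ (IH j))).
    assert (hg := fun j => proj2_sig (constructive_indefinite_description _ (IH j))).
    fold g in hg. change (forall j, Forall (fun q => Forall2 le ns (snd (snd q)) /\
      (fst (snd q) + list_sum (snd (snd q)) = j + list_sum ns)%nat) (g j) /\
      forall Ys p h, length Ys = length ns -> Forall pole_free Ys -> chain e p -> bounded h ->
      steps (combine ns (map geom Ys)) (fun s => p j s * h s) =
      fun s => Csum (map (fun q => ZtoC (fst q) * (p (fst (snd q)) s * steps (combine (snd (snd q)) (map geom Ys)) h s)) (g j))) in hg.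
    exists (flat_map (fun q => map (fun q' => ((fst q * fst q')%Z, (fst (snd q'), (n + snd q)%nat :: snd (snd q')))) (g (k - snd q)%nat)) l1).
    split.
    + apply Forall_flat_map. eapply Forall_impl; [|exact hl1]. intros [c a] ha. cbn [fst snd] in *.
      rewrite Forall_map. eapply Forall_impl; [|apply hg]. intros [c' [j ms]] [h1 h2]. cbn [fst snd] in *.
      split; [constructor; auto; lia|]. simpl. lia.
    + intros [|Y Ys] p h hl hok hp hb; [discriminate|]. injection hl as hl. inversion hok as [|? ? hY hYs]; subst.
      assert (hK := proj1 (kernel_geom Y hY)).
      assert (hKs : kernels (combine ns (map geom Ys))).
      { apply kernels_combine. rewrite Forall_map. eapply Forall_impl; [|exact hYs].
        intros Z hZ. exact (proj1 (kernel_geom Z hZ)). }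
      assert (hW : decaying (fun s => geom Y s * h s)) by (apply kernel_mul_decaying; auto using bounded_moderate).
      cbn [map combine steps fst snd]. unfold step at 1.
      replace (fun s => geom Y s * (p k s * h s)) with (fun s => p k s * (geom Y s * h s))
        by (apply functional_extensionality; intros; ring).
      replace (tail_iter n (fun s => p k s * (geom Y s * h s))) with
        (fun s => Csum (map (fun q => ZtoC (fst q) * (p (k - snd q)%nat s * step (n + snd q) (geom Y) h s)) l1)).
      2: { apply functional_extensionality; intros u.
           rewrite (H1 p (fun s => geom Y s * h s) u hp hW). apply Csum_map_ext. intros; unfold step; ring. }
      assert (hbd : forall a, bounded (step (n + a) (geom Y) h)).
      { intros a. apply decaying_is_bounded, step_decaying; auto using bounded_moderate. }
      rewrite steps_Csum; auto.
      2: { intros q _. apply moderate_scal, (chain_moderate e); auto. }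
      apply functional_extensionality; intros s.
      rewrite Csum_flat_map. apply Csum_map_ext. intros [c a] _. cbn [fst snd].
      rewrite steps_scal; auto; [|now apply (chain_moderate e)].
      rewrite (proj2 (hg (k - a)%nat) Ys p _ hl hYs hp (hbd a)).
      rewrite map_map, <- Csum_scal. apply Csum_map_ext. intros [c' [j ms]] _.
      cbn [fst snd combine steps]. rewrite mult_IZR, RtoC_mult. ring.
Qed.

Lemma beta_chain_decr (Y : C) : Y <> 0 -> chain (-1) (fun k s => beta k (Y * RtoC (exp (- s)))).
Proof.
  intros hY. split; [rewrite Rabs_left; lra|]. split.
  - intros s. rewrite beta_beta_log. apply beta_log_0.
  - intros k s. eapply derC_eq; [apply (beta_derC (S k) Y s hY)|].
    cbv beta. apply C_eq; simpl; ring.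
Qed.

Lemma beta_chain_incr (Y : C) : Y <> 0 -> chain 1 (fun k s => beta k (Y * RtoC (exp s))).
Proof.
  intros hY. split; [rewrite Rabs_R1; lra|]. split.
  - intros s. rewrite beta_beta_log. apply beta_log_0.
  - intros k s.
    replace (fun s => beta (S k) (Y * RtoC (exp s))) with (fun s => (fun s => beta (S k) (Y * RtoC (exp (- s)))) (- s)%R)
      by (apply functional_extensionality; intros; now rewrite Ropp_involutive).
    eapply derC_eq.
    + apply (derC_comp (fun s => beta (S k) (Y * RtoC (exp (- s)))) Ropp s (- beta k (Y * RtoC (exp (- - s)))) (-1)).
      * apply (beta_derC (S k) Y (- s)%R hY).
      * auto_derive; auto; ring.
    + rewrite Ropp_involutive. apply C_eq; simpl; ring.
Qed.

(** * Combinations of generators *)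

Fixpoint contiguous (l : list entry) : Prop :=
  match l with
  | e :: l' => match l' with [] => True | e' :: _ => left_end e' = S (right_end e) end /\ contiguous l'
  | [] => True
  end.
Definition arg (z : list C) (e : entry) : C := zprod z (left_end e) (right_end e).
Definition shift (e : entry) : entry := Entry (index e) (S (left_end e)) (S (right_end e)).

Lemma zprod_cat z i j k : (1 <= i <= j)%nat -> (j < k)%nat ->
  zprod z i j * zprod z (S j) k = zprod z i k.
Proof.
  intros h1 h2. unfold zprod.
  assert (hC : forall l1 l2, Cprod (l1 ++ l2) = Cprod l1 * Cprod l2).
  { induction l1; simpl; intros; [ring|]. rewrite IHl1; ring. }
  rewrite <- hC. f_equal.
  replace (S j - 1)%nat with ((j - i + 1) + (i - 1))%nat by lia.
  rewrite <- skipn_skipn. set (l := skipn (i - 1) z).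
  replace (k - i + 1)%nat with ((j - i + 1) + (k - S j + 1))%nat by lia.
  rewrite <- (firstn_skipn (j - i + 1) l) at 3.
  set (m := (j - i + 1)%nat).
  destruct (Nat.le_gt_cases m (length l)) as [hm|hm].
  - rewrite firstn_app, firstn_firstn, length_firstn.
    replace (Nat.min (m + (k - S j + 1)) m) with m by lia.
    replace (m + (k - S j + 1) - Nat.min m (length l))%nat with (k - S j + 1)%nat by lia. reflexivity.
  - rewrite skipn_all2 by lia. rewrite firstn_nil, !app_nil_r, firstn_firstn.
    rewrite !firstn_all2 by lia. reflexivity.
Qed.

Lemma increasing_bounds lo d l : increasing_in lo d l ->
  Forall (fun e => (lo < left_end e <= right_end e)%nat /\ (right_end e <= d)%nat) l.
Proof.
  revert lo; induction l as [|e l IH]; intros lo h; constructor.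
  - destruct h as [h1 [h2 _]]. auto.
  - destruct h as [h1 [h2 h3]]. eapply Forall_impl; [|apply (IH _ h3)]. cbv beta. intros; lia.
Qed.

Lemma increasing_mono lo lo' d l : (lo' <= lo)%nat -> increasing_in lo d l -> increasing_in lo' d l.
Proof. intros h; destruct l; auto. intros [h1 [h2 h3]]. repeat split; auto; lia. Qed.

Lemma increasing_shift lo d l : increasing_in lo d l -> increasing_in (S lo) (S d) (map shift l).
Proof.
  revert lo; induction l as [|e l IH]; intros lo; simpl; auto.
  intros [h1 [h2 h3]]. split; [lia|split; [lia|auto]].
Qed.

Lemma increasing_app lo d l1 l2 : increasing_in lo d (l1 ++ l2) ->
  increasing_in lo d l1 /\ increasing_in lo d l2.
Proof.
  revert lo; induction l1 as [|e l IH]; intros lo; simpl; auto.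
  intros [h1 [h2 h3]]. destruct (IH _ h3) as [h4 h5].
  split; [auto|]. eapply increasing_mono; [|exact h5]. lia.
Qed.

Lemma contiguous_Cprod z e l lo d : contiguous (e :: l) -> increasing_in lo d (e :: l) ->
  exists j, (right_end e <= j <= d)%nat /\ Cprod (map (arg z) (e :: l)) = zprod z (left_end e) j.
Proof.
  revert e lo; induction l as [|e' l IH]; intros e lo [hc1 hc2] [h1 [h2 h3]].
  - exists (right_end e). split; [lia|]. simpl. unfold arg. ring.
  - destruct (IH e' _ hc2 h3) as [j [hj e1]]. exists j.
    assert (h3' := proj1 h3). split; [lia|].
    change (Cprod (map (arg z) (e :: e' :: l))) with (arg z e * Cprod (map (arg z) (e' :: l))).
    rewrite e1, hc1. unfold arg. apply zprod_cat; lia.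
Qed.

Lemma contiguous_off_ray z l lo d : domain d z -> contiguous l -> increasing_in lo d l ->
  Forall off_ray (suffix_prods (map (arg z) l)).
Proof.
  intros hz. revert lo; induction l as [|e l IH]; intros lo hc hi; [constructor|].
  change (Forall off_ray (Cprod (map (arg z) (e :: l)) :: suffix_prods (map (arg z) l))). constructor.
  - destruct (contiguous_Cprod z e l lo d hc hi) as [j [hj ->]].
    destruct hi as [h1 [h2 _]]. apply (domain_zprod d); auto; lia.
  - apply (IH (right_end e)); [apply hc|apply hi].
Qed.

Definition Lval (z : list C) (l : list entry) : C := Li (map index l) (map (arg z) l).
Lemma Lval_LI z l lo d : domain d z -> contiguous l -> increasing_in lo d l ->
  Lval z l = LI (map index l) (map (arg z) l).
Proof.
  intros h1 h2 h3. unfold Lval. apply Li_eq_LI; [now rewrite !length_map|].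
  now apply (contiguous_off_ray z l lo d).
Qed.

Fixpoint bprod (k : list nat) (z : list C) : C :=
  match k, z with
  | k1 :: k', z1 :: z' => beta k1 (Cprod z) * bprod k' z'
  | _, _ => 1
  end.

Lemma generator_eq d k b z : length k = d -> length z = d ->
  generator d k b z = bprod k z * Cprod (map (Lval z) b).
Proof.
  intros hk hz. unfold generator. f_equal. revert k z hk hz. induction d as [|d IH]; intros k z hk hz.
  - destruct k; [reflexivity|discriminate].
  - destruct k as [|k1 k]; [discriminate|]. destruct z as [|z1 z]; [discriminate|].
    injection hk as hk. injection hz as hz.
    change (seq 1 (S d)) with (1%nat :: seq 2 d). rewrite <- seq_shift. cbn [map Cprod fold_right bprod].
    f_equal.
    + f_equal. rewrite <- hz. apply zprod_full.
    + rewrite <- (IH k z hk hz). change (fold_right Cmult 1 ?x) with (Cprod x). rewrite map_map. f_equal.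
      apply map_ext_in. intros i hi. apply in_seq in hi. rewrite zprod_cons_S by lia.
      f_equal. destruct i; [lia|]. simpl. now rewrite Nat.sub_0_r.
Qed.

Lemma arg_shift z1 z e : (1 <= left_end e)%nat -> arg (z1 :: z) (shift e) = arg z e.
Proof. intros h. unfold arg, shift. simpl. now rewrite zprod_cons_S. Qed.

Lemma map_arg_shift z1 z l lo d : increasing_in lo d l -> map (arg (z1 :: z)) (map shift l) = map (arg z) l.
Proof.
  intros h. rewrite map_map. apply map_ext_in. intros e he. apply arg_shift.
  assert (hb := increasing_bounds _ _ _ h). rewrite Forall_forall in hb. specialize (hb e he). lia.
Qed.

Lemma map_index_shift l : map index (map shift l) = map index l.
Proof. rewrite map_map. reflexivity. Qed.

Lemma Lval_shift z1 z l lo d : increasing_in lo d l -> Lval (z1 :: z) (map shift l) = Lval z l.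
Proof. intros h. unfold Lval. now rewrite (map_arg_shift z1 z l lo d h), map_index_shift. Qed.

Lemma Lval_tail x y z l d : increasing_in 1 d l -> Lval (x :: z) l = Lval (y :: z) l.
Proof.
  intros h. unfold Lval. f_equal. apply map_ext_in. intros e he.
  assert (hb := increasing_bounds _ _ _ h). rewrite Forall_forall in hb. specialize (hb e he).
  unfold arg. destruct (left_end e) as [|[|i]]; [lia|lia|]. destruct (right_end e) as [|j]; [lia|].
  now rewrite !zprod_cons_S by lia.
Qed.

Lemma contiguous_shift l : contiguous l -> contiguous (map shift l).
Proof.
  induction l as [|e l IH]; simpl; auto. intros [h1 h2]. split; auto.
  destruct l; simpl in *; auto.
Qed.

Lemma increasing_concat lo d b : increasing_in lo d (concat b) -> Forall (increasing_in lo d) b.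
Proof.
  induction b as [|l b IH]; simpl; intros h; constructor.
  - apply (increasing_app _ _ _ _ h).
  - apply IH, (increasing_app _ _ _ _ h).
Qed.

Lemma Cprod_Lval_shift z1 z b lo d : increasing_in lo d (concat b) ->
  Cprod (map (Lval (z1 :: z)) (map (map shift) b)) = Cprod (map (Lval z) b).
Proof.
  intros h. apply increasing_concat in h. f_equal. rewrite map_map. apply map_ext_in. intros l hl.
  rewrite Forall_forall in h. now apply (Lval_shift _ _ _ lo d), h.
Qed.

Lemma Cprod_Lval_tail x y z b d : increasing_in 1 d (concat b) ->
  Cprod (map (Lval (x :: z)) b) = Cprod (map (Lval (y :: z)) b).
Proof.
  intros h. apply increasing_concat in h. f_equal. apply map_ext_in. intros l hl.
  rewrite Forall_forall in h. now apply (Lval_tail _ _ _ _ d), h.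
Qed.

(* Generators in which the arguments within each factor are consecutive products, so that
   the factor is well defined on the whole domain. *)
Definition good_generator (D w d : nat) (k : list nat) (b : list (list entry)) : Prop :=
  admissible D w d k b /\ Forall contiguous b.
Definition combination : Type := list (Z * (list nat * list (list entry)))%type.
Definition comb_value (d : nat) (l : combination) (z : list C) : C :=
  Csum (map (fun q => ZtoC (fst q) * generator d (fst (snd q)) (snd (snd q)) z) l).
Definition good_generators (D w d : nat) (l : combination) : Prop :=
  Forall (fun q => good_generator D w d (fst (snd q)) (snd (snd q))) l.
Definition Zspan (D w d : nat) (f : list C -> C) : Prop :=
  exists l, good_generators D w d l /\ forall z, domain d z -> f z = comb_value d l z.

Lemma Zspan_Lspace D w d f : Zspan D w d f -> Lspace D w d f.
Proof.
  intros [l [hl hf]].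
  exists (map (fun q => (fst q, generator d (fst (snd q)) (snd (snd q)))) l). split.
  - rewrite Forall_map. eapply Forall_impl; [|exact hl]. intros [c [k b]] [h _].
    exists k, b. split; auto.
  - intros z hz. rewrite (hf z hz), map_map. reflexivity.
Qed.

Lemma Zspan_ext D w d f g : (forall z, domain d z -> f z = g z) -> Zspan D w d f -> Zspan D w d g.
Proof. intros h [l [h1 h2]]. exists l. split; auto. intros z hz. rewrite <- h; auto. Qed.

Lemma Zspan_plus D w d f g : Zspan D w d f -> Zspan D w d g -> Zspan D w d (fun z => f z + g z).
Proof.
  intros [l [h1 h2]] [l' [h1' h2']]. exists (l ++ l'). split; [now apply Forall_app|].
  intros z hz. rewrite h2, h2' by auto. unfold comb_value. now rewrite map_app, Csum_app.
Qed.

Lemma Zspan_scal D w d c f : Zspan D w d f -> Zspan D w d (fun z => ZtoC c * f z).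
Proof.
  intros [l [h1 h2]]. exists (map (fun q => ((c * fst q)%Z, snd q)) l). split.
  - unfold good_generators. rewrite Forall_map. exact h1.
  - intros z hz. rewrite h2 by auto. unfold comb_value. rewrite map_map, <- Csum_scal.
    apply Csum_map_ext. intros q _. cbn [fst snd]. rewrite mult_IZR, RtoC_mult. ring.
Qed.

Lemma Zspan_zero D w d : Zspan D w d (fun _ => 0).
Proof. exists []. split; [constructor|]. reflexivity. Qed.

Lemma Zspan_Csum {T} D w d (f : T -> list C -> C) l : (forall x, In x l -> Zspan D w d (f x)) ->
  Zspan D w d (fun z => Csum (map (fun x => f x z) l)).
Proof.
  induction l; simpl; intros h; [apply Zspan_zero|]. apply Zspan_plus; auto.
Qed.

Lemma Zspan_gen D w d k b : good_generator D w d k b -> Zspan D w d (generator d k b).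
Proof.
  intros h. exists [(1%Z, (k, b))]. split; [repeat constructor; apply h|].
  intros z _. unfold comb_value. simpl. ring.
Qed.

Lemma good_generator_depth D D' w d k b : (D <= D')%nat -> good_generator D w d k b -> good_generator D' w d k b.
Proof.
  intros h [[h1 [h2 [h3 [h4 [h5 h6]]]]] h7]. repeat split; auto. lia.
Qed.

Lemma Zspan_depth D D' w d f : (D <= D')%nat -> Zspan D w d f -> Zspan D' w d f.
Proof.
  intros h [l [h1 h2]]. exists l. split; auto. eapply Forall_impl; [|exact h1].
  intros q. now apply good_generator_depth.
Qed.

Lemma Forall_nonempty_shift b : Forall (fun l : list entry => l <> []) b ->
  Forall (fun l : list entry => l <> []) (map (map shift) b).
Proof. intros h. rewrite Forall_map. eapply Forall_impl; [|exact h]. intros [|e l]; simpl; congruence. Qed.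

Lemma Forall_index_shift l : Forall (fun e => (1 <= index e)%nat) l -> Forall (fun e => (1 <= index e)%nat) (map shift l).
Proof. intros h. rewrite Forall_map. exact h. Qed.

Lemma Forall_contiguous_shift b : Forall contiguous b -> Forall contiguous (map (map shift) b).
Proof. intros h. rewrite Forall_map. eapply Forall_impl; [|exact h]. apply contiguous_shift. Qed.

Lemma good_generator_cons_beta D w d j k b : good_generator D w d k b -> good_generator D (w + j) (S d) (j :: k) (map (map shift) b).
Proof.
  intros [[h1 [h2 [h3 [h4 [h5 h6]]]]] h7]. split; [|now apply Forall_contiguous_shift].
  split; [simpl; lia|]. rewrite <- concat_map.
  split; [now apply Forall_nonempty_shift|]. split; [now apply Forall_index_shift|].
  split; [apply (increasing_mono 1); [lia|now apply increasing_shift]|].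
  split; [now rewrite length_map|]. rewrite map_index_shift. simpl. lia.
Qed.

Lemma Zspan_cons_beta D w d j f : Zspan D w d f ->
  Zspan D (w + j) (S d) (fun z => beta j (Cprod z) * f (tl z)).
Proof.
  intros [l [h1 h2]].
  exists (map (fun q => (fst q, (j :: fst (snd q), map (map shift) (snd (snd q))))) l). split.
  - unfold good_generators. rewrite Forall_map. eapply Forall_impl; [|exact h1]. intros [c [k b]]. apply good_generator_cons_beta.
  - intros [|z1 z] hz; [destruct hz; discriminate|]. cbn [tl].
    rewrite (h2 z (domain_tail _ _ _ hz)). unfold comb_value. rewrite map_map, <- Csum_scal.
    apply Csum_map_ext. intros [c [k b]] hq. cbn [fst snd].
    unfold good_generators in h1. rewrite Forall_forall in h1. specialize (h1 _ hq). cbn [fst snd] in h1.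
    destruct h1 as [[e1 [_ [_ [e4 _]]]] _]. assert (hl := proj1 hz). simpl in hl.
    rewrite !generator_eq by (simpl; lia). cbn [bprod].
    rewrite (Cprod_Lval_shift z1 z b 0 d e4). ring.
Qed.

Lemma beta_0 z : beta 0 z = 1.
Proof. rewrite beta_beta_log. apply beta_log_0. Qed.

Lemma bprod_zero d z : bprod (repeat O d) z = 1.
Proof.
  revert z; induction d; intros [|z1 z]; simpl; auto. rewrite beta_0, IHd. ring.
Qed.

Lemma list_sum_zero d : list_sum (repeat O d) = O.
Proof. induction d; simpl; auto. Qed.

Lemma Zspan_single D w d l : contiguous l -> l <> [] -> increasing_in 0 d l ->
  Forall (fun e => (1 <= index e)%nat) l -> (length l <= D)%nat -> list_sum (map index l) = w ->
  Zspan D w d (fun z => LI (map index l) (map (arg z) l)).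
Proof.
  intros hc hn hi hx hD hw.
  eapply Zspan_ext; [|apply (Zspan_gen D w d (repeat O d) [l])].
  - intros z hz. rewrite generator_eq by (try apply repeat_length; apply hz).
    rewrite bprod_zero. simpl. rewrite (Lval_LI z l 0 d hz hc hi). ring.
  - split; [|repeat constructor; auto]. split; [apply repeat_length|].
    simpl. rewrite app_nil_r, list_sum_zero. repeat split; auto.
Qed.

Fixpoint diag (ns : list nat) : list entry :=
  match ns with [] => [] | n :: ns' => Entry n 1 1 :: map shift (diag ns') end.
Lemma diag_index ns : map index (diag ns) = ns.
Proof. induction ns; simpl; auto. now rewrite map_index_shift, IHns. Qed.

Lemma diag_increasing ns : increasing_in 0 (length ns) (diag ns).
Proof.
  induction ns; simpl; auto. split; [lia|split; [lia|]]. now apply increasing_shift.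
Qed.

Lemma diag_arg ns z : length ns = length z -> map (arg z) (diag ns) = z.
Proof.
  revert z; induction ns as [|n ns IH]; intros [|z1 z] h; try discriminate; auto.
  injection h as h. cbn [diag map]. rewrite (map_arg_shift z1 z _ _ _ (diag_increasing ns)), IH by auto.
  f_equal. unfold arg. simpl. apply zprod_cons_11.
Qed.

Lemma diag_contiguous ns : contiguous (diag ns).
Proof.
  induction ns as [|n ns IH]; simpl; auto. split; [|now apply contiguous_shift].
  destruct ns; simpl; auto.
Qed.

Lemma diag_length ns : length (diag ns) = length ns.
Proof. induction ns; simpl; auto. now rewrite length_map, IHns. Qed.

Lemma Forall_index ns l : map index l = ns -> Forall (fun m => (1 <= m)%nat) ns -> Forall (fun e => (1 <= index e)%nat) l.
Proof. intros <- h. now rewrite Forall_map in h. Qed.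

Lemma Zspan_LI d ns : (1 <= d)%nat -> length ns = d -> Forall (fun m => (1 <= m)%nat) ns ->
  Zspan d (list_sum ns) d (LI ns).
Proof.
  intros hd hl hn. eapply Zspan_ext; [|apply (Zspan_single d (list_sum ns) d (diag ns))].
  - intros z hz. cbv beta. rewrite diag_index, diag_arg; auto. rewrite hl. symmetry. apply hz.
  - apply diag_contiguous.
  - destruct ns; [simpl in hl; lia|discriminate].
  - rewrite <- hl. apply diag_increasing.
  - apply (Forall_index ns); auto. apply diag_index.
  - rewrite diag_length; lia.
  - now rewrite diag_index.
Qed.

Lemma Zspan_LI_merged d n ns : length ns = d -> (1 <= n)%nat -> Forall (fun m => (1 <= m)%nat) ns ->
  Zspan (S d) (n + list_sum ns) (S (S d)) (fun z => LI (n :: ns) (nth 0 z 0 * nth 1 z 0 :: tl (tl z))).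
Proof.
  intros hl hn hns.
  set (l := Entry n 1 2 :: map shift (map shift (diag ns))).
  assert (hix : map index l = n :: ns) by (simpl; now rewrite !map_index_shift, diag_index).
  eapply Zspan_ext; [|apply (Zspan_single (S d) (n + list_sum ns) (S (S d)) l)].
  - intros [|z1 [|z2 z]] hz; try (destruct hz; discriminate). cbn [nth tl]. rewrite hix. f_equal.
    cbn [l map]. f_equal.
    + unfold arg. simpl. rewrite zprod_cons_1, zprod_cons_11 by lia. reflexivity.
    + rewrite (map_arg_shift z1 (z2 :: z) _ 1 (S (length ns))), (map_arg_shift z2 z _ 0 (length ns)).
      * apply diag_arg. rewrite hl. destruct hz as [hz _]. simpl in hz. lia.
      * apply diag_increasing.
      * apply increasing_shift, diag_increasing.
  - split; [|apply contiguous_shift, contiguous_shift, diag_contiguous]. destruct ns; simpl; auto.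
  - discriminate.
  - split; [simpl; lia|]. split; [simpl; lia|]. simpl right_end. rewrite <- hl.
    apply increasing_shift, increasing_shift, diag_increasing.
  - apply (Forall_index (n :: ns)); auto.
  - simpl. rewrite !length_map, diag_length. lia.
  - rewrite hix. reflexivity.
Qed.

Lemma generator_cons2 d ka kb k b z1 z2 zt : length k = d -> length zt = d ->
  generator (S (S d)) (ka :: kb :: k) b (z1 :: z2 :: zt) =
  beta ka (Cprod (z1 :: z2 :: zt)) * (beta kb (Cprod (z2 :: zt)) * bprod k zt) *
    Cprod (map (Lval (z1 :: z2 :: zt)) b).
Proof. intros h1 h2. rewrite generator_eq by (simpl; lia). reflexivity. Qed.

Lemma good_generator_cons2 D w d ka kb k e t b l : length k = d -> contiguous (e :: t) ->
  Forall (fun l : list entry => l <> []) b -> Forall contiguous b -> t ++ concat b = map shift l ->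
  (1 <= index e)%nat -> Forall (fun e => (1 <= index e)%nat) l -> left_end e = 1%nat ->
  (1 <= right_end e <= S (S d))%nat -> increasing_in (right_end e - 1) (S d) l -> (length l < D)%nat ->
  (ka + kb + list_sum k + (index e + list_sum (map index l)) = w)%nat ->
  good_generator D w (S (S d)) (ka :: kb :: k) ((e :: t) :: b).
Proof.
  intros hk hc hne hcon hl he hx h1 hr hinc hD hw. split; [|constructor; auto].
  split; [simpl; lia|]. split; [constructor; auto; discriminate|].
  cbn [concat app map length]. rewrite hl, map_index_shift, length_map.
  split; [constructor; auto; now apply Forall_index_shift|].
  split; [|simpl; lia]. split; [lia|]. split; [lia|].
  replace (right_end e) with (S (right_end e - 1)) by lia. now apply increasing_shift.
Qed.

Lemma map_arg_tail x y z l d : increasing_in 1 d l -> map (arg (x :: z)) l = map (arg (y :: z)) l.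
Proof.
  intros h. apply map_ext_in. intros e he.
  assert (hb := increasing_bounds _ _ _ h). rewrite Forall_forall in hb. specialize (hb e he).
  unfold arg. destruct (left_end e) as [|[|i]]; [lia|lia|]. destruct (right_end e) as [|j]; [lia|].
  now rewrite !zprod_cons_S by lia.
Qed.

Lemma Lval_depth_one n z1 z : off_ray z1 -> Lval (z1 :: z) [Entry n 1 1] = Lis n z1 0%R.
Proof.
  intros h. assert (e : arg (z1 :: z) (Entry n 1 1) = z1) by (unfold arg; simpl; apply zprod_cons_11).
  unfold Lval. cbn [map index]. rewrite e, Li_eq_LI, LI_cons; auto.
  - simpl. f_equal. ring.
  - simpl. constructor; [|constructor]. now rewrite Cmult_1_r.
Qed.

Lemma geom_decaying z : off_ray z -> decaying (geom z).
Proof. intros h. now apply global_decay_decaying, geom_global_decay, off_ray_pole_free. Qed.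

(* No factor involves the first variable: a new factor [Li_n(z_1)] is created. *)
Lemma insert_first_free n D w d k b : (1 <= n)%nat -> good_generator D w (S d) k b -> increasing_in 1 (S d) (concat b) ->
  exists l, good_generators (S D) (w + n) (S (S d)) l /\
  forall z1 z2 zt, domain (S (S d)) (z1 :: z2 :: zt) ->
    let K := fun sigma => geom z1 sigma *
      (generator (S d) k b (z2 :: zt) - generator (S d) k b (z1 * z2 * RtoC (exp (- sigma)) :: zt)) in
    decaying K /\ tail_iter n K 0%R = comb_value (S (S d)) l (z1 :: z2 :: zt).
Proof.
  intros hn [[hk [hne [hix [hinc [hD hw]]]]] hcon] hfree.
  destruct k as [|k1 k]; [discriminate|]. injection hk as hk.
  destruct (tail_iter_chain_expand (-1) n k1) as [l1 [hl1 Hl1]].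
  set (bs := map (map shift) b).
  exists ((1%Z, (O :: k1 :: k, [Entry n 1 1] :: bs)) ::
    map (fun q => ((- fst q)%Z, ((k1 - snd q)%nat :: O :: k, [Entry (n + snd q) 1 1] :: bs))) l1).
  assert (hadm : forall m ka kb, (n <= m)%nat -> (ka + kb + m = k1 + n)%nat ->
    good_generator (S D) (w + n) (S (S d)) (ka :: kb :: k) ([Entry m 1 1] :: bs)).
  { intros m ka kb hm hs. apply good_generator_cons2 with (concat b); auto.
    - repeat split.
    - now apply Forall_nonempty_shift.
    - now apply Forall_contiguous_shift.
    - symmetry. apply concat_map.
    - simpl; lia.
    - simpl; lia.
    - lia.
    - simpl in *; lia. }
  split.
  { constructor; [apply hadm; lia|]. rewrite Forall_map. eapply Forall_impl; [|exact hl1].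
    intros [c a] ha. cbn [fst snd] in *. apply hadm; lia. }
  intros z1 z2 zt hdom K.
  assert (h1 : off_ray z1) by apply (domain_head _ _ _ hdom).
  assert (hlen : length zt = d) by (assert (h := proj1 hdom); simpl in h; lia).
  set (P := Cprod zt). set (Y1 := z1 * (z2 * P)).
  assert (hY1 : off_ray Y1) by apply (domain_full _ _ _ hdom).
  set (p := fun (j : nat) (s : R) => beta j (Y1 * RtoC (exp (- s)))).
  assert (hp : chain (-1) p) by now apply beta_chain_decr, off_ray_nonzero.
  set (c := bprod k zt * Cprod (map (Lval (z2 :: zt)) b)).
  assert (hgen : forall x, generator (S d) (k1 :: k) b (x :: zt) = beta k1 (x * P) * c).
  { intros x. rewrite generator_eq by (simpl; lia). cbn [bprod].
    rewrite (Cprod_Lval_tail x z2 zt b (S d) hfree). unfold c. simpl Cprod. fold P. ring. }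
  assert (hfk := geom_decaying z1 h1).
  assert (hpf : decaying (fun s => p k1 s * geom z1 s)) by now apply (chain_decaying (-1)).
  assert (eK : K = fun s => (c * beta k1 (z2 * P)) * geom z1 s + (- c) * (p k1 s * geom z1 s)).
  { apply functional_extensionality; intros s. unfold K. rewrite !hgen. unfold p.
    replace (z1 * z2 * RtoC (exp (- s)) * P) with (Y1 * RtoC (exp (- s))) by (unfold Y1; ring). ring. }
  rewrite eK. split; [apply decaying_plus; now apply decaying_scal|].
  rewrite tail_iter_plus, !tail_iter_scal; auto using decaying_scal.
  rewrite (Hl1 p (geom z1) 0%R hp hfk).
  unfold comb_value. cbn [map Csum fold_right fst snd]. change (fold_right Cplus 0 ?x) with (Csum x).
  rewrite generator_cons2 by auto. rewrite beta_0. cbn [map Cprod fold_right].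
  change (fold_right Cmult 1 ?x) with (Cprod x).
  unfold bs. rewrite (Cprod_Lval_shift z1 (z2 :: zt) b 0 (S d) hinc).
  rewrite Lval_depth_one by auto. f_equal; [unfold c, Lis, P; ring|].
  rewrite <- Csum_scal, map_map. apply Csum_map_ext. intros [c' a] _. cbn [fst snd].
  rewrite generator_cons2 by auto. rewrite beta_0. cbn [map Cprod fold_right].
  change (fold_right Cmult 1 ?x) with (Cprod x).
  rewrite (Cprod_Lval_shift z1 (z2 :: zt) b 0 (S d) hinc).
  rewrite Lval_depth_one by auto. unfold p. rewrite Ropp_0, exp_0, Cmult_1_r.
  rewrite opp_IZR, RtoC_opp. unfold c, Lis, Y1, P. ring.
Qed.

Lemma arg_first x zt e : left_end e = 1%nat -> (1 <= right_end e)%nat ->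
  arg (x :: zt) e = x * Cprod (firstn (right_end e - 1) zt).
Proof.
  intros h1 h2. unfold arg, zprod. rewrite h1. simpl skipn.
  replace (right_end e - 1 + 1)%nat with (S (right_end e - 1)) by lia. reflexivity.
Qed.

(* The first factor starts with the first variable: it is either extended by a new
   argument [z_1], or its first argument absorbs [z_1]. *)
Lemma insert_first_bound n D w d k e1 l b : (1 <= n)%nat -> good_generator D w (S d) k ((e1 :: l) :: b) -> left_end e1 = 1%nat ->
  exists r, good_generators (S D) (w + n) (S (S d)) r /\
  forall z1 z2 zt, domain (S (S d)) (z1 :: z2 :: zt) ->
    let K := fun sigma => geom z1 sigma *
      (generator (S d) k ((e1 :: l) :: b) (z2 :: zt) -
       generator (S d) k ((e1 :: l) :: b) (z1 * z2 * RtoC (exp (- sigma)) :: zt)) in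
    decaying K /\ tail_iter n K 0%R = comb_value (S (S d)) r (z1 :: z2 :: zt).
Proof.
  intros hn [[hk [hne [hix [hinc [hD hw]]]]] hcon] he1.
  destruct k as [|k1 k]; [discriminate|]. injection hk as hk.
  assert (hne' := Forall_inv_tail hne). assert (hc1 := Forall_inv hcon). assert (hcon' := Forall_inv_tail hcon).
  assert (hinc0 := hinc).
  cbn [concat] in hinc, hix, hD, hw. cbn [app] in hinc, hix, hD, hw.
  destruct hinc as [hb1 [hb2 hinc]]. assert (hi1 := Forall_inv hix). assert (hi2 := Forall_inv_tail hix). cbv beta in hi1.
  destruct (increasing_app _ _ _ _ hinc) as [hincl hincb].
  destruct (tail_iter_chain_expand (-1) n k1) as [q1 [hq1 Hq1]].
  set (m1 := index e1) in *. set (r1 := right_end e1) in *.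
  set (bs := map (map shift) b).
  set (el := map shift (e1 :: l)).
  exists ((1%Z, (O :: k1 :: k, [Entry n 1 1] :: el :: bs)) ::
    map (fun q => ((- fst q)%Z, ((k1 - snd q)%nat :: O :: k, [Entry (n + snd q) 1 1] :: el :: bs))) q1 ++
    map (fun q => (fst q, ((k1 - snd q)%nat :: O :: k, (Entry (n + snd q) 1 1 :: el) :: bs))) q1 ++
    map (fun q => (fst q, ((k1 - snd q)%nat :: O :: k, (Entry (n + snd q + m1) 1 (S r1) :: map shift l) :: bs))) q1).
  assert (hcS : contiguous el) by now apply contiguous_shift.
  assert (hnb : Forall (fun l : list entry => l <> []) bs) by now apply Forall_nonempty_shift.
  assert (hcb : Forall contiguous bs) by now apply Forall_contiguous_shift.
  assert (hcat : el ++ concat bs = map shift ((e1 :: l) ++ concat b))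
    by (unfold el, bs; now rewrite <- concat_map, <- map_app).
  assert (hadm1 : forall m ka kb, (n <= m)%nat -> (ka + kb + m = k1 + n)%nat ->
    good_generator (S D) (w + n) (S (S d)) (ka :: kb :: k) ([Entry m 1 1] :: el :: bs)).
  { intros m ka kb hm hs. apply good_generator_cons2 with ((e1 :: l) ++ concat b); auto; try (simpl in *; lia).
    - repeat split.
    - constructor; [discriminate|auto]. }
  assert (hadm2 : forall m ka kb, (n <= m)%nat -> (ka + kb + m = k1 + n)%nat ->
    good_generator (S D) (w + n) (S (S d)) (ka :: kb :: k) ((Entry m 1 1 :: el) :: bs)).
  { intros m ka kb hm hs. apply good_generator_cons2 with ((e1 :: l) ++ concat b); auto; try (simpl in *; lia).
    split; [|auto]. simpl. now rewrite he1. }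
  assert (hadm3 : forall m ka kb, (n <= m)%nat -> (ka + kb + m = k1 + n)%nat ->
    good_generator (S D) (w + n) (S (S d)) (ka :: kb :: k) ((Entry (m + m1) 1 (S r1) :: map shift l) :: bs)).
  { intros m ka kb hm hs. apply good_generator_cons2 with (l ++ concat b); auto; try (simpl in *; lia).
    - unfold bs. now rewrite <- concat_map, <- map_app.
    - simpl right_end. now replace (S r1 - 1)%nat with r1 by lia. }
  split.
  { constructor; [apply hadm1; lia|]. apply Forall_app; split; [|apply Forall_app; split];
      rewrite Forall_map; (eapply Forall_impl; [|exact hq1]); intros [c a] ha; cbn [fst snd] in *.
    - apply hadm1; lia.
    - apply hadm2; lia.
    - apply hadm3; lia. }
  intros z1 z2 zt hdom K.
  assert (h1 : off_ray z1) by apply (domain_head _ _ _ hdom).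
  assert (hlen : length zt = d) by (assert (h := proj1 hdom); simpl in h; lia).
  assert (hdom2 := domain_tail _ _ _ hdom).
  set (P := Cprod zt). set (Y1 := z1 * (z2 * P)).
  assert (hY1 : off_ray Y1) by apply (domain_full _ _ _ hdom).
  set (p := fun (j : nat) (s : R) => beta j (Y1 * RtoC (exp (- s)))).
  assert (hp : chain (-1) p) by now apply beta_chain_decr, off_ray_nonzero.
  set (u := Cprod (firstn (r1 - 1) zt)). set (y := map (arg (z2 :: zt)) l).
  assert (hl1 : increasing_in 1 (S d) l) by (apply (increasing_mono r1); auto; lia).
  assert (hb1' : increasing_in 1 (S d) (concat b)) by (apply (increasing_mono r1); auto; lia).
  assert (hargs : forall x, map (arg (x :: zt)) (e1 :: l) = x * u :: y).
  { intros x. cbn [map]. rewrite arg_first by (auto; lia). unfold y.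
    rewrite (map_arg_tail x z2 zt l (S d) hl1). reflexivity. }
  assert (hince : increasing_in 0 (S d) (e1 :: l)) by (split; [lia|split; auto]).
  set (ms := map index l).
  assert (hLv : forall x, domain (S d) (x :: zt) -> Lval (x :: zt) (e1 :: l) = LI (m1 :: ms) (x * u :: y)).
  { intros x hx. rewrite (Lval_LI _ _ 0 (S d) hx hc1 hince), hargs. reflexivity. }
  assert (hargs2 : map (arg (z1 :: z2 :: zt)) (Entry n 1 1 :: el) = z1 :: z2 * u :: y).
  { cbn [map]. unfold el. rewrite (map_arg_shift z1 (z2 :: zt) _ 0 (S d) hince), hargs.
    f_equal. unfold arg; simpl. apply zprod_cons_11. }
  assert (hcum : Forall off_ray (suffix_prods (z1 :: z2 * u :: y))).
  { rewrite <- hargs2. apply (contiguous_off_ray _ _ 0 (S (S d)) hdom).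
    - split; auto. simpl. now rewrite he1.
    - split; [simpl; lia|]. split; [simpl; lia|]. apply (increasing_shift 0); auto. }
  set (A := LI (m1 :: ms) (z2 * u :: y)).
  set (LB := fun s => LI (m1 :: ms) (z1 * (z2 * u) * RtoC (exp (- s)) :: y)).
  destruct (fun j => LI_first_variable j m1 ms z1 (z2 * u) y hi1 h1 hcum) with (j := O) as [hWh _].
  assert (hIh := fun j => proj2 (LI_first_variable j m1 ms z1 (z2 * u) y hi1 h1 hcum)).
  cbv zeta in hIh. cbv zeta in hWh.
  fold A in hIh, hWh.
  set (h := fun sigma => geom z1 sigma * A - (1 + geom z1 sigma) * LI (m1 :: ms) (z1 * (z2 * u) * RtoC (exp (- sigma)) :: y)) in *.
  assert (hcum' : Forall off_ray (suffix_prods (z1 * (z2 * u) :: y))).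
  { inversion hcum as [|? ? g1 g2]; subst. inversion g2; subst. constructor; auto.
    replace (z1 * (z2 * u) * Cprod y) with (z1 * Cprod (z2 * u :: y)) by (simpl; ring). exact g1. }
  assert (hWB := proj1 (LI_tail_iter 0 m1 ms (z1 * (z2 * u)) y hi1 hcum')). fold LB in hWB.
  assert (hIB := fun j => proj2 (LI_tail_iter j m1 ms (z1 * (z2 * u)) y hi1 hcum')). fold LB in hIB.
  set (c := bprod k zt * Cprod (map (Lval (z2 :: zt)) b)).
  assert (hgen : forall x, domain (S d) (x :: zt) ->
    generator (S d) (k1 :: k) ((e1 :: l) :: b) (x :: zt) = beta k1 (x * P) * c * LI (m1 :: ms) (x * u :: y)).
  { intros x hx. rewrite generator_eq by (simpl; lia). cbn [bprod map Cprod fold_right].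
    change (fold_right Cmult 1 ?v) with (Cprod v). rewrite (hLv x hx).
    rewrite (Cprod_Lval_tail x z2 zt b (S d) hb1'). unfold c. fold P. ring. }
  assert (hfk := geom_decaying z1 h1).
  assert (hpf : decaying (fun s => p k1 s * geom z1 s)) by now apply (chain_decaying (-1)).
  assert (hhB : decaying (fun s => h s + LB s)) by now apply decaying_plus.
  assert (hphB : decaying (fun s => p k1 s * (h s + LB s))) by now apply (chain_decaying (-1)).
  assert (eK : K = fun s => ((c * beta k1 (z2 * P) * A) * geom z1 s + (- (c * A)) * (p k1 s * geom z1 s))
      + c * (p k1 s * (h s + LB s))).
  { apply functional_extensionality; intros s. unfold K. rewrite hgen by auto.
    rewrite hgen by (apply domain_merge; auto; apply exp_pos). unfold p, h, LB, A.
    replace (z1 * z2 * RtoC (exp (- s)) * P) with (Y1 * RtoC (exp (- s))) by (unfold Y1; ring).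
    replace (z1 * z2 * RtoC (exp (- s)) * u) with (z1 * (z2 * u) * RtoC (exp (- s))) by ring. ring. }
  rewrite eK. split; [apply decaying_plus; [apply decaying_plus|]; now apply decaying_scal|].
  rewrite !tail_iter_plus, !tail_iter_scal; auto using decaying_scal, decaying_plus.
  rewrite (Hq1 p (geom z1) 0%R hp hfk), (Hq1 p _ 0%R hp hhB).
  unfold comb_value. cbn [map Csum fold_right fst snd]. change (fold_right Cplus 0 ?x) with (Csum x).
  rewrite !map_app, !Csum_app, !map_map.
  assert (hCb : Cprod (map (Lval (z1 :: z2 :: zt)) bs) = Cprod (map (Lval (z2 :: zt)) b)).
  { apply (Cprod_Lval_shift z1 (z2 :: zt) b r1 (S d) hincb). }
  assert (hLel : Lval (z1 :: z2 :: zt) el = A).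
  { unfold el. rewrite (Lval_shift z1 (z2 :: zt) _ 0 (S d) hince). now apply hLv. }
  assert (hp0 : forall j, p j 0%R = beta j (Cprod (z1 :: z2 :: zt))).
  { intros j. unfold p. rewrite Ropp_0, exp_0, Cmult_1_r. reflexivity. }
  assert (hL2 : forall a, Lval (z1 :: z2 :: zt) (Entry (n + a) 1 1 :: el) = tail_iter (n + a) h 0%R).
  { intros a. rewrite hIh. rewrite (Lval_LI _ _ 0 (S (S d)) hdom).
    - change (map (arg (z1 :: z2 :: zt)) (Entry (n + a) 1 1 :: el)) with (map (arg (z1 :: z2 :: zt)) (Entry n 1 1 :: el)).
      rewrite hargs2. unfold el. cbn [map index]. rewrite map_index_shift. reflexivity.
    - split; auto. simpl. now rewrite he1.
    - split; [simpl; lia|]. split; [simpl; lia|]. apply (increasing_shift 0); auto. }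
  assert (hL3 : forall a, Lval (z1 :: z2 :: zt) (Entry (n + a + m1) 1 (S r1) :: map shift l) = tail_iter (n + a) LB 0%R).
  { intros a. rewrite hIB. rewrite (Lval_LI _ _ 0 (S (S d)) hdom).
    - cbn [map index]. rewrite map_index_shift. rewrite (map_arg_shift z1 (z2 :: zt) l r1 (S d) hincl).
      fold y ms. rewrite Ropp_0, exp_0, Cmult_1_r. do 2 f_equal.
      unfold arg. cbn [left_end right_end]. rewrite zprod_cons_1 by (unfold r1; lia).
      f_equal. assert (e := arg_first z2 zt e1 he1 ltac:(lia)). unfold arg in e. rewrite he1 in e. exact e.
    - destruct hc1 as [hc1 hc2]. split; [|now apply contiguous_shift].
      destruct l; simpl in *; auto.
    - split; [simpl; lia|]. split; [simpl; lia|]. simpl. now apply increasing_shift. }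
  rewrite generator_cons2 by auto. cbn [map Cprod fold_right].
  change (fold_right Cmult 1 ?v) with (Cprod v).
  rewrite hCb, hLel, beta_0, Lval_depth_one by auto.
  rewrite <- !Cplus_assoc. f_equal; [unfold c, Lis; simpl Cprod; fold P; ring|].
  rewrite <- !Csum_scal, <- !Csum_plus. apply Csum_map_ext. intros [c' a] _. cbn [fst snd].
  rewrite !generator_cons2 by auto. cbn [map Cprod fold_right].
  change (fold_right Cmult 1 (map (Lval (z1 :: z2 :: zt)) bs)) with (Cprod (map (Lval (z1 :: z2 :: zt)) bs)).
  rewrite hCb, hLel, hL2, hL3, beta_0, Lval_depth_one by auto.
  rewrite !hp0, tail_iter_plus by auto. rewrite opp_IZR, RtoC_opp.
  unfold c, Lis. cbn [Cprod fold_right]. ring.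
Qed.

Lemma insert_first n D w d k b : (1 <= n)%nat -> good_generator D w (S d) k b ->
  exists l, good_generators (S D) (w + n) (S (S d)) l /\
  forall z1 z2 zt, domain (S (S d)) (z1 :: z2 :: zt) ->
    let K := fun sigma => geom z1 sigma *
      (generator (S d) k b (z2 :: zt) - generator (S d) k b (z1 * z2 * RtoC (exp (- sigma)) :: zt)) in
    decaying K /\ tail_iter n K 0%R = comb_value (S (S d)) l (z1 :: z2 :: zt).
Proof.
  intros hn hadm. assert (hinc := proj1 (proj2 (proj2 (proj2 (proj1 hadm))))).
  destruct b as [|[|e1 l] b].
  - now apply (insert_first_free n D w d k []).
  - destruct hadm as [[_ [hne _]] _]. inversion hne; congruence.
  - destruct (Nat.eq_dec (left_end e1) 1) as [he|he].
    + now apply (insert_first_bound n D w d k e1 l b).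
    + apply (insert_first_free n D w d k); auto.
      destruct hinc as [h1 [h2 h3]]. split; [lia|split; auto].
Qed.

Lemma sign_ZtoC n : exists c : Z, (- (1)) ^ n = ZtoC c.
Proof.
  induction n as [|n [c IH]]; [now exists 1%Z|].
  exists (- c)%Z. simpl. rewrite IH, opp_IZR, RtoC_opp. ring.
Qed.

Lemma LI_inv_PLI ns zs : LI ns (map Cinv zs) = parity_sign ns * (LI ns zs - PLI ns zs).
Proof.
  unfold PLI. replace (parity_sign ns * (LI ns zs - (LI ns zs - parity_sign ns * LI ns (map Cinv zs))))
    with ((parity_sign ns * parity_sign ns) * LI ns (map Cinv zs)) by ring.
  unfold parity_sign. rewrite sign_sq. ring.
Qed.

Lemma Forall2_le_length ns ms : Forall2 le ns ms -> length ms = length ns.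
Proof. induction 1; simpl; auto. Qed.

Lemma Forall2_le_pos ns ms : Forall2 le ns ms -> Forall (fun m => (1 <= m)%nat) ns -> Forall (fun m => (1 <= m)%nat) ms.
Proof. induction 1; intros h; inversion h; subst; constructor; auto; lia. Qed.

Definition parity_claim (d : nat) : Prop := forall ns, length ns = S d ->
  Forall (fun m => (1 <= m)%nat) ns -> Zspan d (list_sum ns) (S d) (PLI ns).

Lemma Zspan_LI_inv d ns : parity_claim d -> length ns = S d -> Forall (fun m => (1 <= m)%nat) ns ->
  Zspan (S d) (list_sum ns) (S d) (fun z => LI ns (map Cinv z)).
Proof.
  intros IH hl hn. destruct (sign_ZtoC (list_sum ns + length ns)) as [c hc].
  apply (Zspan_ext _ _ _ (fun z => ZtoC c * (LI ns z + ZtoC (-1) * PLI ns z))).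
  - intros z _. rewrite LI_inv_PLI. unfold parity_sign. rewrite hc.
    replace (ZtoC (-1)) with (- (1)) by (apply C_eq; simpl; ring). ring.
  - apply Zspan_scal, Zspan_plus; [apply Zspan_LI; auto; lia|].
    apply Zspan_scal, (Zspan_depth d); auto.
Qed.

Lemma Zspan_polar d n ns : parity_claim d -> length ns = S d -> Forall (fun m => (1 <= m)%nat) ns ->
  Zspan (S d) (n + list_sum ns) (S (S d))
    (fun z => steps (inv_kernels ns (tl z)) (fun s => beta n (Cprod z * RtoC (exp s))) 0%R).
Proof.
  intros IH hl hn. destruct (steps_chain_expand 1 ns n) as [l [hfl Hl]].
  apply (Zspan_ext _ _ _ (fun z => Csum (map (fun q => ZtoC (fst q) *
    (beta (fst (snd q)) (Cprod z) * LI (snd (snd q)) (map Cinv (tl z)))) l))).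
  - intros [|z1 z] hz; [destruct hz; discriminate|]. cbn [tl].
    assert (hY := domain_full _ _ _ hz). assert (hzi := domain_inv _ _ (domain_tail _ _ _ hz)).
    set (Y := Cprod (z1 :: z)) in *.
    assert (hlen : length (suffix_prods (map Cinv z)) = length ns).
    { rewrite hl. assert (e : forall l, length (suffix_prods l) = length l) by (induction l0; simpl; auto).
      rewrite e, length_map. assert (h := proj1 hz). simpl in h. lia. }
    assert (hok : Forall pole_free (suffix_prods (map Cinv z))).
    { eapply Forall_impl; [|apply (domain_suffix_prods _ _ hzi)]. apply off_ray_pole_free. }
    assert (hb : bounded (fun _ : R => RtoC 1)).
    { split; [apply contC_const|]. exists 1%R. intros. rewrite Cmod_1; lra. }
    assert (e := Hl _ (fun k s => beta k (Y * RtoC (exp s))) _ hlen hok (beta_chain_incr Y (off_ray_nonzero _ hY)) hb).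
    unfold inv_kernels. cbv beta in e.
    replace (fun s => beta n (Y * RtoC (exp s))) with (fun s => beta n (Y * RtoC (exp s)) * 1)
      by (apply functional_extensionality; intros; ring).
    rewrite e. apply Csum_map_ext. intros q _. rewrite exp_0, Cmult_1_r. reflexivity.
  - apply (Zspan_Csum (S d) (n + list_sum ns) (S (S d)) (fun q z => ZtoC (fst q) *
      (beta (fst (snd q)) (Cprod z) * LI (snd (snd q)) (map Cinv (tl z))))).
    intros [c [j ms]] hq. rewrite Forall_forall in hfl. specialize (hfl _ hq). cbn [fst snd] in *.
    destruct hfl as [h2 hw]. apply Zspan_scal.
    replace (n + list_sum ns)%nat with (list_sum ms + j)%nat by lia.
    apply (Zspan_cons_beta (S d) (list_sum ms) (S d) j (fun z => LI ms (map Cinv z))).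
    apply Zspan_LI_inv; auto.
    + rewrite (Forall2_le_length _ _ h2). auto.
    + apply (Forall2_le_pos _ _ h2 hn).
Qed.

Definition first_integrand (f : list C -> C) (z : list C) (sigma : R) : C :=
  geom (nth 0 z 0) sigma *
    (f (tl z) - f (nth 0 z 0 * nth 1 z 0 * RtoC (exp (- sigma)) :: tl (tl z))).

Lemma Zspan_first_integral d D w n f : (1 <= n)%nat -> Zspan D w (S d) f ->
  Zspan (S D) (w + n) (S (S d)) (fun z => tail_iter n (first_integrand f z) 0%R).
Proof.
  intros hn [l [hl hf]].
  assert (hins : forall q, In q l -> exists r, good_generators (S D) (w + n) (S (S d)) r /\
    forall z1 z2 zt, domain (S (S d)) (z1 :: z2 :: zt) ->
      decaying (first_integrand (generator (S d) (fst (snd q)) (snd (snd q))) (z1 :: z2 :: zt)) /\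
      tail_iter n (first_integrand (generator (S d) (fst (snd q)) (snd (snd q))) (z1 :: z2 :: zt)) 0%R
        = comb_value (S (S d)) r (z1 :: z2 :: zt)).
  { intros q hq. unfold good_generators in hl. rewrite Forall_forall in hl.
    exact (insert_first n D w d _ _ hn (hl q hq)). }
  apply (Zspan_ext _ _ _ (fun z => Csum (map (fun q => ZtoC (fst q) *
    tail_iter n (first_integrand (generator (S d) (fst (snd q)) (snd (snd q))) z) 0%R) l))).
  - intros [|z1 [|z2 zt]] hz; try (destruct hz; discriminate).
    assert (hW : forall q, In q l -> decaying (first_integrand (generator (S d) (fst (snd q)) (snd (snd q))) (z1 :: z2 :: zt))).
    { intros q hq. destruct (hins q hq) as [r [_ hr]]. now apply hr. }
    replace (first_integrand f (z1 :: z2 :: zt)) with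
      (fun s => Csum (map (fun q => ZtoC (fst q) *
         first_integrand (generator (S d) (fst (snd q)) (snd (snd q))) (z1 :: z2 :: zt) s) l)).
    + rewrite (tail_iter_Csum n (fun q s => ZtoC (fst q) *
         first_integrand (generator (S d) (fst (snd q)) (snd (snd q))) (z1 :: z2 :: zt) s)).
      * apply Csum_map_ext. intros q hq. now rewrite tail_iter_scal by auto.
      * intros q hq. apply decaying_scal; auto.
    + apply functional_extensionality; intros s. unfold first_integrand. cbn [nth tl].
      rewrite (hf (z2 :: zt)) by apply (domain_tail _ _ _ hz).
      rewrite hf by (apply domain_merge; auto; apply exp_pos).
      unfold comb_value. 
      match goal with |- _ = ?a * (?b - ?c) => replace (a * (b - c)) with (a * b + (- a) * c) by ring end.
      rewrite <- !Csum_scal, <- Csum_plus. symmetry. apply Csum_map_ext. intros q _. ring.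
  - apply (Zspan_Csum (S D) (w + n) (S (S d)) (fun q z => ZtoC (fst q) *
      tail_iter n (first_integrand (generator (S d) (fst (snd q)) (snd (snd q))) z) 0%R)).
    intros q hq. apply Zspan_scal. destruct (hins q hq) as [r [hr1 hr2]].
    exists r. split; auto. intros [|z1 [|z2 zt]] hz; try (destruct hz; discriminate). now apply hr2.
Qed.

Lemma parity_all d : parity_claim d.
Proof.
  induction d as [|d IH]; intros ns hl hn.
  - destruct ns as [|n [|]]; try discriminate.
    apply (Zspan_ext _ _ _ (fun z => ZtoC (-1) * generator 1 [n] [] z)).
    + intros [|z [|]] hz; try (destruct hz; discriminate).
      assert (h := domain_head _ _ _ hz).
      rewrite generator_eq by reflexivity. unfold PLI. cbn [map].
      rewrite !LI_cons. cbn [suffix_prods map combine steps bprod Cprod fold_right].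
      rewrite !Cmult_1_r. rewrite parity_sign_cons. unfold parity_sign. 
      assert (J := jonquiere n z 0 h). rewrite Ropp_0, exp_0, Cmult_1_r in J.
      replace (ZtoC (-1)) with (- (1)) by (apply C_eq; simpl; ring).
      replace (- (1) * beta n z) with (- beta n z) by ring. rewrite <- J. simpl. ring.
    + apply Zspan_scal, Zspan_gen. split; [|constructor]. repeat split; auto.
      simpl. lia.
  - destruct ns as [|n1 [|n2 ns]]; try discriminate.
    assert (hn1 := Forall_inv hn). assert (hn' := Forall_inv_tail hn). cbv beta in hn1.
    assert (hn2 := Forall_inv hn'). assert (hn'' := Forall_inv_tail hn'). cbv beta in hn2.
    assert (hl' : length (n2 :: ns) = S d) by (simpl in *; lia).
    destruct n2 as [|m2]; [lia|].
    destruct (sign_ZtoC (list_sum (S m2 :: ns) + length (S m2 :: ns))) as [c hc].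
    apply (Zspan_ext _ _ _ (fun z =>
      (ZtoC (-1) * LI ((n1 + S m2)%nat :: ns) (nth 0 z 0 * nth 1 z 0 :: tl (tl z)) +
       ZtoC (- c) * steps (inv_kernels (S m2 :: ns) (tl z)) (fun s => beta n1 (Cprod z * RtoC (exp s))) 0%R) +
       tail_iter n1 (first_integrand (PLI (S m2 :: ns)) z) 0%R)).
    + intros [|z1 [|z2 zt]] hz; try (destruct hz; discriminate).
      rewrite (proj2 (parity_step n1 m2 ns z1 z2 zt d hz)). cbn [nth tl].
      unfold parity_sign. rewrite hc, opp_IZR, RtoC_opp.
      replace (ZtoC (-1)) with (- (1)) by (apply C_eq; simpl; ring).
      unfold first_integrand. cbn [nth tl]. change (Cprod (z1 :: z2 :: zt)) with (z1 * (z2 * Cprod zt)). ring.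
    + apply Zspan_plus; [apply Zspan_plus|].
      * apply Zspan_scal.
        replace (list_sum (n1 :: S m2 :: ns)) with (n1 + S m2 + list_sum ns)%nat by (simpl; lia).
        apply Zspan_LI_merged; auto; simpl in *; lia.
      * apply Zspan_scal. apply (Zspan_polar d n1 (S m2 :: ns)); auto.
      * replace (list_sum (n1 :: S m2 :: ns)) with (list_sum (S m2 :: ns) + n1)%nat by (simpl; lia).
        apply Zspan_first_integral; auto.
Qed.

Lemma PLi_PLI d ns z : length ns = d -> Forall (fun m => (1 <= m)%nat) ns -> domain d z -> PLi ns z = PLI ns z.
Proof.
  intros hl hn hz. assert (hlz := proj1 hz). assert (hzi := domain_inv d z hz).
  unfold PLi, PLI. rewrite !Li_eq_LI; auto.
  - f_equal. f_equal. f_equal. unfold parity_sign.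
    assert (hle : (length ns <= list_sum ns)%nat).
    { clear -hn. induction hn; simpl; lia. }
    replace (list_sum ns + length ns)%nat with ((list_sum ns - length ns) + (length ns + length ns))%nat by lia.
    rewrite Cpow_add_r, (Cpow_add_r _ (length ns)), sign_sq. ring.
  - rewrite length_map. congruence.
  - apply (domain_suffix_prods _ _ hzi).
  - congruence.
  - apply (domain_suffix_prods _ _ hz).
Qed.

Local Open Scope nat_scope.

Theorem theorem2p5 (d : nat) (n : list nat)
    (hd : 1 <= d) (hlen : length n = d) (hn : Forall (fun m => 1 <= m) n) :
  Lspace (d - 1) (list_sum n) d (PLi n).
Proof.
  apply Zspan_Lspace. destruct d as [|d]; [lia|].
  replace (S d - 1)%nat with d by lia.
  apply (Zspan_ext _ _ _ (PLI n)).
  - intros z hz. symmetry. now apply (PLi_PLI (S d)).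
  - now apply parity_all.
Qed.
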